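(* Let $(F,F_1,F_2,F_0)$ be a differential diamond with the factorization property, and let $(N\rtimes H,R)$ be a split differential embedding problem over $F$ with the property that $R\subseteq F_1$ (as differential $F$-algebras). Assume further that there exists a Picard-Vessiot ring $R_1/F_1$ with differential Galois group $N_{C_{F_1}}$ and with $R_1\subseteq F_0$ (as differential $F_1$-algebras). Then there exists a proper solution to the differential embedding problem $(N\rtimes H,R)$ over $F$.
   Context: A differential diamond $(F,F_1,F_2,F_0)$ is a quadruple of differential fields of characteristic zero with differential inclusions $F\hookrightarrow F_i\hookrightarrow F_0$ ($i=1,2$), forming a commutative square, such that $F=F_1\cap F_2$ inside $F_0$. It has the factorization property if for every $n>0$ every $A\in\mathrm{GL}_n(F_0)$ can be written as $A=A_2^{-1}A_1$ with $A_i\in\mathrm{GL}_n(F_i)$. Let $L$ be a differential field of characteristic zero with field of constants $C_L$. A linear algebraic group over $C_L$ is an affine group scheme of finite type over $C_L$. A Picard-Vessiot ring over $L$ is a differential ring extension $R/L$ of the form $R=L[Z,\det(Z)^{-1}]$ with $Z\in\mathrm{GL}_n(R)$, $\partial(Z)Z^{-1}\in L^{n\times n}$, such that $R$ has no non-trivial differential ideals and $C_R=C_L$. Its differential Galois group is the group scheme $\underline{\mathrm{Aut}}^{\partial}(R/L)$ over $C_L$, sending a $C_L$-algebra $A$ to the group of differential $L\otimes_{C_L}A$-automorphisms of $R\otimes_{C_L}A$ ($A$ constant). To say that $R/L$ has differential Galois group $G$ means that an isomorphism $G\cong\underline{\mathrm{Aut}}^{\partial}(R/L)$ is given. Let $K=C_F$.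 A differential embedding problem over $F$ consists of an epimorphism $G\to H$ of linear algebraic groups over $K$, say with kernel $N$, together with a Picard-Vessiot ring $R/F$ with differential Galois group $H$. It is split if $1\to N\to G\to H\to1$ splits, i.e. $G=N\rtimes H$, and it is then denoted $(N\rtimes H,R)$. A proper solution is a Picard-Vessiot ring $S/F$ with differential Galois group $G$ together with an embedding of differential rings $R\subseteq S$ over $F$ such that under $G\cong\underline{\mathrm{Aut}}^{\partial}(S/F)$ and $H\cong\underline{\mathrm{Aut}}^{\partial}(R/F)$ the map $G\to H$ corresponds to restriction. *)

(* Defs.v *)
From HB Require Import structures.
From mathcomp Require Import all_boot all_algebra boolp.

Set Implicit Arguments.
Unset Strict Implicit.
Unset Printing Implicit Defensive.

Import GRing.Theory.

Local Open Scope ring_scope.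
Local Open Scope quotient_scope.

HB.mixin Record hasDerivation R of GRing.ComUnitRing R := {
  der : R -> R;
  derD_subproof : forall x y, der (x + y) = der x + der y;
  derM_subproof : forall x y, der (x * y) = der x * y + x * der y
}.

#[short(type="diffRingType")]
HB.structure Definition DiffRing :=
  {R of GRing.ComUnitRing R & hasDerivation R}.

#[short(type="diffFieldType")]
HB.structure Definition DiffField :=
  {R of GRing.Field R & hasDerivation R}.

HB.mixin Record isDifferential (R S : diffRingType) (f : R -> S) := {
  rmorph_der : forall x, f (der x) = der (f x)
}.

#[short(type="diffMorphism")]
HB.structure Definition DiffMorphism (R S : diffRingType) :=
  {f of @GRing.RMorphism R S f & @isDifferential R S f}.

Notation "{ 'dmorphism' R -> S }" := (diffMorphism R S)
  (at level 0, R at level 98, S at level 99,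
   format "{ 'dmorphism'  R  ->  S }") : type_scope.

Section DerTheory.
Variable R : diffRingType.
Implicit Types x y : R.

Lemma derD : {morph (@der R) : x y / x + y}.
Proof. exact: derD_subproof. Qed.

Lemma derM x y : der (x * y) = der x * y + x * der y.
Proof. exact: derM_subproof. Qed.

Lemma der0 : der (0 : R) = 0.
Proof. by apply: (@addrI _ (der 0)); rewrite -derD !addr0. Qed.

Lemma derN x : der (- x) = - der x.
Proof. by apply/eqP; rewrite -addr_eq0 -derD addNr der0. Qed.

Lemma derB x y : der (x - y) = der x - der y.
Proof. by rewrite derD derN. Qed.

Lemma der1 : der (1 : R) = 0.
Proof.
have := derM (1 : R) 1; rewrite !mul1r mulr1 => h.
by apply: (@addrI _ (der 1)); rewrite addr0 -h.
Qed.

End DerTheory.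

Section Constants.
Variable L : diffFieldType.

Definition is_constant : {pred L} := fun x => der x == 0.

Fact is_constant_divring : divring_closed is_constant.
Proof.
have derV0 (y : L) : der y = 0 -> der y^-1 = 0.
  move=> dy; have [->|yN0] := eqVneq y 0; first by rewrite invr0 der0.
  have := derM y y^-1; rewrite divff // der1 dy mul0r add0r => /esym/eqP.
  by rewrite mulf_eq0 (negbTE yN0) => /eqP.
split=> [|x y|x y]; rewrite !unfold_in ?der1 //=; move=> /eqP dx /eqP dy.
  by rewrite derB dx dy subr0.
by rewrite derM dx derV0 // mul0r mulr0 addr0.
Qed.

HB.instance Definition _ :=
  GRing.isDivringClosed.Build L is_constant is_constant_divring.

Record constants := Constant {
  const_val :> L;
  const_valP : const_val \in is_constant
}.

HB.instance Definition _ := [isSub for const_val].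
HB.instance Definition _ := [Choice of constants by <:].
HB.instance Definition _ := [SubChoice_isSubIntegralDomain of constants by <:].
HB.instance Definition _ := [SubIntegralDomain_isSubField of constants by <:].

Lemma der_const (c : constants) : der (const_val c) = 0.
Proof. by apply/eqP; case: c. Qed.

End Constants.

Section ConstantsMap.
Variables (L L' : diffFieldType) (f : {dmorphism L -> L'}).

Fact constants_map_subproof (c : constants L) :
  f (const_val c) \in @is_constant L'.
Proof. by rewrite unfold_in -rmorph_der der_const rmorph0. Qed.

Definition constants_map (c : constants L) : constants L' :=
  Constant (constants_map_subproof c).

Fact constants_map_is_zmod_morphism : zmod_morphism constants_map.
Proof. by move=> x y; apply/val_inj; rewrite /= !rmorphB. Qed.

Fact constants_map_is_monoid_morphism : monoid_morphism constants_map.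
Proof.
by split=> [|x y]; apply/val_inj; rewrite /= ?rmorph1 ?rmorphM.
Qed.

HB.instance Definition _ := GRing.isZmodMorphism.Build _ _
  constants_map constants_map_is_zmod_morphism.
HB.instance Definition _ := GRing.isMonoidMorphism.Build _ _
  constants_map constants_map_is_monoid_morphism.

End ConstantsMap.

(* The structure map is kept explicit, so that restriction of scalars is     *)
(* composition; the zero algebra is allowed, which comAlgType excludes.      *)
Record calg (K : fieldType) := CAlg {
  alg_ring :> comPzRingType;
  alg_str : {rmorphism K -> alg_ring}
}.

Record algHom (K : fieldType) (A B : calg K) := AlgHom {
  alg_fun :> {rmorphism A -> B};
  alg_funE : forall k, alg_fun (alg_str A k) = alg_str B k
}.

Section AlgHom.
Variable K : fieldType.

Lemma algHomP (A B : calg K) (f g : algHom A B) : f =1 g -> f = g.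
Proof.
case: f g => [[f cf] fE] [[g cg] gE] /= /funext fg.
subst g; have ec : cf = cg.
  case: cf cg {fE gE} => [[a] [b] ] [[a'] [b']] /=.
  by rewrite (Prop_irrelevance a a') (Prop_irrelevance b b').
by subst cg; rewrite (Prop_irrelevance fE gE).
Qed.

Definition algHom_id (A : calg K) : algHom A A :=
  @AlgHom K A A idfun (fun k => erefl).

Definition algHom_comp (A B C : calg K) (g : algHom B C) (f : algHom A B) :
  algHom A C :=
  @AlgHom K A C (g \o f)
    (fun k => etrans (congr1 g (alg_funE f k)) (alg_funE g k)).

End AlgHom.

Section Restriction.
Variables (K K' : fieldType) (h : {rmorphism K -> K'}).

Definition restrict (A : calg K') : calg K := CAlg (alg_str A \o h).

Definition restrict_hom (A B : calg K') (f : algHom A B) :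
    algHom (restrict A) (restrict B) :=
  @AlgHom K (restrict A) (restrict B) (alg_fun f) (fun k => alg_funE f (h k)).

End Restriction.

(* Negatives come from the scalar -1. *)
Inductive generated (K A : pzRingType) (str : K -> A) (gens : A -> Prop) :
    A -> Prop :=
| gen_scalar k : generated str gens (str k)
| gen_gen x of gens x : generated str gens x
| gen_add x y of generated str gens x & generated str gens y :
    generated str gens (x + y)
| gen_mul x y of generated str gens x & generated str gens y :
    generated str gens (x * y).

Definition finite_type (K : fieldType) (A : calg K) : Prop :=
  exists s : seq A, forall x, generated (alg_str A) (fun y => y \in s) x.

Section Tensor.
Variables (K : fieldType) (B A : calg K).

(* A list of pairs stands for the formal sum of the corresponding pure       *)
(* tensors; [tensor] below is B (x)_K A, in which [pure b a] is b (x) a.         *)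
Inductive tens_rel : seq (B * A) -> seq (B * A) -> Prop :=
| tens_refl s : tens_rel s s
| tens_sym s t of tens_rel s t : tens_rel t s
| tens_trans s t u of tens_rel s t & tens_rel t u : tens_rel s u
| tens_cat s s' t t' of tens_rel s s' & tens_rel t t' :
    tens_rel (s ++ t) (s' ++ t')
| tens_catC s t : tens_rel (s ++ t) (t ++ s)
| tens_0l a : tens_rel [:: (0, a)] [::]
| tens_Dl b b' a : tens_rel [:: (b + b', a)] [:: (b, a); (b', a)]
| tens_Dr b a a' : tens_rel [:: (b, a + a')] [:: (b, a); (b, a')]
| tens_scale k b a :
    tens_rel [:: (alg_str B k * b, a)] [:: (b, alg_str A k * a)].

Definition tens_relb : rel (seq (B * A)) := fun s t => `[< tens_rel s t >].

Fact tens_relb_equiv : equiv_class_of tens_relb.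
Proof.
split=> [s|s t|t s u]; rewrite /tens_relb.
- by apply/asboolP; exact: tens_refl.
- by apply/asboolP/asboolP => /tens_sym.
- by move=> /asboolP h1 /asboolP h2; apply/asboolP; exact: tens_trans h1 h2.
Qed.

Canonical tens_equiv := EquivRelPack tens_relb_equiv.

Definition tensor := {eq_quot tens_equiv}.

HB.instance Definition _ := Choice.on tensor.

Let cls (s : seq (B * A)) : tensor := \pi_({eq_quot tens_equiv}) s.
Let rep (x : tensor) : seq (B * A) :=
  repr (x : {eq_quot tens_equiv}).

Let repK x : cls (rep x) = x.
Proof. by rewrite /cls /rep reprK. Qed.

Let clsP s t : tens_rel s t -> cls s = cls t.
Proof. by move=> h; apply/eqquotP; apply/asboolP. Qed.

Let clsE s : tens_rel (rep (cls s)) s.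
Proof. by have /eqquotP/asboolP := repK (cls s). Qed.

Definition pure (b : B) (a : A) : tensor := cls [:: (b, a)].

Let opps (s : seq (B * A)) : seq (B * A) := [seq (- p.1, p.2) | p <- s].

Definition tens_zero : tensor := cls [::].
Definition tens_add (x y : tensor) : tensor := cls (rep x ++ rep y).
Definition tens_opp (x : tensor) : tensor := cls (opps (rep x)).

Let opps_rel s t : tens_rel s t -> tens_rel (opps s) (opps t).
Proof.
elim=> {s t} => /=.
- by move=> s; exact: tens_refl.
- by move=> s t _; exact: tens_sym.
- by move=> s t u _ h1 _ h2; exact: tens_trans h1 h2.
- by move=> s s' t t' _ h1 _ h2; rewrite /opps !map_cat; exact: tens_cat.
- by move=> s t; rewrite /opps !map_cat; exact: tens_catC.
- by move=> a; rewrite oppr0; exact: tens_0l.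
- by move=> b b' a; rewrite opprD; exact: tens_Dl.
- by move=> b a a'; exact: tens_Dr.
- by move=> k b a; rewrite -mulrN; exact: tens_scale.
Qed.

Let addE s t : tens_add (cls s) (cls t) = cls (s ++ t).
Proof. by apply/clsP/tens_cat; exact: clsE. Qed.

Let oppE s : tens_opp (cls s) = cls (opps s).
Proof. by apply/clsP/opps_rel/clsE. Qed.

Fact tens_addA : associative tens_add.
Proof.
by move=> x y z; rewrite -(repK x) -(repK y) -(repK z) !addE catA.
Qed.

Fact tens_addC : commutative tens_add.
Proof.
by move=> x y; rewrite -(repK x) -(repK y) !addE; apply/clsP/tens_catC.
Qed.

Fact tens_add0 : left_id tens_zero tens_add.
Proof. by move=> x; rewrite -(repK x) addE. Qed.

Fact tens_addN : left_inverse tens_zero tens_opp tens_add.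
Proof.
move=> x; rewrite -(repK x) oppE addE; apply/clsP.
elim: (rep x) => [|[b a] s IHs]; first exact: tens_refl.
rewrite /= -/(opps s).
have h1 : tens_rel [:: (- b, a); (b, a)] [::].
  apply: tens_trans (tens_0l a); rewrite -(addNr b).
  exact/tens_sym/tens_Dl.
have h2 := tens_catC (opps s) [:: (b, a)].
have h3 := tens_cat (tens_cat (tens_refl [:: (- b, a)]) h2) (tens_refl s).
rewrite -!catA /= in h3.
exact: (tens_trans h3 (tens_cat h1 IHs)).
Qed.

HB.instance Definition _ := GRing.isZmodule.Build tensor
  tens_addA tens_addC tens_add0 tens_addN.

Let clsD s t : cls (s ++ t) = cls s + cls t.
Proof. by rewrite -addE. Qed.

Lemma pureDl a : {morph pure^~ a : b b' / b + b'}.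
Proof. by move=> b b'; rewrite /pure -clsD; apply/clsP/tens_Dl. Qed.

Lemma pureDr b : {morph pure b : a a' / a + a'}.
Proof. by move=> a a'; rewrite /pure -clsD; apply/clsP/tens_Dr. Qed.

Lemma pure_scale k b a : pure (alg_str B k * b) a = pure b (alg_str A k * a).
Proof. by apply/clsP/tens_scale. Qed.

Lemma pure0l a : pure 0 a = 0.
Proof. by apply/clsP/tens_0l. Qed.

Lemma tensor_ind (P : tensor -> Prop) :
  P 0 -> (forall b a x, P x -> P (pure b a + x)) -> forall x, P x.
Proof.
move=> P0 PD x; rewrite -(repK x); elim: (rep x) => // -[b a] s.
by move/PD => /(_ b a); rewrite /pure -clsD.
Qed.

Section Lift.
Variable M : zmodType.

Definition balanced (h : B -> A -> M) : Prop :=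
  [/\ forall a, {morph h^~ a : b b' / b + b'},
      forall b, {morph h b : a a' / a + a'}
    & forall k b a, h (alg_str B k * b) a = h b (alg_str A k * a)].

Definition tens_lift (h : B -> A -> M) (x : tensor) : M :=
  \sum_(p <- rep x) h p.1 p.2.

Variable h : B -> A -> M.
Hypothesis hb : balanced h.

Let lift_rel s t : tens_rel s t ->
  \sum_(p <- s) h p.1 p.2 = \sum_(p <- t) h p.1 p.2.
Proof.
have [hDl hDr hZ] := hb.
elim=> {s t} //=.
- by move=> s t u _ -> _ ->.
- by move=> s s' t t' _ h1 _ h2; rewrite !big_cat /= h1 h2.
- by move=> s t; rewrite !big_cat /= addrC.
- move=> a; rewrite big_seq1 big_nil /=.
  by apply: (@addrI _ (h 0 a)); rewrite -hDl !addr0.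
- by move=> b b' a; rewrite !big_cons !big_nil /= !addr0 hDl.
- by move=> b a a'; rewrite !big_cons !big_nil /= !addr0 hDr.
- by move=> k b a; rewrite !big_seq1 /= hZ.
Qed.

Lemma tens_lift_pure b a : tens_lift h (pure b a) = h b a.
Proof. by rewrite /tens_lift (lift_rel (clsE _)) big_seq1. Qed.

Lemma tens_liftD : {morph tens_lift h : x y / x + y}.
Proof.
move=> x y; rewrite {1}/tens_lift -{1}(repK x) -{1}(repK y) -clsD.
by rewrite (lift_rel (clsE _)) big_cat.
Qed.

Lemma tens_lift0 : tens_lift h 0 = 0.
Proof. by apply: (@addrI _ (tens_lift h 0)); rewrite -tens_liftD !addr0. Qed.

End Lift.

Lemma tensor_eq (M : zmodType) (f g : tensor -> M) :
  {morph f : x y / x + y} -> {morph g : x y / x + y} ->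
  (forall b a, f (pure b a) = g (pure b a)) -> f =1 g.
Proof.
move=> fD gD fg.
have z (k : tensor -> M) : {morph k : x y / x + y} -> k 0 = 0.
  by move=> kD; apply: (@addrI _ (k 0)); rewrite -kD !addr0.
by elim/tensor_ind=> [|b a x IH]; rewrite ?z // fD gD fg IH.
Qed.

Let mulh (y : tensor) (b : B) (a : A) : tensor :=
  tens_lift (fun b' a' => pure (b * b') (a * a')) y.

Let mulb b a : balanced (fun b' a' => pure (b * b') (a * a')).
Proof.
split=> [a' x y|b' x y|k b' a']; rewrite ?mulrDr ?pureDl ?pureDr //.
by rewrite mulrCA pure_scale mulrCA.
Qed.

Let mulhb y : balanced (mulh y).
Proof.
split=> [a x z|b x z|k b a]; rewrite /mulh.
- apply: (@tensor_eq _ (fun y => tens_lift _ y) (fun y => tens_lift _ y + tens_lift _ y)).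
  + exact/tens_liftD/mulb.
  + by move=> u v; rewrite !(tens_liftD (mulb _ _)) addrACA.
  + by move=> b' a'; rewrite !(tens_lift_pure (mulb _ _)) mulrDl pureDl.
- apply: (@tensor_eq _ (fun y => tens_lift _ y) (fun y => tens_lift _ y + tens_lift _ y)).
  + exact/tens_liftD/mulb.
  + by move=> u v; rewrite !(tens_liftD (mulb _ _)) addrACA.
  + by move=> b' a'; rewrite !(tens_lift_pure (mulb _ _)) mulrDl pureDr.
- apply: tensor_eq; [exact/tens_liftD/mulb|exact/tens_liftD/mulb|].
  by move=> b' a'; rewrite !(tens_lift_pure (mulb _ _)) -!mulrA pure_scale.
Qed.

Definition tens_mul (x y : tensor) : tensor := tens_lift (mulh y) x.
Definition tens_one : tensor := pure 1 1.

Let mulDl y : {morph tens_mul^~ y : x x' / x + x'}.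
Proof. exact/tens_liftD/mulhb. Qed.

Let mul_pure b a b' a' :
  tens_mul (pure b a) (pure b' a') = pure (b * b') (a * a').
Proof.
by rewrite /tens_mul (tens_lift_pure (mulhb _)) /mulh (tens_lift_pure (mulb _ _)).
Qed.

Let mulDr x : {morph tens_mul x : y y' / y + y'}.
Proof.
move=> y y'.
apply: (@tensor_eq _ (tens_mul^~ (y + y'))
                     (fun x => tens_mul x y + tens_mul x y')).
- exact: mulDl.
- by move=> u v; rewrite !mulDl addrACA.
- move=> b a; rewrite /tens_mul !(tens_lift_pure (mulhb _)) /mulh.
  exact/tens_liftD/mulb.
Qed.

Fact tens_mulC : commutative tens_mul.
Proof.
move=> x y; apply: (@tensor_eq _ (tens_mul^~ y) (tens_mul y)) => // b a.
apply: (@tensor_eq _ (tens_mul _) (tens_mul^~ _)) => // b' a'.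
by rewrite !mul_pure mulrC (mulrC a).
Qed.

Fact tens_mulA : associative tens_mul.
Proof.
move=> x y z.
apply: (@tensor_eq _ (tens_mul^~ (tens_mul y z))
                     (fun x => tens_mul (tens_mul x y) z)) => //.
  by move=> u v; rewrite !mulDl.
move=> b a.
apply: (@tensor_eq _ (fun y => tens_mul _ (tens_mul y z))
                     (fun y => tens_mul (tens_mul _ y) z)).
- by move=> u v; rewrite mulDl mulDr.
- by move=> u v; rewrite mulDr mulDl.
move=> b' a'.
apply: (@tensor_eq _ (fun z => tens_mul _ (tens_mul _ z)) (tens_mul _)) => //.
  by move=> u v; rewrite !mulDr.
by move=> b'' a''; rewrite !mul_pure !mulrA.
Qed.

Fact tens_mul1 : left_id tens_one tens_mul.
Proof.
apply: tensor_eq => // b a.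
by rewrite mul_pure !mul1r.
Qed.

Fact tens_mulDl : left_distributive tens_mul +%R.
Proof. by move=> x x' y; exact: mulDl. Qed.

HB.instance Definition _ := GRing.Zmodule_isComPzRing.Build tensor
  tens_mulA tens_mulC tens_mul1 tens_mulDl.

Lemma pureM b a b' a' : pure b a * pure b' a' = pure (b * b') (a * a').
Proof. exact: mul_pure. Qed.

Lemma pure11 : pure 1 1 = 1. Proof. by []. Qed.

End Tensor.

Section TensorMap.
Variables (K : fieldType) (B B' A A' : calg K).
Variables (phi : algHom B B') (psi : algHom A A').

Definition tens_map : tensor B A -> tensor B' A' :=
  tens_lift (fun b a => pure (phi b) (psi a)).

Fact tens_map_balanced : balanced (fun b a => pure (phi b) (psi a)).
Proof.
split=> [a x y|b x y|k b a]; rewrite ?rmorphD ?pureDl ?pureDr //.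
by rewrite !rmorphM !alg_funE pure_scale.
Qed.

Lemma tens_map_pure b a : tens_map (pure b a) = pure (phi b) (psi a).
Proof. exact: (tens_lift_pure tens_map_balanced). Qed.

Fact tens_map_is_zmod_morphism : zmod_morphism tens_map.
Proof.
move=> x y; apply: (@addIr _ (tens_map y)).
by rewrite -(tens_liftD tens_map_balanced) !subrK.
Qed.

HB.instance Definition _ := GRing.isZmodMorphism.Build _ _
  tens_map tens_map_is_zmod_morphism.

Fact tens_map_is_monoid_morphism : monoid_morphism tens_map.
Proof.
split=> [|x y]; first by rewrite -pure11 tens_map_pure !rmorph1.
apply: (@tensor_eq _ _ _ _ (fun x => tens_map (x * y))
  (fun x => tens_map x * tens_map y)).
- by move=> u v; rewrite mulrDl raddfD.
- by move=> u v; rewrite raddfD mulrDl.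
move=> b a.
apply: (@tensor_eq _ _ _ _ (fun y => tens_map (_ * y))
  (fun y => tens_map _ * tens_map y)).
- by move=> u v; rewrite mulrDr raddfD.
- by move=> u v; rewrite raddfD mulrDr.
by move=> b' a'; rewrite !(pureM, tens_map_pure) !rmorphM.
Qed.

HB.instance Definition _ := GRing.isMonoidMorphism.Build _ _
  tens_map tens_map_is_monoid_morphism.

Lemma tens_mapD : {morph tens_map : x y / x + y}.
Proof. exact: raddfD. Qed.

Lemma tens_mapM : {morph tens_map : x y / x * y}.
Proof. exact: rmorphM. Qed.

End TensorMap.

Record groupFunctor (K : fieldType) := GroupFunctor {
  gf_obj :> calg K -> groupType;
  gf_map : forall A B, algHom A B -> {multiplicative gf_obj A -> gf_obj B};
  gf_map_id : forall A g, gf_map (algHom_id A) g = g;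
  gf_map_comp : forall A B C (f : algHom B C) (f' : algHom A B) g,
    gf_map (algHom_comp f f') g = gf_map f (gf_map f' g)
}.

Record gfHom (K : fieldType) (G H : groupFunctor K) := GFHom {
  gf_app :> forall A, {multiplicative G A -> H A};
  gf_nat : forall A B (f : algHom A B) g,
    gf_app B (gf_map G f g) = gf_map H f (gf_app A g)
}.

Record gfIso (K : fieldType) (G H : groupFunctor K) := GFIso {
  gf_iso :> gfHom G H;
  gf_iso_bij : forall A, bijective (gf_iso A)
}.

(* An affine group scheme of finite type over K, as a group functor         *)
(* represented by a finitely generated K-algebra, the coordinate ring.      *)
Record linAlgGroup (K : fieldType) := LinAlgGroup {
  lag_functor :> groupFunctor K;
  lag_coord : calg K;
  lag_coord_ft : finite_type lag_coord;
  lag_pt : forall A, algHom lag_coord A -> lag_functor A;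
  lag_pt_bij : forall A, bijective (@lag_pt A);
  lag_pt_nat : forall A B (f : algHom A B) (x : algHom lag_coord A),
    gf_map lag_functor f (lag_pt x) = lag_pt (algHom_comp f x)
}.

(* [phi] is an epimorphism (a faithfully flat quotient map) when the dual   *)
(* map K[H] -> K[G], i.e. the image of the universal point of G, is         *)
(* injective.                                                               *)
Definition is_epi (K : fieldType) (G H : linAlgGroup K) (phi : gfHom G H) :
    Prop :=
  forall f : algHom (lag_coord H) (lag_coord G),
    lag_pt f = phi _ (lag_pt (algHom_id (lag_coord G))) -> injective f.

Section Kernel.
Variables (K : fieldType) (G H : groupFunctor K) (phi : gfHom G H).

Section KernelPoints.
Variable A : calg K.

Definition in_ker : {pred G A} := fun g => phi A g == 1%g.

Fact in_ker_group : group_closed in_ker.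
Proof.
have p1 : phi A 1%g = 1%g.
  by apply: (@mulgI _ (phi A 1%g)); rewrite -gmulfM !mulg1.
split=> [|x y]; rewrite !unfold_in ?p1 //= => /eqP hx /eqP hy.
have pV : phi A y^-1%g = 1%g.
  by rewrite -[LHS]mul1g -hy -gmulfM mulgV p1 hy.
by rewrite gmulfM hx pV mulg1.
Qed.

Record kernel_pts := KernelPt {
  ker_val :> G A;
  ker_valP : ker_val \in in_ker
}.

HB.instance Definition _ := [isSub for ker_val].
HB.instance Definition _ := [Choice of kernel_pts by <:].
HB.instance Definition _ :=
  SubChoice_isSubGroup.Build (G A) in_ker kernel_pts in_ker_group.

End KernelPoints.

Section KernelMap.
Variables (A B : calg K) (f : algHom A B).

Fact kernel_map_subproof (g : kernel_pts A) :
  gf_map G f (ker_val g) \in @in_ker B.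
Proof.
rewrite unfold_in gf_nat (eqP (ker_valP g)); apply/eqP.
by apply: (@mulgI _ (gf_map H f 1%g)); rewrite -gmulfM !mulg1.
Qed.

Definition kernel_map (g : kernel_pts A) : kernel_pts B :=
  KernelPt (kernel_map_subproof g).

Fact kernel_map_is_mult : {morph kernel_map : x y / (x * y)%g}.
Proof. by move=> x y; apply/val_inj; rewrite /= gmulfM. Qed.

HB.instance Definition _ :=
  isMultiplicative.Build _ _ kernel_map kernel_map_is_mult.

End KernelMap.

Definition gf_kernel : groupFunctor K.
Proof.
refine (@GroupFunctor K (fun A => kernel_pts A : groupType)
  (fun A B f => @kernel_map A B f : {multiplicative _ -> _}) _ _).
- by move=> A g; apply/val_inj; rewrite /= gf_map_id.
- by move=> A B C f f' g; apply/val_inj; rewrite /= gf_map_comp.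
Defined.

End Kernel.

Definition base_change (K K' : fieldType) (h : {rmorphism K -> K'})
    (G : groupFunctor K) : groupFunctor K'.
Proof.
exact: (@GroupFunctor K' (fun A => G (restrict h A))
  (fun A B f => gf_map G (restrict_hom h f))
  (fun A g => gf_map_id g)
  (fun A B C f f' g => gf_map_comp (restrict_hom h f) (restrict_hom h f') g)).
Defined.

Section PicardVessiot.
Variables (L : diffFieldType) (R : diffRingType) (iota : {dmorphism L -> R}).

Record diff_ideal (I : R -> Prop) : Prop := DiffIdeal {
  diff_ideal0 : I 0;
  diff_idealD : forall x y, I x -> I y -> I (x + y);
  diff_idealM : forall r x, I x -> I (r * x);
  diff_ideal_der : forall x, I x -> I (der x)
}.

Definition diff_simple : Prop :=
  forall I, diff_ideal I -> (forall x, I x -> x = 0) \/ (forall x, I x).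

Definition PV_matrix n (Z : 'M[R]_n) : Prop :=
  [/\ Z \in unitmx,
      exists A : 'M[L]_n, map_mx der Z *m invmx Z = map_mx iota A
    & forall x, generated iota
        (fun y => (exists i j, y = Z i j) \/ y = (\det Z)^-1) x].

Definition is_PV : Prop :=
  [/\ exists n (Z : 'M[R]_n), PV_matrix Z,
      diff_simple
    & forall x : R, der x = 0 -> exists c : constants L, iota (const_val c) = x].

End PicardVessiot.

Definition ext_calg (L : diffFieldType) (R : diffRingType)
    (iota : {dmorphism L -> R}) : calg (constants L) :=
  @CAlg (constants L) R (iota \o val).

Definition base_calg (L : diffFieldType) : calg (constants L) :=
  @CAlg (constants L) L val.

Definition ext_base_hom (L : diffFieldType) (R : diffRingType)
    (iota : {dmorphism L -> R}) : algHom (base_calg L) (ext_calg iota) :=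
  @AlgHom _ (base_calg L) (ext_calg iota) iota (fun k => erefl).

Definition ext_hom (L : diffFieldType) (R S : diffRingType)
    (iotaR : {dmorphism L -> R}) (iotaS : {dmorphism L -> S})
    (e : {dmorphism R -> S}) (eE : forall x, e (iotaR x) = iotaS x) :
    algHom (ext_calg iotaR) (ext_calg iotaS) :=
  @AlgHom _ (ext_calg iotaR) (ext_calg iotaS) e (fun k => eE (val k)).

Section TensorDer.
Variables (L : diffFieldType) (R : diffRingType) (iota : {dmorphism L -> R}).
Local Notation RC := (ext_calg iota).

(* A is constant, so the derivation of R (x) A is der (x) id. *)
Definition tens_der (A : calg (constants L)) : tensor RC A -> tensor RC A :=
  @tens_lift _ RC A _ (fun (r : R) a => @pure _ RC A (der r) a).

Variable A : calg (constants L).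

Fact tens_der_balanced :
  @balanced _ RC A _ (fun (r : R) a => @pure _ RC A (der r) a).
Proof.
split=> [a x y|x a b|k x a]; rewrite ?pureDr //.
  by rewrite -pureDl derD.
rewrite -pure_scale; congr pure.
rewrite [LHS](derM (iota (val k)) (x : R)).
by rewrite -rmorph_der der_const rmorph0 mul0r add0r.
Qed.

Lemma tens_der_pure (r : R) a :
  tens_der (@pure _ RC A r a) = @pure _ RC A (der r) a.
Proof. exact: (tens_lift_pure tens_der_balanced). Qed.

Lemma tens_derD : {morph @tens_der A : x y / x + y}.
Proof. exact: (tens_liftD tens_der_balanced). Qed.

Lemma tens_der_scale (x : tensor RC A) a :
  tens_der (x * pure 1 a) = tens_der x * pure 1 a.
Proof.
move: x; apply: tensor_eq.
- by move=> u v; rewrite mulrDl tens_derD.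
- by move=> u v; rewrite tens_derD mulrDl.
by move=> r b; rewrite tens_der_pure !pureM tens_der_pure !mulr1.
Qed.

End TensorDer.

Lemma tens_der_map (L : diffFieldType) (R : diffRingType)
    (iota : {dmorphism L -> R}) (A A' : calg (constants L)) (psi : algHom A A')
    (x : tensor (ext_calg iota) A) :
  tens_map (algHom_id (ext_calg iota)) psi (tens_der x) =
  tens_der (tens_map (algHom_id (ext_calg iota)) psi x).
Proof.
move: x; apply: tensor_eq.
- by move=> u v; rewrite tens_derD rmorphD.
- by move=> u v; rewrite rmorphD tens_derD.
by move=> r b; rewrite !(tens_der_pure, tens_map_pure).
Qed.

Section DiffAut.
Variables (L : diffFieldType) (R : diffRingType) (iota : {dmorphism L -> R}).
Local Notation RC := (ext_calg iota).
Local Notation LC := (base_calg L).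

Section Points.
Variable A : calg (constants L).

(* [aut_lin]: fixing the image of L (x) A is the same as being linear over   *)
(* it.  The group law is composition, (s * t) x = s (t x).                   *)
Record diffAut := DiffAut {
  aut_fun :> tensor RC A -> tensor RC A;
  aut_inv : tensor RC A -> tensor RC A;
  aut_funK : cancel aut_fun aut_inv;
  aut_invK : cancel aut_inv aut_fun;
  aut_zmod : zmod_morphism aut_fun;
  aut_monoid : monoid_morphism aut_fun;
  aut_der : forall x, aut_fun (tens_der x) = tens_der (aut_fun x);
  aut_lin : forall y : tensor LC A,
    aut_fun (tens_map (ext_base_hom iota) (algHom_id A) y) =
    tens_map (ext_base_hom iota) (algHom_id A) y
}.

HB.instance Definition _ (s : diffAut) :=
  GRing.isZmodMorphism.Build _ _ (aut_fun s) (aut_zmod s).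
HB.instance Definition _ (s : diffAut) :=
  GRing.isMonoidMorphism.Build _ _ (aut_fun s) (aut_monoid s).

Lemma diffAutP (s t : diffAut) : s =1 t -> s = t.
Proof.
case: s t => [f f' fK f'K a b c d] [g g' gK g'K a' b' c' d'] /= fg.
have e : f = g by apply/funext.
subst g; have e : f' = g' by apply/funext => x; rewrite -[x in LHS]g'K fK.
subst g'; congr DiffAut; exact: Prop_irrelevance.
Qed.

HB.instance Definition _ := gen_eqMixin diffAut.
HB.instance Definition _ := gen_choiceMixin diffAut.

Definition diffAut_one : diffAut :=
  @DiffAut id id (fun _ => erefl) (fun _ => erefl) (fun _ _ => erefl)
    (erefl, fun _ _ => erefl) (fun _ => erefl) (fun _ => erefl).

Section Mul.
Variables s t : diffAut.

Fact diffAut_mulK : cancel (s \o t) (aut_inv t \o aut_inv s).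
Proof. by move=> x /=; rewrite !aut_funK. Qed.

Fact diffAut_mulVK : cancel (aut_inv t \o aut_inv s) (s \o t).
Proof. by move=> x /=; rewrite !aut_invK. Qed.

Fact diffAut_mul_der x : (s \o t) (tens_der x) = tens_der ((s \o t) x).
Proof. by rewrite /= !aut_der. Qed.

Fact diffAut_mul_lin (y : tensor LC A) :
  (s \o t) (tens_map (ext_base_hom iota) (algHom_id A) y) =
  tens_map (ext_base_hom iota) (algHom_id A) y.
Proof. by rewrite /= !aut_lin. Qed.

Definition diffAut_mul : diffAut :=
  DiffAut diffAut_mulK diffAut_mulVK (rmorphB (s \o t))
    (rmorphism_monoidP (s \o t)) diffAut_mul_der diffAut_mul_lin.

End Mul.

Section Inv.
Variable s : diffAut.

Let sI : injective s. Proof. exact: can_inj (@aut_funK s). Qed.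

Fact diffAut_inv_zmod : zmod_morphism (aut_inv s).
Proof. by move=> x y; apply: sI; rewrite rmorphB /= !aut_invK. Qed.

Fact diffAut_inv_monoid : monoid_morphism (aut_inv s).
Proof.
by split=> [|x y]; apply: sI; rewrite ?rmorph1 ?rmorphM /= ?aut_invK ?rmorph1.
Qed.

Fact diffAut_inv_der x : aut_inv s (tens_der x) = tens_der (aut_inv s x).
Proof. by apply: sI; rewrite aut_der !aut_invK. Qed.

Fact diffAut_inv_lin (y : tensor LC A) :
  aut_inv s (tens_map (ext_base_hom iota) (algHom_id A) y) =
  tens_map (ext_base_hom iota) (algHom_id A) y.
Proof. by apply: sI; rewrite aut_lin aut_invK. Qed.

Definition diffAut_inv : diffAut :=
  DiffAut (@aut_invK s) (@aut_funK s) diffAut_inv_zmod diffAut_inv_monoid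
    diffAut_inv_der diffAut_inv_lin.

End Inv.

Fact diffAut_mulA : associative diffAut_mul.
Proof. by move=> s t u; exact: diffAutP. Qed.

Fact diffAut_mul1 : left_id diffAut_one diffAut_mul.
Proof. by move=> s; exact: diffAutP. Qed.

Fact diffAut_mulr1 : right_id diffAut_one diffAut_mul.
Proof. by move=> s; exact: diffAutP. Qed.

Fact diffAut_mulV : left_inverse diffAut_one diffAut_inv diffAut_mul.
Proof. by move=> s; apply: diffAutP => x; exact: (@aut_funK s x). Qed.

Fact diffAut_mulrV : right_inverse diffAut_one diffAut_inv diffAut_mul.
Proof. by move=> s; apply: diffAutP => x; exact: (@aut_invK s x). Qed.

HB.instance Definition _ := isGroup.Build diffAut
  diffAut_mulA diffAut_mul1 diffAut_mulr1 diffAut_mulV diffAut_mulrV.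

Lemma diffAut_base (s : diffAut) (l : L) (a : A) :
  s (@pure _ RC A (iota l) a) = @pure _ RC A (iota l) a.
Proof.
have := aut_lin s (@pure _ LC A l a).
by rewrite tens_map_pure.
Qed.

Lemma diffAut_scal (s : diffAut) (a : A) :
  s (@pure _ RC A 1 a) = @pure _ RC A 1 a.
Proof. by have := diffAut_base s 1 a; rewrite rmorph1. Qed.

End Points.

Section Map.
Variables (A A' : calg (constants L)) (psi : algHom A A').
Local Notation tm := (tens_map (algHom_id RC) psi).

(* The A'-linear extension of s: r (x) a' goes to the image of s (r (x) 1)   *)
(* in R (x) A', times a'.                                                    *)
Definition diffAut_ext (s : diffAut A) : tensor RC A' -> tensor RC A' :=
  tens_lift (fun r a => tm (s (pure r 1)) * pure 1 a).

Variable s : diffAut A.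

Fact diffAut_ext_balanced :
  balanced (fun r a => tm (s (pure r 1)) * @pure _ RC A' 1 a).
Proof.
split=> [a x y|r a b|k r a].
- by rewrite pureDl !rmorphD mulrDl.
- by rewrite pureDr mulrDr.
have -> : s (@pure _ RC A (alg_str RC k * r) 1) =
    pure (alg_str RC k) 1 * s (pure r 1).
  rewrite -(diffAut_base s (val k) 1 : s (pure (alg_str RC k) 1) = _).
  by rewrite -(rmorphM s) pureM mul1r.
rewrite tens_mapM tens_map_pure rmorph1 mulrAC mulrC pureM mul1r mulr1.
congr (_ * _); rewrite -[X in pure X _]mulr1; exact: pure_scale.
Qed.

Lemma diffAut_ext_pure r a :
  diffAut_ext s (pure r a) = tm (s (pure r 1)) * pure 1 a.
Proof. exact: (tens_lift_pure diffAut_ext_balanced). Qed.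

Lemma diffAut_extD : {morph diffAut_ext s : x y / x + y}.
Proof. exact: (tens_liftD diffAut_ext_balanced). Qed.

Fact diffAut_ext_zmod : zmod_morphism (diffAut_ext s).
Proof.
by move=> x y; apply: (@addIr _ (diffAut_ext s y)); rewrite -diffAut_extD !subrK.
Qed.

Lemma diffAut_extM x y :
  diffAut_ext s (x * y) = diffAut_ext s x * diffAut_ext s y.
Proof.
move: x; apply: tensor_eq.
- by move=> u v; rewrite mulrDl diffAut_extD.
- by move=> u v; rewrite diffAut_extD mulrDl.
move=> r a; move: y; apply: tensor_eq.
- by move=> u v; rewrite mulrDr diffAut_extD.
- by move=> u v; rewrite diffAut_extD mulrDr.
move=> r' a'; rewrite pureM !diffAut_ext_pure mulrACA pureM !mulr1.
by rewrite -!rmorphM pureM mulr1.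
Qed.

Fact diffAut_ext_monoid : monoid_morphism (diffAut_ext s).
Proof.
split; last exact: diffAut_extM.
by rewrite -pure11 diffAut_ext_pure !pure11 !rmorph1 mulr1.
Qed.

Lemma diffAut_ext_map x : diffAut_ext s (tm x) = tm (s x).
Proof.
move: x; apply: tensor_eq.
- by move=> u v; rewrite rmorphD diffAut_extD.
- by move=> u v; rewrite !rmorphD.
move=> r a; rewrite tens_map_pure diffAut_ext_pure /=.
have -> : @pure _ RC A' 1 (psi a) = tm (s (pure 1 a)).
  by rewrite diffAut_scal tens_map_pure.
by rewrite -!rmorphM pureM mulr1 mul1r.
Qed.

Lemma diffAut_ext_scal a : diffAut_ext s (pure 1 a) = pure 1 a.
Proof. by rewrite diffAut_ext_pure pure11 !rmorph1 mul1r. Qed.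

Fact diffAut_ext_der x : diffAut_ext s (tens_der x) = tens_der (diffAut_ext s x).
Proof.
move: x; apply: tensor_eq.
- by move=> u v; rewrite tens_derD diffAut_extD.
- by move=> u v; rewrite diffAut_extD tens_derD.
move=> r a; rewrite tens_der_pure !diffAut_ext_pure tens_der_scale.
by rewrite -tens_der_map -aut_der tens_der_pure.
Qed.

Fact diffAut_ext_lin (y : tensor LC A') :
  diffAut_ext s (tens_map (ext_base_hom iota) (algHom_id A') y) =
  tens_map (ext_base_hom iota) (algHom_id A') y.
Proof.
move: y; apply: tensor_eq.
- by move=> u v; rewrite rmorphD diffAut_extD.
- by move=> u v; rewrite rmorphD.
move=> l a; rewrite tens_map_pure /= diffAut_ext_pure diffAut_base.
by rewrite tens_map_pure /= rmorph1 pureM mulr1 mul1r.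
Qed.

End Map.

Lemma diffAut_extK (A A' : calg (constants L)) (psi : algHom A A')
    (s t : diffAut A) :
  cancel t s -> cancel (diffAut_ext psi t) (diffAut_ext psi s).
Proof.
move=> tK; apply: (@tensor_eq _ _ _ _
  (fun x => diffAut_ext psi s (diffAut_ext psi t x)) id) => //.
  by move=> u v; rewrite !diffAut_extD.
move=> r a; rewrite diffAut_ext_pure diffAut_extM diffAut_ext_map tK.
by rewrite diffAut_ext_scal tens_map_pure pureM rmorph1 mulr1 mul1r.
Qed.

Definition diffAut_map (A A' : calg (constants L)) (psi : algHom A A')
    (s : diffAut A) : diffAut A' :=
  @DiffAut A' (diffAut_ext psi s) (diffAut_ext psi (diffAut_inv s))
    (@diffAut_extK _ _ psi (diffAut_inv s) s (@aut_funK _ s))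
    (@diffAut_extK _ _ psi s (diffAut_inv s) (@aut_invK _ s))
    (diffAut_ext_zmod psi s) (diffAut_ext_monoid psi s)
    (diffAut_ext_der psi s) (diffAut_ext_lin psi s).

Fact diffAut_map_is_mult (A A' : calg (constants L)) (psi : algHom A A') :
  {morph @diffAut_map A A' psi : s t / (s * t)%g}.
Proof.
move=> s t; apply: diffAutP; apply: tensor_eq.
- exact: diffAut_extD.
- by move=> u v /=; rewrite !diffAut_extD.
move=> r a /=; rewrite !diffAut_ext_pure diffAut_extM diffAut_ext_map.
by rewrite diffAut_ext_scal.
Qed.

HB.instance Definition _ A A' psi := isMultiplicative.Build _ _
  (@diffAut_map A A' psi) (@diffAut_map_is_mult A A' psi).

Fact diffAut_map_id A (s : diffAut A) : diffAut_map (algHom_id A) s = s.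
Proof.
apply: diffAutP; apply: tensor_eq.
- exact: diffAut_extD.
- by move=> u v; rewrite rmorphD.
move=> r a /=; rewrite diffAut_ext_pure.
have -> : tens_map (algHom_id RC) (algHom_id A) =1 id.
  by apply: tensor_eq => // [u v|b c]; rewrite ?rmorphD ?tens_map_pure.
by rewrite -{1}(diffAut_scal s a) -rmorphM pureM mulr1 mul1r.
Qed.

Fact diffAut_map_comp A B C (f : algHom B C) (f' : algHom A B)
    (s : diffAut A) :
  diffAut_map (algHom_comp f f') s = diffAut_map f (diffAut_map f' s).
Proof.
apply: diffAutP; apply: tensor_eq.
- exact: diffAut_extD.
- exact: diffAut_extD.
move=> r a /=; rewrite !diffAut_ext_pure /= diffAut_ext_pure pure11 mulr1.
congr (_ * _); move: (s _); apply: tensor_eq.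
- by move=> u v; rewrite rmorphD.
- by move=> u v; rewrite !rmorphD.
by move=> b c; rewrite !tens_map_pure.
Qed.

Definition diffGal : groupFunctor (constants L) :=
  @GroupFunctor _ (fun A => diffAut A : groupType)
    (fun A B f => @diffAut_map A B f : {multiplicative _ -> _})
    diffAut_map_id diffAut_map_comp.

End DiffAut.

Record diffEmbProblem (F : diffFieldType) := DiffEmbProblem {
  ep_G : linAlgGroup (constants F);
  ep_H : linAlgGroup (constants F);
  ep_pi : gfHom ep_G ep_H;
  ep_pi_epi : is_epi ep_pi;
  ep_R : diffRingType;
  ep_iota : {dmorphism F -> ep_R};
  ep_PV : is_PV ep_iota;
  ep_gal : gfIso ep_H (diffGal ep_iota)
}.

Definition ep_N (F : diffFieldType) (E : diffEmbProblem F) :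
  groupFunctor (constants F) := gf_kernel (ep_pi E).

(* G = N ><| H: the epimorphism G -> H has a homomorphic section. *)
Definition ep_split (F : diffFieldType) (E : diffEmbProblem F) : Prop :=
  exists s : gfHom (ep_H E) (ep_G E), forall A h, ep_pi E A (s A h) = h.

Record properSolution (F : diffFieldType) (E : diffEmbProblem F) :=
    ProperSolution {
  sol_S : diffRingType;
  sol_iota : {dmorphism F -> sol_S};
  sol_PV : is_PV sol_iota;
  sol_gal : gfIso (ep_G E) (diffGal sol_iota);
  sol_emb : {dmorphism ep_R E -> sol_S};
  sol_emb_inj : injective sol_emb;
  sol_embE : forall x, sol_emb (ep_iota E x) = sol_iota x;
  (* the automorphism of R (x) A given by pi(g) is the restriction of the   *)
  (* automorphism of S (x) A given by g                                     *)
  sol_restr : forall A (g : ep_G E A) (x : tensor (ext_calg (ep_iota E)) A),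
    tens_map (ext_hom sol_embE) (algHom_id A) (ep_gal E A (ep_pi E A g) x) =
    sol_gal A g (tens_map (ext_hom sol_embE) (algHom_id A) x)
}.

Definition char0 (F : fieldType) : Prop := [pchar F] =i pred0.

Section Diamond.
Variables (F F1 F2 F0 : diffFieldType).
Variables (i1 : {dmorphism F -> F1}) (i2 : {dmorphism F -> F2}).
Variables (j1 : {dmorphism F1 -> F0}) (j2 : {dmorphism F2 -> F0}).

(* The last clause is F = F1 :&: F2 inside F0. *)
Definition diffDiamond : Prop :=
  [/\ [/\ char0 F, char0 F1, char0 F2 & char0 F0],
      forall x, j1 (i1 x) = j2 (i2 x)
    & forall x1 x2, j1 x1 = j2 x2 -> exists x, i1 x = x1 /\ i2 x = x2].

Definition factorization_property : Prop :=
  forall n (A : 'M[F0]_n), (0 < n)%N -> A \in unitmx ->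
    exists (A1 : 'M[F1]_n) (A2 : 'M[F2]_n),
      [/\ A1 \in unitmx, A2 \in unitmx
        & A = invmx (map_mx j2 A2) *m map_mx j1 A1].

End Diamond.

(* Main.v *)
Require Import Defs.
From HB Require Import structures.
From mathcomp Require Import all_boot all_algebra boolp.
From mathcomp Require classical_sets.

Set Implicit Arguments.
Unset Strict Implicit.
Unset Printing Implicit Defensive.

Import GRing.Theory.

Local Open Scope ring_scope.

(* Write O = F0 (x) K[G] for the coordinate ring of the trivial torsor and let S
   be the set of functions in O that lie both in Ind_N^G(R1) and in
   F2 (x) Ind_H^G(R), the N- and H-equivariant functions; S is a differential
   F-algebra on which G acts by right translation.  If a representation of G
   acts on fundamental matrices Z_N of R1 and Z_H of R, factoring
   Z_H Z_N^-1 = A2^-1 A1 gives a frame Y = A1 Z_N = A2 Z_H with entries in F0,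
   and the coordinates of the representation twisted by Y lie in S.  As
   F = F1 :&: F2, such frames show that S is an F-form of O.  R embeds in S, and
   an element of S invariant under g |-> s(pi(g)) comes from R: this reduces the
   constants of S to those of R, and the simplicity of S to that of R1 and R.
   Finally the F0-linear extension to O of a differential automorphism of S
   preserves constants, hence is a right translation by a point of G. *)

(** * Linear forms and slices of tensors *)

(** The groups may be non-reduced and K need not be algebraically closed, so K-points decide
    nothing: groups are probed at generic points over K[G] and, for a Picard-Vessiot ring R/L, at a
    universal automorphism over the constants of R (x)_L R. Bases of infinite-dimensional algebras
    are replaced by linear forms. Gluing is possible because Z_N and Z_H transform on the right by
    restrictions of one representation of G, while A1 and A2 multiply on the left by scalars. The
    coefficients of an element of S against Y therefore lie in F1, by the first form of Y, and in
    F2, by the second. The splitting enters through g = n s(pi(g)) with n in N: an N-equivariant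
    function is known from its values on s(pi(g)). As F1 may have more constants than K, this
    decomposition is made over C_{F1} (x)_K K[G] and the result is transported back to F0 (x)_K
    K[G]. *)

Section LinearForms.
Variables (K : fieldType) (A : calg K).

Definition is_form (mu : A -> K) : Prop :=
  {morph mu : x y / x + y} /\ forall k x, mu (alg_str A k * x) = k * mu x.

Lemma is_form0 mu : is_form mu -> mu 0 = 0.
Proof. by case=> muD _; apply: (@addrI _ (mu 0)); rewrite -muD !addr0. Qed.

Lemma is_formN mu x : is_form mu -> mu (- x) = - mu x.
Proof.
move=> fm; have [muD _] := fm.
by apply/eqP; rewrite -addr_eq0 -muD addNr is_form0.
Qed.

Lemma is_formB mu x y : is_form mu -> mu (x - y) = mu x - mu y.
Proof. by move=> fm; rewrite (proj1 fm) is_formN. Qed.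

Lemma is_form_sum mu I (r : seq I) (P : pred I) (f : I -> A) : is_form mu ->
  mu (\sum_(i <- r | P i) f i) = \sum_(i <- r | P i) mu (f i).
Proof.
move=> fm; have [muD _] := fm.
exact: (big_morph mu muD (is_form0 fm)).
Qed.

Inductive in_span (X : A -> Prop) : A -> Prop :=
| in_span0 : in_span X 0
| in_spanD k x y of X x & in_span X y : in_span X (alg_str A k * x + y).

Lemma in_span_gen (X : A -> Prop) x : X x -> in_span X x.
Proof.
move=> Xx; rewrite -[x]addr0 -[x]mul1r -(rmorph1 (alg_str A)).
by apply: in_spanD => //; exact: in_span0.
Qed.

Lemma in_span_lin (X : A -> Prop) k x y :
  in_span X x -> in_span X y -> in_span X (alg_str A k * x + y).
Proof.
move=> sx sy; elim: sx => [|l u v Xu sv IH]; first by rewrite mulr0 add0r.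
rewrite mulrDr mulrA -rmorphM -addrA; exact: in_spanD.
Qed.

Lemma in_span_sub (X Y : A -> Prop) x :
  (forall x, X x -> Y x) -> in_span X x -> in_span Y x.
Proof.
by move=> XY; elim=> [|k u v Xu _ IH]; [exact: in_span0|apply: in_spanD; auto].
Qed.

(** Zorn's lemma gives X maximal among the subsets whose span misses [a]. By maximality A is the
    direct sum of that span and K a, and [mu] is the coordinate along [a]. *)
Lemma exists_form (a : A) : a != 0 -> exists2 mu, is_form mu & mu a = 1.
Proof.
move=> a0.
have [X [Xa Xmax]] : exists X, ~ in_span X a /\
    forall Y, classical_sets.proper X Y -> ~ ~ in_span Y a.
  apply: (@classical_sets.Zorn_bigcup A (fun X => ~ in_span X a)) => F FP Ftot.
  move=> sa.
  suff [a0'|[X FX /(FP _ FX)//]] : a = 0 \/ exists2 X, F X & in_span X a.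
    by rewrite a0' eqxx in a0.
  elim: sa => [|k x y [X FX Xx] _ IH]; first by left.
  right; case: IH => [->|[Y FY sy]].
    by exists X => //; apply: in_spanD => //; exact: in_span0.
  have [XY|YX] := Ftot _ _ FX FY.
    by exists Y => //; apply: in_spanD => //; exact: XY.
  by exists X => //; apply: in_spanD => //; exact: in_span_sub sy.
have dec b : exists k, in_span X (b - alg_str A k * a).
  have [sb|nsb] := pselect (in_span X b).
    by exists 0; rewrite rmorph0 mul0r subr0.
  pose Y x := X x \/ x = b.
  have sYa : in_span Y a.
    apply: contrapT; apply: Xmax; split; first by move=> x; left.
    by move=> YX; apply: nsb; apply/in_span_gen/YX; right.
  have [k sk] : exists k, in_span X (a - alg_str A k * b).
    elim: sYa => [|k x y [Xx|->] _ [l sl]].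
    - by exists 0; rewrite rmorph0 mul0r subr0; exact: in_span0.
    - by exists l; rewrite -addrA; exact: in_spanD.
    - by exists (k + l); rewrite rmorphD mulrDl opprD addrACA subrr add0r.
  have k0 : k != 0.
    by apply: contra_notN Xa => /eqP k0; rewrite k0 rmorph0 mul0r subr0 in sk.
  exists k^-1; rewrite -[_ - _]addr0.
  have -> : b - alg_str A k^-1 * a = alg_str A (- k^-1) * (a - alg_str A k * b).
    rewrite mulrBr mulrA -rmorphM mulNr mulVf // !rmorphN rmorph1.
    by rewrite !mulNr mul1r opprK addrC.
  by apply: in_span_lin => //; exact: in_span0.
have uniq b k l : in_span X (b - alg_str A k * a) ->
    in_span X (b - alg_str A l * a) -> k = l.
  move=> sk sl; apply/eqP; rewrite -subr_eq0; apply: contra_notT Xa => kl0.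
  have := in_span_lin (-1) sk sl.
  rewrite rmorphN rmorph1 mulN1r opprB addrA subrK -mulrBl -rmorphB => s.
  have := in_span_lin (k - l)^-1 s (in_span0 X).
  by rewrite addr0 mulrA -rmorphM mulVf // rmorph1 mul1r.
pose mu b := projT1 (cid (dec b)).
have muP b : in_span X (b - alg_str A (mu b) * a) by rewrite /mu; case: cid.
exists mu; first split=> [x y|k x].
- apply: uniq (muP _) _; rewrite rmorphD mulrDl opprD addrACA.
  have := in_span_lin 1 (muP x) (muP y); by rewrite rmorph1 mul1r.
- apply: uniq (muP _) _; rewrite rmorphM -mulrA -mulrBr -[_ * _]addr0.
  by apply: in_span_lin => //; exact: in_span0.
apply: uniq (muP _) _; rewrite rmorph1 mul1r subrr; exact: in_span0.
Qed.

End LinearForms.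

Lemma tensor_seq (K : fieldType) (B A : calg K) (x : tensor B A) :
  exists s : seq (B * A), x = \sum_(p <- s) pure p.1 p.2.
Proof.
elim/tensor_ind: x => [|b a x [s ->]]; first by exists [::]; rewrite big_nil.
by exists ((b, a) :: s); rewrite big_cons.
Qed.

Lemma pure0r (K : fieldType) (B A : calg K) (b : B) : pure b 0 = 0 :> tensor B A.
Proof. by apply: (@addrI _ (pure b 0)); rewrite -pureDr !addr0. Qed.

Section TensorFactors.
Variables (K : fieldType) (B A : calg K).

Definition tens_inl (b : B) : tensor B A := pure b 1.
Definition tens_inr (a : A) : tensor B A := pure 1 a.

Fact tens_inl_zmod : zmod_morphism tens_inl.
Proof.
by move=> x y; apply: (@addIr _ (tens_inl y)); rewrite subrK -pureDl subrK.
Qed.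

Fact tens_inl_monoid : monoid_morphism tens_inl.
Proof. by split=> // x y; rewrite /tens_inl pureM mulr1. Qed.

HB.instance Definition _ := GRing.isZmodMorphism.Build B (tensor B A)
  tens_inl tens_inl_zmod.
HB.instance Definition _ := GRing.isMonoidMorphism.Build B (tensor B A)
  tens_inl tens_inl_monoid.

Fact tens_inr_zmod : zmod_morphism tens_inr.
Proof.
by move=> x y; apply: (@addIr _ (tens_inr y)); rewrite subrK -pureDr subrK.
Qed.

Fact tens_inr_monoid : monoid_morphism tens_inr.
Proof. by split=> // x y; rewrite /tens_inr pureM mulr1. Qed.

HB.instance Definition _ := GRing.isZmodMorphism.Build A (tensor B A)
  tens_inr tens_inr_zmod.
HB.instance Definition _ := GRing.isMonoidMorphism.Build A (tensor B A)
  tens_inr tens_inr_monoid.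

Lemma pureE b a : pure b a = tens_inl b * tens_inr a.
Proof. by rewrite pureM mulr1 mul1r. Qed.

Lemma tens_inlr k : tens_inl (alg_str B k) = tens_inr (alg_str A k).
Proof. by rewrite /tens_inl -[alg_str B k]mulr1 pure_scale mulr1. Qed.

End TensorFactors.

Arguments tens_inl {K B} A b.
Arguments tens_inr {K} B {A} a.

Section TensorLift.
Variables (K : fieldType) (B A : calg K) (M : comPzRingType).
Variables (f : {rmorphism B -> M}) (g : {rmorphism A -> M}).

Definition rlift of (forall k, f (alg_str B k) = g (alg_str A k)) :
    tensor B A -> M :=
  tens_lift (fun b a => f b * g a).

Hypothesis fg : forall k, f (alg_str B k) = g (alg_str A k).

Fact rlift_balanced : balanced (fun b a => f b * g a).
Proof.
split=> [a x y|b x y|k b a]; rewrite ?rmorphD ?mulrDl ?mulrDr //.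
by rewrite !rmorphM fg mulrAC mulrC.
Qed.

Lemma rlift_pure b a : rlift fg (pure b a) = f b * g a.
Proof. exact: (tens_lift_pure rlift_balanced). Qed.

Fact rlift_zmod : zmod_morphism (rlift fg).
Proof.
move=> x y; apply: (@addIr _ (rlift fg y)).
by rewrite -(tens_liftD rlift_balanced) !subrK.
Qed.

HB.instance Definition _ :=
  GRing.isZmodMorphism.Build (tensor B A) M (rlift fg) rlift_zmod.

Fact rlift_monoid : monoid_morphism (rlift fg).
Proof.
split=> [|x y]; first by rewrite -pure11 rlift_pure !rmorph1 mulr1.
move: x; apply: tensor_eq.
- by move=> u v; rewrite mulrDl raddfD.
- by move=> u v; rewrite raddfD mulrDl.
move=> b a; move: y; apply: tensor_eq.
- by move=> u v; rewrite mulrDr raddfD.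
- by move=> u v; rewrite raddfD mulrDr.
by move=> b' a'; rewrite !(pureM, rlift_pure) !rmorphM mulrACA.
Qed.

HB.instance Definition _ :=
  GRing.isMonoidMorphism.Build (tensor B A) M (rlift fg) rlift_monoid.

Lemma rlift_inl b : rlift fg (tens_inl A b) = f b.
Proof. by rewrite rlift_pure rmorph1 mulr1. Qed.

Lemma rlift_inr a : rlift fg (tens_inr B a) = g a.
Proof. by rewrite rlift_pure rmorph1 mul1r. Qed.

End TensorLift.

(* The slices of a tensor by forms on A play the role of its coefficients. *)
Section Slices.
Variables (K : fieldType) (B A : calg K).

Definition slice (mu : A -> K) : tensor B A -> B :=
  tens_lift (fun b a => alg_str B (mu a) * b).

Section Form.
Variables (mu : A -> K) (fm : is_form mu).

Fact slice_balanced : balanced (fun b a => alg_str B (mu a) * b).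
Proof.
have [muD muZ] := fm.
split=> [a x y|b x y|k b a]; first exact: mulrDr.
  by rewrite muD rmorphD mulrDl.
by rewrite muZ rmorphM mulrCA mulrA.
Qed.

Lemma slice_pure b a : slice mu (pure b a) = alg_str B (mu a) * b.
Proof. exact: (tens_lift_pure slice_balanced). Qed.

Lemma sliceD : {morph slice mu : x y / x + y}.
Proof. exact: (tens_liftD slice_balanced). Qed.

Lemma slice0 : slice mu 0 = 0.
Proof. exact: (tens_lift0 slice_balanced). Qed.

Lemma sliceN x : slice mu (- x) = - slice mu x.
Proof. by apply/eqP; rewrite -addr_eq0 -sliceD addNr slice0. Qed.

Lemma slice_sum I (r : seq I) (P : pred I) (f : I -> tensor B A) :
  slice mu (\sum_(i <- r | P i) f i) = \sum_(i <- r | P i) slice mu (f i).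
Proof. exact: (big_morph (slice mu) sliceD slice0). Qed.

Lemma slice_inl b x : slice mu (tens_inl A b * x) = b * slice mu x.
Proof.
move: x; apply: tensor_eq => [u v|u v|c a]; rewrite ?mulrDr ?sliceD ?mulrDr //.
by rewrite pureM mul1r !slice_pure mulrCA.
Qed.

End Form.

(** This replaces the expansion of [x] in a basis of A. If mu a = 1, then b (x) a + sum b_i (x) a_i
    equals p (x) a + sum b_i (x) (a_i - mu(a_i) a), with p the slice of [x] by [mu]. So p satisfies
    [P], and the remaining sum is shorter, with slices still in [P]. *)
Lemma slices_in (P : B -> Prop) (x : tensor B A) :
    P 0 -> (forall k u v, P u -> P v -> P (alg_str B k * u + v)) ->
    (forall mu, is_form mu -> P (slice mu x)) ->
  exists2 s : seq (B * A), (forall p, p \in s -> P p.1) &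
    x = \sum_(p <- s) pure p.1 p.2.
Proof.
move=> P0 PD.
have [s ->] := tensor_seq x.
have [n] := ubnP (size s); elim: n s => // n IH [|[b a] s] /= sn Ps.
  by exists [::]; rewrite ?big_nil.
have [a0|/exists_form[mu fm mu1]] := eqVneq a 0.
  have [|s' Ps' e] := IH s sn.
    by move=> mu /Ps; rewrite big_cons a0 pure0r add0r.
  by exists s' => //; rewrite big_cons a0 pure0r add0r.
pose p := slice mu (\sum_(q <- (b, a) :: s) pure q.1 q.2).
have Pp : P p by exact: Ps.
have pE : b = p - \sum_(q <- s) alg_str B (mu q.2) * q.1.
  rewrite /p big_cons sliceD // slice_pure // mu1 rmorph1 mul1r slice_sum //.
  by under eq_bigr do rewrite slice_pure //; rewrite addrK.
pose s' := [seq (q.1, q.2 - alg_str A (mu q.2) * a) | q <- s].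
have xE : \sum_(q <- (b, a) :: s) pure q.1 q.2 =
    pure p a + \sum_(q <- s') pure q.1 q.2 :> tensor B A.
  rewrite big_cons {1}pE big_map /=.
  rewrite pureE rmorphB mulrBl -pureE -addrA; congr (_ + _).
  rewrite rmorph_sum mulr_suml addrC -sumrB; apply: eq_bigr => q _.
  rewrite -pureE pure_scale; apply/eqP; rewrite subr_eq -pureDr.
  by rewrite subrK.
have [||t Pt tE] := IH s'; first by rewrite size_map.
  move=> nu fn; have := PD (- nu a) p _ Pp (Ps nu fn).
  rewrite xE sliceD // slice_pure // rmorphN mulNr addrA addNr add0r.
  by apply.
exists ((p, a) :: t); last by rewrite xE big_cons tE.
by move=> q; rewrite inE => /predU1P[->//|]; exact: Pt.
Qed.

Lemma slices_eq0 (x : tensor B A) :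
  (forall mu, is_form mu -> slice mu x = 0) -> x = 0.
Proof.
move=> x0; have [|k u v -> ->|//|s s0 ->] := @slices_in (eq^~ 0) x => //.
  by rewrite mulr0 addr0.
by rewrite big_seq big1 // => -[b a] /s0 /= ->; exact: pure0l.
Qed.

Lemma slices_inj (x y : tensor B A) :
  (forall mu, is_form mu -> slice mu x = slice mu y) -> x = y.
Proof.
move=> xy; apply/eqP; rewrite -subr_eq0; apply/eqP/slices_eq0 => mu fm.
by rewrite sliceD // sliceN // xy // subrr.
Qed.

End Slices.

Section LeftSlices.
Variables (K : fieldType) (B A : calg K).

Definition tens_swap : tensor B A -> tensor A B :=
  rlift (f := tens_inr A) (g := tens_inl B) (fun k => esym (tens_inlr A B k)).

Lemma tens_swap_pure b a : tens_swap (pure b a) = pure a b.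
Proof. by rewrite /tens_swap rlift_pure pureM mulr1 mul1r. Qed.

HB.instance Definition _ := GRing.RMorphism.on tens_swap.

Definition lslice (la : B -> K) (x : tensor B A) : A := slice la (tens_swap x).

Section Form.
Variables (la : B -> K) (fl : is_form la).

Lemma lslice_pure b a : lslice la (pure b a) = alg_str A (la b) * a.
Proof. by rewrite /lslice tens_swap_pure slice_pure. Qed.

Lemma lsliceD : {morph lslice la : x y / x + y}.
Proof. by move=> x y; rewrite /lslice rmorphD sliceD. Qed.

Lemma lslice_inr a x : lslice la (tens_inr B a * x) = a * lslice la x.
Proof.
by rewrite /lslice rmorphM /= tens_swap_pure slice_inl.
Qed.

Lemma lslice_inr1 a : la 1 = 1 -> lslice la (tens_inr B a) = a.
Proof. by move=> l1; rewrite lslice_pure l1 rmorph1 mul1r. Qed.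

End Form.
End LeftSlices.

Lemma tens_swapK (K : fieldType) (B A : calg K) :
  cancel (@tens_swap K B A) (@tens_swap K A B).
Proof.
apply: (@tensor_eq _ _ _ _ (fun x => tens_swap (tens_swap x)) id) => //.
  by move=> x y; rewrite !rmorphD.
by move=> b a; rewrite !tens_swap_pure.
Qed.

Lemma lslices_eq0 (K : fieldType) (B A : calg K) (x : tensor B A) :
  (forall la, is_form la -> lslice la x = 0) -> x = 0.
Proof. by move=> /slices_eq0 x0; rewrite -[x]tens_swapK x0 rmorph0. Qed.

Lemma tens_inr_inj (K : fieldType) (B A : calg K) :
  (1 : B) != 0 -> injective (@tens_inr K B A).
Proof.
move=> /exists_form[la fl l1] x y xy.
by rewrite -(lslice_inr1 fl x l1) xy lslice_inr1.
Qed.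

Lemma slice_map (K : fieldType) (B B' A : calg K) (f : algHom B B')
    (mu : A -> K) (fm : is_form mu) (x : tensor B A) :
  slice mu (tens_map f (algHom_id A) x) = f (slice mu x).
Proof.
move: x; apply: tensor_eq.
- by move=> u v; rewrite rmorphD sliceD.
- by move=> u v; rewrite sliceD // rmorphD.
by move=> b a; rewrite tens_map_pure !slice_pure // rmorphM alg_funE.
Qed.

Lemma tens_map_inj (K : fieldType) (B B' A : calg K) (f : algHom B B') :
  injective f -> injective (tens_map f (algHom_id A)).
Proof.
move=> fI x y xy; apply: slices_inj => mu fm; apply: fI.
by rewrite -!slice_map // xy.
Qed.

Section TensorLinear.
Variables (K : fieldType) (B A A' : calg K) (f : A -> A').

Definition tens_linr : tensor B A -> tensor B A' :=
  tens_lift (fun b a => pure b (f a)).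

Hypothesis fD : {morph f : x y / x + y}.
Hypothesis fZ : forall k a, f (alg_str A k * a) = alg_str A' k * f a.

Fact tens_linr_balanced : balanced (fun b a => @pure _ B A' b (f a)).
Proof.
split=> [a x y|b x y|k b a]; first exact: pureDl.
  by rewrite fD pureDr.
by rewrite pure_scale fZ.
Qed.

Lemma tens_linr_pure b a : tens_linr (pure b a) = pure b (f a).
Proof. exact: (tens_lift_pure tens_linr_balanced). Qed.

Lemma tens_linrD : {morph tens_linr : x y / x + y}.
Proof. exact: (tens_liftD tens_linr_balanced). Qed.

Lemma tens_linr0 : tens_linr 0 = 0.
Proof. exact: (tens_lift0 tens_linr_balanced). Qed.

End TensorLinear.

(** Rows of [P] are added one by one. Fewer than n independent rows Z leave a nonzero column w with
    Z w = 0; the hypothesis then provides u in [P] with u w != 0, and such a u is independent of the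
    rows of Z. *)
Lemma rows_full (K : fieldType) n (P : 'rV[K]_n -> Prop) :
    (forall w : 'cV_n, (forall u, P u -> u *m w = 0) -> w = 0) ->
  exists2 Z : 'M_n, forall i, P (row i Z) & Z \in unitmx.
Proof.
move=> Pw.
suff H k : (k <= n)%N ->
    exists2 Z : 'M_(k, n), forall i, P (row i Z) & row_free Z.
  have [Z PZ Zf] := H n (leqnn n).
  by exists Z => //; rewrite -row_free_unit.
elim: k => [_|k IH kn].
  exists (0 : 'M_(0, n)); first by case.
  by rewrite -row_leq_rank leq0n.
have [Z PZ Zf] := IH (ltnW kn).
have [w w0 Zw] : exists2 w : 'cV_n, w != 0 & Z *m w = 0.
  have : kermx Z^T != 0.
    rewrite -mxrank_eq0 mxrank_ker mxrank_tr (eqP Zf) subn_eq0 -ltnNge.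
    exact: leq_trans kn _.
  case/rowV0Pn=> u /sub_kermxP uZ u0; exists u^T.
    by rewrite -[0]trmx0 (inj_eq (@trmx_inj _ _ _)).
  by apply: trmx_inj; rewrite trmx_mul trmxK uZ trmx0.
have [u Pu uw] : exists2 u, P u & u *m w != 0.
  apply: contrapT => nu; move/eqP: w0; apply; apply: Pw => u Pu.
  by apply/eqP/negP => /negP uw; apply: nu; exists u.
have PuZ (i : 'I_(1 + k)) : P (row i (col_mx u Z)).
  have [j ->|j ->] := split_ordP i.
    by rewrite rowKu ord1 row_id.
  by rewrite rowKd.
have cuZ (c : 'rV_(1 + k)) : c *m col_mx u Z = 0 -> c = 0.
  rewrite -[c]hsubmxK mul_row_col => e.
  have l0 : lsubmx c = 0.
    move/(congr1 (mulmx^~ w)): e.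
    rewrite mulmxDl mul0mx -!mulmxA Zw mulmx0 addr0.
    rewrite [lsubmx c]mx11_scalar mul_scalar_mx => /eqP.
    by rewrite scaler_eq0 (negbTE uw) orbF => /eqP ->; rewrite raddf0.
  rewrite l0 mul0mx add0r in e *.
  by rewrite (row_free_inj Zf (etrans e (esym (mul0mx _ _)))) row_mx0.
exists (col_mx u Z : 'M_(1 + k, n)); first exact: PuZ.
by rewrite -kermx_eq0; apply/rowV0P => c /sub_kermxP; exact: cuZ.
Qed.

Definition dual_basis (K : fieldType) (A : calg K) n (v : 'cV[A]_n)
    (mu : 'I_n -> A -> K) : Prop :=
  (forall i, is_form (mu i)) /\ forall i j, mu i (v j 0) = (i == j)%:R.

Section DualBasis.
Variables (K : fieldType) (A : calg K).

(** A dual family inside [P] has at most m members, because its coordinates along the [w i] form a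
    matrix with a right inverse. A family of maximal size must span [P]: a nonzero remainder [p],
    killed by all [mu i], would extend it. *)
Lemma dual_basis_exists m (w : 'I_m -> A) (P : A -> Prop) :
    (forall k x y, P x -> P y -> P (alg_str A k * x + y)) -> P 0 ->
    (forall x, P x -> exists c : 'I_m -> K, x = \sum_i alg_str A (c i) * w i) ->
  exists n (v : 'cV[A]_n) mu, [/\ dual_basis v mu, forall i, P (v i 0)
    & forall x, P x -> x = \sum_i alg_str A (mu i x) * v i 0].
Proof.
move=> PD P0 Pw.
pose Q n := exists (v : 'cV[A]_n) mu, dual_basis v mu /\ forall i, P (v i 0).
have Q0 : exists n, `[< Q n >].
  exists 0%N; apply/asboolP; exists (\col_i 0), (fun _ _ => 0).
  by split; [split|]; case.
have Qm n : `[< Q n >] -> (n <= m)%N.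
  move=> /asboolP[v [mu [[fm dm] Pv]]].
  have /choice[c cE] i := Pw _ (Pv i).
  pose C := \matrix_(i, j) c i j; pose W := \matrix_(i < m, j < n) mu j (w i).
  have : C *m W = 1%:M.
    apply/matrixP => i j; rewrite !mxE eq_sym -dm cE is_form_sum //.
    by apply: eq_bigr => k _; rewrite !mxE (proj2 (fm j)).
  move/(congr1 mxrank); rewrite mxrank1 => <-.
  exact: leq_trans (mxrankM_maxl _ _) (rank_leq_col _).
case: (ex_maxnP Q0 Qm) => n /asboolP[v [mu [[fm dm] Pv]]] nmax.
exists n, v, mu; split=> // x Px; apply/eqP; rewrite -subr_eq0.
set p := x - _; apply: contraT => /exists_form[la fl l1].
have mup i : mu i p = 0.
  rewrite is_formB // is_form_sum //.
  under eq_bigr do rewrite (proj2 (fm i)) dm mulr_natr mulrb eq_sym.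
  by rewrite -big_mkcond big_pred1_eq subrr.
have Pp : P p.
  rewrite /p -sumrN; move: Px; rewrite -[in P x](addr0 x).
  rewrite addr0 => Px; elim/big_rec: _ => [|i y _ IH]; first by rewrite addr0.
  by rewrite addrCA -mulNr -rmorphN; exact: PD.
suff /asboolP/nmax : Q n.+1 by rewrite ltnn.
(* The correction makes [nu] vanish on [v], while nu p = la p = 1 since every mu i p is 0. *)
pose nu x := la x - \sum_i la (v i 0) * mu i x.
exists (\col_i oapp (fun j => v j 0) p (unlift ord0 i)),
  (fun i => oapp mu nu (unlift ord0 i)).
have fnu : is_form nu.
  split=> [y z|k y]; rewrite /nu.
    rewrite (proj1 fl) -addrACA -opprD -big_split; congr (_ - _).
    by apply: eq_bigr => i _; rewrite (proj1 (fm i)) mulrDr.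
  rewrite (proj2 fl) mulrBr mulr_sumr; congr (_ - _).
  by apply: eq_bigr => i _; rewrite (proj2 (fm i)) mulrCA.
split; first split.
- by move=> i; case: unlift.
- move=> i j; rewrite mxE.
  case: (unliftP ord0 i) => [{}i|] ->; case: (unliftP ord0 j) => [{}j|] -> /=.
  + by rewrite dm (inj_eq lift_inj).
  + by rewrite mup.
  + rewrite /nu.
    under eq_bigr do rewrite dm mulr_natr mulrb.
    by rewrite -big_mkcond big_pred1_eq subrr.
  + by rewrite /nu l1 big1 ?subr0 // => k _; rewrite mup mulr0.
by move=> i; rewrite mxE; case: unliftP => [j|] _ /=.
Qed.

End DualBasis.

(** * Points and comodules of a linear algebraic group *)

Definition tens_calg (K : fieldType) (B A : calg K) : calg K :=
  @CAlg K (tensor B A) (tens_inl A \o alg_str B).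

Definition inl_hom (K : fieldType) (B A : calg K) : algHom B (tens_calg B A) :=
  @AlgHom K B (tens_calg B A) (tens_inl A) (fun k => erefl).

Definition inr_hom (K : fieldType) (B A : calg K) : algHom A (tens_calg B A) :=
  @AlgHom K A (tens_calg B A) (tens_inr B) (fun k => esym (tens_inlr B A k)).

Section PairHom.
Variables (K : fieldType) (B A C : calg K) (f : algHom B C) (g : algHom A C).

Fact pair_hom_compat k : f (alg_str B k) = g (alg_str A k).
Proof. by rewrite !alg_funE. Qed.

Fact pair_homE k : rlift pair_hom_compat (tens_inl A (alg_str B k)) = alg_str C k.
Proof. by rewrite rlift_inl alg_funE. Qed.

Definition pair_hom : algHom (tens_calg B A) C :=
  @AlgHom K (tens_calg B A) C (rlift pair_hom_compat) pair_homE.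

Lemma pair_hom_pure b a : pair_hom (pure b a : tensor B A) = f b * g a.
Proof. exact: rlift_pure. Qed.

Lemma pair_hom_inl : algHom_comp pair_hom (inl_hom B A) = f.
Proof. by apply: algHomP => b /=; rewrite rlift_inl. Qed.

Lemma pair_hom_inr : algHom_comp pair_hom (inr_hom B A) = g.
Proof. by apply: algHomP => b /=; rewrite rlift_inr. Qed.

End PairHom.

Section DualSlices.
Variables (K : fieldType) (B A : calg K) (n : nat) (v : 'cV[A]_n).
Variables (mu : 'I_n -> A -> K) (vmu : dual_basis v mu).

Lemma slice_dual (t : 'I_n -> B) k :
  slice (mu k) (\sum_j pure (t j) (v j 0)) = t k.
Proof.
have [fm dm] := vmu; rewrite slice_sum //.
under eq_bigr do rewrite slice_pure // dm.
rewrite (bigD1 k) //= eqxx rmorph1 mul1r big1 ?addr0 // => j /negPf jk.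
by rewrite eq_sym jk rmorph0 mul0r.
Qed.

Lemma mul_inlrE m (S : 'M[B]_(m, n)) i :
  (map_mx (tens_inl A) S *m map_mx (tens_inr B) v) i 0 =
  \sum_j pure (S i j) (v j 0).
Proof. by rewrite mxE; apply: eq_bigr => j _; rewrite !mxE -pureE. Qed.

Lemma dual_inj m (S T : 'M[B]_(m, n)) :
  map_mx (tens_inl A) S *m map_mx (tens_inr B) v =
  map_mx (tens_inl A) T *m map_mx (tens_inr B) v -> S = T.
Proof.
move=> ST; apply/matrixP => i k.
rewrite -(slice_dual (S i) k) -(slice_dual (T i) k); congr (slice _ _).
by rewrite -!mul_inlrE ST.
Qed.

End DualSlices.

Section Points.
Variables (K : fieldType) (G : linAlgGroup K).
Local Notation KG := (lag_coord G).

Lemma pt_exists A (g : G A) : exists x : algHom KG A, lag_pt x = g.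
Proof. by have [f _ fK] := @lag_pt_bij K G A; exists (f g). Qed.

Definition pt A (g : G A) : algHom KG A := projT1 (cid (pt_exists g)).

Lemma lag_ptK A (g : G A) : lag_pt (pt g) = g.
Proof. by rewrite /pt; case: cid. Qed.

Lemma ptK A (x : algHom KG A) : pt (lag_pt x : G A) = x.
Proof. by apply: (bij_inj (@lag_pt_bij K G A)); rewrite lag_ptK. Qed.

Lemma pt_inj A : injective (@pt A).
Proof. by move=> g h /(congr1 (@lag_pt K G A)); rewrite !lag_ptK. Qed.

Lemma pt_map A B (f : algHom A B) (g : G A) :
  pt (gf_map G f g) = algHom_comp f (pt g).
Proof. by rewrite -{1}(lag_ptK g) lag_pt_nat ptK. Qed.

Lemma pt_mapE A B (f : algHom A B) (g : G A) x :
  pt (gf_map G f g) x = f (pt g x).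
Proof. by rewrite pt_map. Qed.

Definition gen_pt : G KG := lag_pt (algHom_id KG).

Lemma pt_gen : pt gen_pt = algHom_id KG.
Proof. exact: ptK. Qed.

Lemma map_gen A (g : G A) : gf_map G (pt g) gen_pt = g.
Proof.
apply: pt_inj; rewrite pt_map pt_gen; exact: algHomP.
Qed.

(** By Yoneda: the witness is the product of the two generic points over K[G] (x) K[G], and every
    pair of points is the image of this universal pair under [pair_hom]. *)
Lemma comul_exists : exists c : algHom KG (tens_calg KG KG),
  forall A (x y : G A) f, pt (x * y)%g f = pair_hom (pt x) (pt y) (c f).
Proof.
exists (pt (gf_map G (inl_hom KG KG) gen_pt *
            gf_map G (inr_hom KG KG) gen_pt)%g) => A x y f.
rewrite -pt_mapE gmulfM -!gf_map_comp pair_hom_inl pair_hom_inr.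
by rewrite !map_gen.
Qed.

Definition comul : algHom KG (tens_calg KG KG) := projT1 (cid comul_exists).

Lemma pt_mul A (x y : G A) f : pt (x * y)%g f = pair_hom (pt x) (pt y) (comul f).
Proof. by rewrite /comul; case: cid. Qed.

Lemma gf_map1 A B (f : algHom A B) : gf_map G f 1%g = 1%g.
Proof. by apply: (@mulgI _ (gf_map G f 1%g)); rewrite -gmulfM !mulg1. Qed.

Definition base1 : calg K := @CAlg K K idfun.

Definition base1_hom (A : calg K) : algHom base1 A :=
  @AlgHom K base1 A (alg_str A) (fun k => erefl).

Definition counit : algHom KG base1 := pt (1%g : G base1).

Lemma pt1E A f : pt (1%g : G A) f = alg_str A (counit f).
Proof. by rewrite -(gf_map1 (base1_hom A)) pt_mapE. Qed.

Lemma counit_form : is_form (counit : KG -> K).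
Proof.
split=> [x y|k x]; first exact: (rmorphD counit).
by rewrite (rmorphM counit) (alg_funE counit).
Qed.

Lemma counit_mul f : lslice (counit : KG -> K) (comul f) = f.
Proof.
have e : pt (1 * gen_pt)%g f = f by rewrite mul1g pt_gen.
rewrite -[RHS]e pt_mul; move: (comul f); apply: tensor_eq.
- exact: (lsliceD counit_form).
- by move=> x y; rewrite rmorphD.
move=> a b; rewrite (lslice_pure counit_form) pair_hom_pure pt1E pt_gen //.
Qed.

(** A finite-dimensional space of functions on G stable under the translations y |-> x y, with
    matrix coefficients [cm_rho]. The coaction is stated on points, so that matrix identities follow
    from group identities; the dual forms record the linear independence of [cm_v]. *)
Record comodule := Comodule {
  cm_dim : nat;
  cm_v : 'cV[KG]_cm_dim;
  cm_rho : 'M[KG]_cm_dim;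
  cm_mu : 'I_cm_dim -> KG -> K;
  cm_dual : dual_basis cm_v cm_mu;
  cm_vM : forall A (x y : G A), map_mx (pt (x * y)%g) cm_v =
    map_mx (pt x) cm_rho *m map_mx (pt y) cm_v
}.

Section ComoduleTheory.
Variable V : comodule.
Local Notation v := (cm_v V).
Local Notation rho := (cm_rho V).

Let map_inl A m p (g : G A) (M : 'M[KG]_(m, p)) :
  map_mx (pt (gf_map G (inl_hom A KG) g)) M =
  map_mx (tens_inl KG) (map_mx (pt g) M).
Proof. by apply/matrixP => i j; rewrite !mxE pt_mapE. Qed.

Let map_inr (A : calg K) m p (M : 'M[KG]_(m, p)) :
  map_mx (pt (gf_map G (inr_hom A KG) gen_pt)) M = map_mx (tens_inr A) M.
Proof. by apply/matrixP => i j; rewrite !mxE pt_mapE pt_gen. Qed.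

Let vM A (x : G A) :
  map_mx (tens_inl KG) (map_mx (pt x) rho) *m map_mx (tens_inr A) v =
  map_mx (pt (gf_map G (inl_hom A KG) x * gf_map G (inr_hom A KG) gen_pt)%g) v.
Proof.
rewrite -map_inl -map_inr.
have := cm_vM V (gf_map G (inl_hom A KG) x) (gf_map G (inr_hom A KG) gen_pt).
by move/esym.
Qed.

(** v(x y u), with u the generic point over A (x) K[G], is expanded in two ways by associativity;
    linear independence of [v] cancels v(u). *)
Lemma cm_rhoM A (x y : G A) :
  map_mx (pt (x * y)%g) rho = map_mx (pt x) rho *m map_mx (pt y) rho.
Proof.
apply: (dual_inj (cm_dual V)); rewrite vM map_mxM -mulmxA vM -map_inl gmulfM.
rewrite -mulgA; have := cm_vM V (gf_map G (inl_hom A KG) x)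
  (gf_map G (inl_hom A KG) y * gf_map G (inr_hom A KG) gen_pt)%g.
by [].
Qed.

Lemma cm_rho1 A : map_mx (pt (1%g : G A)) rho = 1%:M.
Proof.
apply: (dual_inj (cm_dual V)).
by rewrite vM gf_map1 mul1g map_inr map_mx1 mul1mx.
Qed.

Lemma cm_rhoV A (x : G A) :
  map_mx (pt x) rho *m map_mx (pt x^-1%g) rho = 1%:M.
Proof. by rewrite -cm_rhoM mulgV cm_rho1. Qed.

(** The case y = 1 of [cm_vM]: the functions in [v] are K-combinations of the entries of [rho],
    which reduces questions about K[G] to matrix coefficients. *)
Lemma cm_v_rho A (x : G A) :
  map_mx (pt x) v = map_mx (pt x) rho *m map_mx (alg_str A \o counit) v.
Proof.
rewrite -{1}[x]mulg1 cm_vM; congr (_ *m _).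
by apply/matrixP => i j; rewrite !mxE pt1E.
Qed.

End ComoduleTheory.

Lemma span_seq (ws : seq KG) x : in_span (fun y => y \in ws) x ->
  exists c : 'I_(size ws) -> K, x = \sum_i alg_str KG (c i) * ws`_i.
Proof.
elim=> [|k u y /(nthP 0)[i iw <-] _ [c ->]].
  by exists (fun _ => 0); rewrite big1 // => i _; rewrite rmorph0 mul0r.
exists (fun j => (if j == Ordinal iw then k else 0) + c j).
under [RHS]eq_bigr do rewrite rmorphD mulrDl; rewrite big_split /=.
congr (_ + _); rewrite (bigD1 (Ordinal iw)) //= eqxx big1 ?addr0 // => j /negPf ->.
by rewrite rmorph0 mul0r.
Qed.

Lemma fubini (B A : calg K) (la : B -> K) (mu : A -> K) (x : tensor B A) :
  is_form la -> is_form mu -> mu (lslice la x) = la (slice mu x).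
Proof.
move=> fl fm; have [[lD lZ] [mD mZ]] := (fl, fm).
move: x; apply: tensor_eq => [x y|x y|b a].
- by rewrite lsliceD // mD.
- by rewrite sliceD // lD.
by rewrite lslice_pure // slice_pure // lZ mZ mulrC.
Qed.

(* The span of the left slices of the comultiplications is stable, which is
   local finiteness of the regular comodule. *)
Lemma lslice_comul (mu la : KG -> K) (f : KG) : is_form mu -> is_form la ->
  lslice la (comul (lslice mu (comul f))) =
  lslice (fun p => mu (slice la (comul p))) (comul f).
Proof.
move=> fm fl.
pose nu p := mu (slice la (comul p)).
have fnu : is_form nu.
  have [[mD mZ] cD] := (fm, rmorphD comul).
  split=> [x y|k x]; rewrite /nu; first by rewrite rmorphD sliceD // mD.
  rewrite rmorphM alg_funE (slice_inl fl (alg_str KG k)); exact: mZ.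
pose T := tens_calg KG KG.
(* [x], [y], [z] are the three generic points over K[G] (x) K[G] (x) K[G]. The two sides arise from
   (x y) z = x (y z) by applying [mu] to the first tensor factor and [la] to the second. *)
pose x := gf_map G (inl_hom KG T) gen_pt.
pose y := gf_map G (algHom_comp (inr_hom KG T) (inl_hom KG KG)) gen_pt.
pose z := gf_map G (algHom_comp (inr_hom KG T) (inr_hom KG KG)) gen_pt.
have xE a : pt x a = @pure K KG T a (@pure K KG KG 1 1) by rewrite pt_mapE pt_gen.
have yE a : pt y a = @pure K KG T 1 (@pure K KG KG a 1) by rewrite pt_mapE pt_gen.
have zE a : pt z a = @pure K KG T 1 (@pure K KG KG 1 a) by rewrite pt_mapE pt_gen.
pose L (t : tensor KG T) : KG := lslice la (lslice mu t : tensor KG KG).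
have LD : {morph L : s t / s + t}.
  by move=> s t; rewrite /L !lsliceD.
have LE a (s : tensor KG KG) : L (@pure K KG T a s) = alg_str KG (mu a) * lslice la s.
  rewrite /L lslice_pure // /= -[RHS](mulrC).
  by rewrite tens_inlr lslice_inr // mulrC.
have yzE b : pt (y * z)%g b = @pure K KG T 1 (comul b).
  rewrite pt_mul; move: (comul b); apply: tensor_eq => [u w|u w|p q].
  - by rewrite rmorphD.
  - by rewrite pureDr.
  by rewrite pair_hom_pure yE zE !pureM !mulr1 !mul1r.
have e1 t : L (pair_hom (pt (x * y)%g) (pt z) t) = lslice nu t.
  move: t; apply: tensor_eq => [u w|u w|a b]; rewrite ?rmorphD ?LD ?lsliceD //.
  rewrite pair_hom_pure lslice_pure // zE pt_mul /nu.
  move: (comul a); apply: tensor_eq => [u w|u w|p q].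
  - by rewrite rmorphD mulrDl LD.
  - by rewrite sliceD // (proj1 fm) rmorphD mulrDl.
  rewrite pair_hom_pure xE yE !pureM !mulr1 !mul1r LE lslice_pure //.
  by rewrite slice_pure // (proj2 fm) rmorphM mulrA (mulrC (alg_str KG (mu p))).
have e2 t : L (pair_hom (pt x) (pt (y * z)%g) t) = lslice la (comul (lslice mu t)).
  move: t; apply: tensor_eq => [u w|u w|a b]; rewrite ?lsliceD ?rmorphD ?LD ?lsliceD //.
  rewrite pair_hom_pure lslice_pure // xE yzE pureM mulr1 mul1r LE.
  by rewrite rmorphM alg_funE /= tens_inlr lslice_inr.
by rewrite -e1 -e2 -!pt_mul mulgA.
Qed.

(** The span of the left slices of the [comul f] works: it lies in the span of finitely many right
    tensor factors, it is stable by [lslice_comul], and it contains each [f] because the counit is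
    one of the forms. *)
Lemma comodule_exists (fs : seq KG) :
  exists V : comodule, forall f, f \in fs ->
    exists c : 'I_(cm_dim V) -> K, f = \sum_i alg_str KG (c i) * cm_v V i 0.
Proof.
pose X y := exists2 f, f \in fs & exists2 mu, is_form mu & y = lslice mu (comul f).
pose P := in_span X.
have PD k x y : P x -> P y -> P (alg_str KG k * x + y) by exact: in_span_lin.
have [ws wsP] : exists ws : seq KG, forall y, X y -> in_span (fun w => w \in ws) y.
  have /choice[s sE] f := tensor_seq (comul f).
  exists (flatten [seq [seq p.2 | p <- s f] | f <- fs]) => _ [f ff [mu fm ->]].
  have : {subset s f <= s f} by [].
  rewrite [comul f]sE; elim: {1 3}(s f) => [|p t IH] tP.
    by rewrite big_nil /lslice rmorph0 slice0 //; exact: in_span0.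
  rewrite big_cons lsliceD // lslice_pure //; apply: in_spanD.
    apply/flattenP; exists [seq p.2 | p <- s f]; first exact: map_f.
    by apply/map_f/tP; rewrite mem_head.
  by apply: IH => q qt; apply: tP; rewrite inE qt orbT.
have [||n [v [mu [[fm dm] Pv vE]]]] :=
    @dual_basis_exists _ KG (size ws) (fun i => ws`_i) P PD.
- exact: in_span0.
- move=> x Px; apply: span_seq; elim: Px => [|k y u Xy _ IH].
    exact: in_span0.
  by apply: in_span_lin => //; exact: wsP.
have Pstable y la : is_form la -> P y -> P (lslice la (comul y)).
  move=> fl; elim=> [|k _ u [f ff [nu fn ->]] _ IH].
    by rewrite rmorph0 /lslice rmorph0 slice0 //; exact: in_span0.
  rewrite rmorphD rmorphM alg_funE /= tens_inlr lsliceD // lslice_inr //.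
  apply: in_spanD IH; exists f => //; rewrite lslice_comul //.
  exists (fun p => nu (slice la (comul p))) => //.
  split=> [p q|l p]; first by rewrite rmorphD sliceD // (proj1 fn).
  by rewrite rmorphM alg_funE (slice_inl fl (alg_str KG l)) (proj2 fn).
pose rho := \matrix_(i, j) slice (mu j) (comul (v i 0)).
have comulv i : comul (v i 0) = \sum_j pure (rho i j) (v j 0).
  apply/eqP; rewrite -subr_eq0; apply/eqP/lslices_eq0 => la fl.
  have -> : lslice la (comul (v i 0) - \sum_j pure (rho i j) (v j 0)) =
      lslice la (comul (v i 0)) - \sum_j alg_str KG (la (rho i j)) * v j 0.
    rewrite /lslice rmorphB sliceD // sliceN //; congr (_ - _).
    rewrite rmorph_sum slice_sum //; apply: eq_bigr => j _.
    exact: lslice_pure.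
  rewrite {1}(vE _ (Pstable _ _ fl (Pv i))) -sumrB big1 // => j _.
  by rewrite fubini // mxE subrr.
unshelve eexists (@Comodule n v rho mu _ _); first by split.
  move=> A x y; apply/matrixP => i j; rewrite !mxE ord1 pt_mul comulv rmorph_sum.
  by apply: eq_bigr => k _; rewrite pair_hom_pure !mxE.
move=> f ff; exists (fun i => mu i f) => /=; apply: vE.
rewrite -[f in P f]counit_mul; apply: in_span_gen; exists f => //.
by exists counit => //; exact: counit_form.
Qed.

End Points.

Arguments cm_mu {K G} c _ _.

(** * Differential algebras and their constants *)

(** In contrast to [diffRingType], neither units nor 1 != 0 are asked for, so that tensor products
    qualify. *)
Record dalg (L : diffFieldType) := Dalg {
  da_alg :> calg L;
  da_der : da_alg -> da_alg;
  da_derD : {morph da_der : x y / x + y};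
  da_derM : forall x y, da_der (x * y) = da_der x * y + x * da_der y;
  da_der_str : forall l, da_der (alg_str da_alg l) = alg_str da_alg (der l)
}.

Section DalgConstants.
Variables (L : diffFieldType) (D : dalg L).

Lemma da_der0 : da_der (0 : D) = 0.
Proof. by apply: (@addrI _ (da_der 0)); rewrite -da_derD !addr0. Qed.

Lemma da_derB (x y : D) : da_der (x - y) = da_der x - da_der y.
Proof. by apply: (@addIr _ (da_der y)); rewrite -da_derD !subrK. Qed.

Lemma da_der1 : da_der (1 : D) = 0.
Proof. by rewrite -(rmorph1 (alg_str D)) da_der_str der1 rmorph0. Qed.

Definition dconst_pred : {pred D} := fun x => da_der x == 0.

Fact dconst_subring : subring_closed dconst_pred.
Proof.
split=> [|x y|x y]; rewrite !unfold_in ?da_der1 //=; move=> /eqP dx /eqP dy.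
  by rewrite da_derB dx dy subr0.
by rewrite da_derM dx dy mul0r mulr0 addr0.
Qed.

HB.instance Definition _ :=
  GRing.isSubringClosed.Build D dconst_pred dconst_subring.

Record dconst_type := DConst {
  dc_val :> D;
  dc_valP : dc_val \in dconst_pred
}.

HB.instance Definition _ := [isSub for dc_val].
HB.instance Definition _ := [Choice of dconst_type by <:].
HB.instance Definition _ :=
  GRing.SubChoice_isSubComPzRing.Build D dconst_pred dconst_type dconst_subring.

Lemma dc_der (x : dconst_type) : da_der (dc_val x) = 0.
Proof. exact/eqP/(dc_valP x). Qed.

Fact dconst_str_subproof (c : constants L) :
  alg_str D (const_val c) \in dconst_pred.
Proof. by rewrite unfold_in da_der_str der_const rmorph0. Qed.

Definition dconst_str (c : constants L) : dconst_type :=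
  DConst (dconst_str_subproof c).

Fact dconst_str_zmod : zmod_morphism dconst_str.
Proof. by move=> x y; apply/val_inj; rewrite /= !rmorphB. Qed.

Fact dconst_str_monoid : monoid_morphism dconst_str.
Proof. by split=> [|x y]; apply/val_inj; rewrite /= ?rmorph1 ?rmorphM. Qed.

HB.instance Definition _ := GRing.isZmodMorphism.Build (constants L)
  dconst_type dconst_str dconst_str_zmod.
HB.instance Definition _ := GRing.isMonoidMorphism.Build (constants L)
  dconst_type dconst_str dconst_str_monoid.

Definition dconst : calg (constants L) :=
  @CAlg (constants L) dconst_type dconst_str.

Definition dc_rmorphism : {rmorphism dconst -> D} := val : dconst_type -> D.

End DalgConstants.

Record dalgHom (L : diffFieldType) (D D' : dalg L) := DalgHom {
  dah_fun :> algHom D D';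
  dah_der : forall x, dah_fun (da_der x) = da_der (dah_fun x)
}.

Section DconstMap.
Variables (L : diffFieldType) (D D' : dalg L) (f : dalgHom D D').

Fact dconst_map_subproof (x : dconst D) : f (dc_val x) \in @dconst_pred L D'.
Proof. by rewrite unfold_in -dah_der dc_der rmorph0. Qed.

Definition dconst_fun (x : dconst D) : dconst D' :=
  DConst (dconst_map_subproof x).

Fact dconst_fun_zmod : zmod_morphism dconst_fun.
Proof. by move=> x y; apply/val_inj; rewrite /= !rmorphB. Qed.

Fact dconst_fun_monoid : monoid_morphism dconst_fun.
Proof. by split=> [|x y]; apply/val_inj; rewrite /= ?rmorph1 ?rmorphM. Qed.

HB.instance Definition _ := GRing.isZmodMorphism.Build (dconst D) (dconst D')
  dconst_fun dconst_fun_zmod.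
HB.instance Definition _ := GRing.isMonoidMorphism.Build (dconst D) (dconst D')
  dconst_fun dconst_fun_monoid.

Fact dconst_mapE k :
  dconst_fun (alg_str (dconst D) k) = alg_str (dconst D') k.
Proof. by apply/val_inj; rewrite /= alg_funE. Qed.

Definition dconst_map : algHom (dconst D) (dconst D') :=
  @AlgHom _ (dconst D) (dconst D') dconst_fun dconst_mapE.

End DconstMap.

Section TensorDalg.
Variables (L : diffFieldType) (E D : dalg L).
Local Notation T := (tensor E D).

Definition tens_dder : T -> T :=
  tens_lift (fun a b => pure (da_der a) b + pure a (da_der b)).

Fact tens_dder_balanced :
  balanced (fun (a : E) (b : D) => pure (da_der a) b + pure a (da_der b) : T).
Proof.
split=> [b x y|a x y|l a b].
- by rewrite da_derD !pureDl addrACA.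
- by rewrite da_derD !pureDr addrACA.
by rewrite !da_derM !da_der_str pureDl !pure_scale pureDr -addrA addrCA.
Qed.

Lemma tens_dder_pure a b :
  tens_dder (pure a b) = pure (da_der a) b + pure a (da_der b).
Proof. exact: (tens_lift_pure tens_dder_balanced). Qed.

Lemma tens_dderD : {morph tens_dder : x y / x + y}.
Proof. exact: (tens_liftD tens_dder_balanced). Qed.

Lemma tens_dderM x y : tens_dder (x * y) = tens_dder x * y + x * tens_dder y.
Proof.
move: x; apply: tensor_eq => [u v|u v|a b].
- by rewrite mulrDl tens_dderD.
- by rewrite tens_dderD !mulrDl addrACA.
move: y; apply: tensor_eq => [u v|u v|a' b'].
- by rewrite mulrDr tens_dderD.
- by rewrite tens_dderD !mulrDr addrACA.
rewrite pureM !tens_dder_pure !da_derM pureDl pureDr mulrDl mulrDr !pureM.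
by rewrite addrACA.
Qed.

Fact tens_dder_str l : tens_dder (alg_str (tens_calg E D) l) =
  alg_str (tens_calg E D) (der l).
Proof. by rewrite /= tens_dder_pure da_der_str da_der1 pure0r addr0. Qed.

Definition tens_dalg : dalg L :=
  @Dalg L (tens_calg E D) tens_dder tens_dderD tens_dderM tens_dder_str.

End TensorDalg.

Section TensorDalgMap.
Variables (L : diffFieldType) (E D D' : dalg L) (f : dalgHom D D').

Fact tens_dmap_str l :
  tens_map (algHom_id E) f (alg_str (tens_dalg E D) l) =
  alg_str (tens_dalg E D') l.
Proof. by rewrite /= tens_map_pure rmorph1. Qed.

Definition tens_dmap_hom : algHom (tens_dalg E D) (tens_dalg E D') :=
  @AlgHom L (tens_dalg E D) (tens_dalg E D')
    (tens_map (algHom_id E) f) tens_dmap_str.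

Fact tens_dmap_der (x : tens_dalg E D) :
  tens_dmap_hom (da_der x) = da_der (tens_dmap_hom x).
Proof.
rewrite /=; move: x; apply: tensor_eq => [u v|u v|a b].
- by rewrite tens_dderD rmorphD.
- by rewrite rmorphD tens_dderD.
by rewrite tens_map_pure !tens_dder_pure rmorphD /= !tens_map_pure dah_der.
Qed.

Definition tens_dmap : dalgHom (tens_dalg E D) (tens_dalg E D') :=
  DalgHom tens_dmap_der.

End TensorDalgMap.

Section TensorSwap.
Variables (L : diffFieldType) (D : dalg L).

Fact tens_swap_str l :
  tens_swap (alg_str (tens_dalg D D) l) = alg_str (tens_dalg D D) l.
Proof. by rewrite /= tens_swap_pure; exact/esym/tens_inlr. Qed.

Definition swap_hom : algHom (tens_dalg D D) (tens_dalg D D) :=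
  @AlgHom L (tens_dalg D D) (tens_dalg D D) (@tens_swap _ D D) tens_swap_str.

Fact swap_der (x : tens_dalg D D) : swap_hom (da_der x) = da_der (swap_hom x).
Proof.
rewrite /=; move: x; apply: tensor_eq => [u v|u v|a b].
- by rewrite tens_dderD rmorphD.
- by rewrite rmorphD tens_dderD.
by rewrite tens_swap_pure !tens_dder_pure rmorphD /= !tens_swap_pure addrC.
Qed.

Definition swap_dhom : dalgHom (tens_dalg D D) (tens_dalg D D) :=
  DalgHom swap_der.

End TensorSwap.

(** * Picard-Vessiot torsors *)

Section SimpleTensor.
Variables (L : diffFieldType) (R : diffRingType) (iota : {dmorphism L -> R}).
Local Notation RC := (ext_calg iota).

Lemma slice_der (A : calg (constants L)) (mu : A -> constants L)
    (x : tensor RC A) : is_form mu ->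
  slice mu (tens_der x) = der (slice mu x : R).
Proof.
move=> fm; move: x; apply: tensor_eq => [u v|u v|r a].
- by rewrite tens_derD sliceD.
- by rewrite sliceD // derD.
rewrite tens_der_pure !slice_pure // [RHS](derM (iota (val (mu a))) (r : R)).
by rewrite -rmorph_der der_const rmorph0 mul0r add0r.
Qed.

Lemma tens_der_inr (A : calg (constants L)) (a : A) :
  tens_der (tens_inr RC a) = 0.
Proof. by rewrite tens_der_pure der1 pure0l. Qed.

Lemma tens_derM (A : calg (constants L)) (x y : tensor RC A) :
  tens_der (x * y) = tens_der x * y + x * tens_der y.
Proof.
move: x; apply: tensor_eq => [u v|u v|a b].
- by rewrite mulrDl tens_derD.
- by rewrite tens_derD !mulrDl addrACA.
move: y; apply: tensor_eq => [u v|u v|a' b'].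
- by rewrite mulrDr tens_derD.
- by rewrite tens_derD !mulrDr addrACA.
by rewrite pureM !tens_der_pure !pureM -pureDl -derM.
Qed.

Lemma tens_der0 (A : calg (constants L)) : tens_der (0 : tensor RC A) = 0.
Proof. by apply: (@addrI _ (tens_der 0)); rewrite -tens_derD !addr0. Qed.

Hypothesis constR : forall x : R, der x = 0 ->
  exists c : constants L, iota (const_val c) = x.

(** Slices commute with the derivation, so all slices of [x] are constants of R, hence scalars. By
    [slices_in] the left factors can be taken to be scalars, which move to the right factor. *)
Lemma tens_der_eq0 (A : calg (constants L)) (x : tensor RC A) :
  tens_der x = 0 -> exists a : A, x = tens_inr RC a.
Proof.
move=> dx; pose P (r : RC) := exists c, r = alg_str RC c.
have [||mu fm|s Ps ->] := @slices_in _ RC A P x.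
- by exists 0; rewrite rmorph0.
- by move=> k _ _ [c ->] [d ->]; exists (k * c + d); rewrite rmorphD rmorphM.
- have [|c cE] := constR (x := slice mu x); last by exists c.
  by rewrite -slice_der // dx slice0.
elim: s Ps => [|p s IH] Ps; first by exists 0; rewrite big_nil rmorph0.
have [|a aE] := IH; first by move=> q qs; apply: Ps; rewrite inE qs orbT.
have [c cE] := Ps p (mem_head _ _).
exists (alg_str A c * p.2 + a); rewrite big_cons aE rmorphD; congr (_ + _).
by rewrite cE -[alg_str RC c]mulr1 pure_scale.
Qed.

Hypothesis simpleR : diff_simple R.

(* A differential R-submodule of R (x) A, for A constant, is detected by its
   constants: normalise one coefficient of a shortest element to 1. *)
Lemma simple_submodule (A : calg (constants L)) (M : tensor RC A -> Prop) :
    (forall x y, M x -> M y -> M (x + y)) ->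
    (forall r x, M x -> M (tens_inl A r * x)) ->
    (forall x, M x -> M (tens_der x)) ->
    forall x, M x -> x != 0 ->
  exists a : A, M (tens_inr RC a) /\ tens_inr RC a != 0.
Proof.
move=> MD MZ Mder.
suff H m : forall (a : 'I_m -> A) (r : 'I_m -> R),
    let x := \sum_i @pure _ RC A (r i) (a i) in M x -> x != 0 ->
    exists a : A, M (tens_inr RC a) /\ tens_inr RC a != 0.
  move=> x Mx x0; have [s sE] := tensor_seq x.
  pose p i := nth (0 : R, 0 : A) s i.
  have xE : x = \sum_(i < size s) @pure _ RC A (p i).1 (p i).2.
    by rewrite sE (big_nth (0 : R, 0 : A)) big_mkord.
  by rewrite xE in Mx x0; exact: H Mx x0.
elim: m => [|m IH] a r x Mx x0; first by rewrite /x big_ord0 eqxx in x0.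
pose a0 := a ord0; pose a' i := a (lift ord0 i).
pose y (q : R) (r' : 'I_m -> R) : tensor RC A :=
  @pure _ RC A q a0 + \sum_i @pure _ RC A (r' i) (a' i).
have xE : x = y (r ord0) (fun i => r (lift ord0 i)) by rewrite /x big_ord_recl.
have yM q r' s : tens_inl A (s : RC) * y q r' = y (s * q) (fun i => s * r' i).
  rewrite /y mulrDr mulr_sumr pureM mul1r; congr (_ + _).
  by apply: eq_bigr => i _; rewrite pureM mul1r.
have yD q r' q' r'' : y q r' + y q' r'' = y (q + q') (fun i => r' i + r'' i).
  rewrite /y addrACA -big_split; congr (_ + _).
    by rewrite (pureDl a0 (q : RC) q').
  by apply: eq_bigr => i _; rewrite (pureDl (a' i) (r' i : RC) (r'' i)).
have yder q r' : tens_der (y q r') = y (der q) (fun i => der (r' i)).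
  rewrite /y tens_derD tens_der_pure; congr (_ + _).
  rewrite (big_morph (@tens_der _ _ _ A) (@tens_derD _ _ _ A) (@tens_der0 A)).
  by apply: eq_bigr => i _; rewrite tens_der_pure.
(* The coefficients at [a0] of the elements of [M] supported on the [a i] form a differential ideal
   of R. Either r ord0 = 0 and [x] is shorter than it looks, or some element of [M] has coefficient
   1 at [a0]. *)
pose I q := exists r', M (y q r').
have [I0|I1] : (forall q, I q -> q = 0) \/ (forall q, I q).
  apply: simpleR; split.
  - have := MZ 0 _ Mx; rewrite xE yM mul0r => Mx'; by eexists; exact: Mx'.
  - move=> q q' [r1 M1] [r2 M2]; have := MD _ _ M1 M2.
    by rewrite yD => M12; eexists; exact: M12.
  - move=> s q [r1 M1]; have := MZ s _ M1.
    by rewrite yM => M2; eexists; exact: M2.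
  - by move=> q [r1 /Mder]; rewrite yder => M2; eexists; exact: M2.
- have r0 : r ord0 = 0 by apply: I0; exists (fun i => r (lift ord0 i)); rewrite -xE.
  apply: (IH a' (fun i => r (lift ord0 i))).
    by move: Mx; rewrite xE /y r0 pure0l add0r.
  by move: x0; rewrite xE /y r0 pure0l add0r.
have [r' Mr'] := I1 1.
(* If the normalised element is zero, it eliminates [a0] from [x]. Otherwise its derivative lies in
   [M] and has no term at [a0]; if that derivative vanishes too, the element itself is the constant
   sought. *)
have [y0|ny0] := eqVneq (y 1 r') 0.
  have xE' : x = \sum_i @pure _ RC A (r (lift ord0 i) - r ord0 * r' i) (a' i).
    have e := yM 1 r' (- r ord0); rewrite y0 mulr0 in e.
    rewrite -[LHS]addr0 [X in _ + X]e xE yD mulr1 subrr /y pure0l add0r.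
    by apply: eq_bigr => i _; rewrite mulNr.
  by apply: (IH a' (fun i => r (lift ord0 i) - r ord0 * r' i)); rewrite -xE'.
have [dy0|dy] := eqVneq (tens_der (y 1 r')) 0.
  by have [b bE] := tens_der_eq0 dy0; exists b; rewrite -bE.
have dyE : tens_der (y 1 r') = \sum_i @pure _ RC A (der (r' i)) (a' i).
  by rewrite yder /y der1 pure0l add0r.
by apply: (IH a' (fun i => der (r' i))); rewrite -dyE //; exact: Mder.
Qed.

Fact ring_dalg_str l : der (iota l) = iota (der l).
Proof. by rewrite rmorph_der. Qed.

Definition ring_dalg : dalg L :=
  @Dalg L (@CAlg L R iota) (@der R) (@derD R) (@derM R) ring_dalg_str.
Local Notation RL := ring_dalg.

Section PhiD.
Variable D : dalg L.
Local Notation T := (tens_dalg RL D).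
Local Notation RT := (tensor RC (dconst T)).

Definition inlT : {rmorphism RC -> T} := alg_fun (inl_hom RL D).

Fact Phi_compat k : inlT (alg_str RC k) = dc_rmorphism T (alg_str (dconst T) k).
Proof. by []. Qed.

(** The multiplication map from R (x)_C C' to R (x)_L D, where C' is the ring of constants of R
    (x)_L D. For D = R it is the torsor isomorphism of a Picard-Vessiot ring. *)
Definition Phi : RT -> T := rlift Phi_compat.
HB.instance Definition _ := GRing.RMorphism.copy Phi (rlift Phi_compat).

Lemma Phi_pure (r : RC) t : Phi (pure r t) = @tens_inl L RL D r * dc_val t.
Proof. exact: rlift_pure. Qed.

Lemma Phi_der x : Phi (tens_der x) = da_der (Phi x).
Proof.
move: x; apply: tensor_eq => [u v|u v|r t].
- by rewrite tens_derD rmorphD.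
- by rewrite rmorphD da_derD.
rewrite tens_der_pure !Phi_pure da_derM dc_der mulr0 addr0; congr (_ * _).
by rewrite /= tens_dder_pure da_der1 pure0r addr0.
Qed.

(** The kernel is a differential submodule. By [simple_submodule] a nonzero kernel would contain
    some 1 (x) t with t a nonzero constant, but [Phi] maps this to t itself. *)
Lemma Phi_inj : injective Phi.
Proof.
move=> x y xy; apply/eqP; rewrite -subr_eq0; apply: contraT => xy0.
pose M z := Phi z = 0.
have [||||t []] := @simple_submodule (dconst T) M _ _ _ _ _ xy0.
- by move=> u v; rewrite /M rmorphD /= => -> ->; rewrite addr0.
- by move=> r u; rewrite /M rmorphM /= => ->; rewrite mulr0.
- by move=> u; rewrite /M Phi_der => ->; exact: da_der0.
- by rewrite /M rmorphB /= xy subrr.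
rewrite /M Phi_pure rmorph1 mul1r => t0 /eqP[].
have -> : t = 0 by exact/val_inj.
by rewrite rmorph0.
Qed.

End PhiD.
End SimpleTensor.

(** * The universal differential automorphism of a Picard-Vessiot ring *)

Section UniversalAut.
Variables (L : diffFieldType) (R : diffRingType) (iota : {dmorphism L -> R}).
Local Notation RC := (ext_calg iota).
Local Notation RL := (ring_dalg iota).
Local Notation T := (tens_dalg RL RL).
Local Notation A' := (dconst T).

Hypothesis constR : forall x : R, der x = 0 ->
  exists c : constants L, iota (const_val c) = x.
Hypothesis simpleR : diff_simple R.
Hypothesis matrixR : exists n (Z : 'M[R]_n), PV_matrix iota Z.

Local Notation PhiR := (@Phi L R iota RL).

Definition inrT : {rmorphism RC -> T} := alg_fun (inr_hom RL RL).

Fact Psi_compat k : inrT (alg_str RC k) = dc_rmorphism T (alg_str A' k).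
Proof. exact/esym/(@tens_inlr L RL RL (val k)). Qed.

Definition Psi : tensor RC A' -> T := rlift Psi_compat.
HB.instance Definition _ := GRing.RMorphism.copy Psi (rlift Psi_compat).

Lemma Psi_pure (r : RC) t : Psi (pure r t) = @tens_inr L RL RL r * dc_val t.
Proof. exact: rlift_pure. Qed.

Lemma Psi_der x : Psi (tens_der x) = da_der (Psi x).
Proof.
move: x; apply: tensor_eq => [u v|u v|r t].
- by rewrite tens_derD rmorphD.
- by rewrite rmorphD da_derD.
rewrite tens_der_pure !Psi_pure da_derM dc_der mulr0 addr0; congr (_ * _).
by rewrite /= tens_dder_pure da_der1 pure0l add0r.
Qed.

(** W = (Z^-1 (x) 1)(1 (x) Z) has constant entries, since Z (x) 1 and 1 (x) Z solve the same
    equation over L, and 1 (x) Z = (Z (x) 1) W. The same holds for the inverse [W'], and Z together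
    with 1/det Z generates R. *)
Lemma Phi_surj y : exists x, PhiR x = y.
Proof.
pose Q (y : T) := exists x, PhiR x = y.
have QD u v : Q u -> Q v -> Q (u + v).
  by move=> [a <-] [b <-]; exists (a + b); rewrite rmorphD.
have QM u v : Q u -> Q v -> Q (u * v).
  by move=> [a <-] [b <-]; exists (a * b); rewrite rmorphM.
have Q0 : Q 0 by exists 0; rewrite rmorph0.
have Ql (r : R) : Q (@tens_inl L RL RL r).
  by exists (@pure _ RC A' r 1); rewrite Phi_pure mulr1.
have Qc (t : A') : Q (dc_val t).
  by exists (@pure _ RC A' 1 t); rewrite Phi_pure rmorph1 mul1r.
suff Qr (r : R) : Q (@tens_inr L RL RL r).
  move: y; apply: tensor_ind => [//|b a x Qx]; apply: QD => //.
  by rewrite pureE; exact: QM.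
have [n [Z [Zu [a aE] Zgen]]] := matrixR.
pose il : {rmorphism R -> T} := alg_fun (inl_hom RL RL).
pose ir : {rmorphism R -> T} := alg_fun (inr_hom RL RL).
have dZ : map_mx der Z = map_mx iota a *m Z by rewrite -aE mulmxKV.
have dZV : map_mx der (invmx Z) = - (invmx Z *m map_mx iota a).
  have : map_mx der (Z *m invmx Z) = 0.
    by rewrite mulmxV //; apply/matrixP => i j; rewrite !mxE; case: (_ == _); rewrite ?der1 ?der0.
  have -> : map_mx der (Z *m invmx Z) =
      map_mx der Z *m invmx Z + Z *m map_mx der (invmx Z).
    apply/matrixP => i j; rewrite !mxE.
    rewrite (big_morph (@der R) (@derD R) (@der0 R)) -big_split.
    by apply: eq_bigr => k _; rewrite derM !mxE.
  rewrite dZ mulmxK // => /eqP; rewrite addrC addr_eq0 => /eqP e.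
  by rewrite -[LHS](mulKmx Zu) e mulmxN.
have dil q : da_der (il q) = il (der q).
  by rewrite /= tens_dder_pure da_der1 pure0r addr0.
have dir q : da_der (ir q) = ir (der q).
  by rewrite /= tens_dder_pure da_der1 pure0l add0r.
have ilir l : il (iota l) = ir (iota l) by exact: (@tens_inlr L RL RL).
pose W := map_mx il (invmx Z) *m map_mx ir Z.
pose W' := map_mx ir (invmx Z) *m map_mx il Z.
have dmx m p q (M : 'M[T]_(m, p)) (N : 'M[T]_(p, q)) :
    map_mx (@da_der _ T) (M *m N) =
    map_mx (@da_der _ T) M *m N + M *m map_mx (@da_der _ T) N.
  apply/matrixP => i j; rewrite !mxE.
  rewrite (big_morph (@da_der _ T) (@da_derD _ T) (@da_der0 _ T)) -big_split.
  by apply: eq_bigr => k _; rewrite da_derM !mxE.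
have dilmx m p (M : 'M[R]_(m, p)) :
    map_mx (@da_der _ T) (map_mx il M) = map_mx il (map_mx der M).
  by apply/matrixP => i j; rewrite !mxE dil.
have dirmx m p (M : 'M[R]_(m, p)) :
    map_mx (@da_der _ T) (map_mx ir M) = map_mx ir (map_mx der M).
  by apply/matrixP => i j; rewrite !mxE dir.
have ilirmx m p (M : 'M[L]_(m, p)) :
    map_mx il (map_mx iota M) = map_mx ir (map_mx iota M).
  by apply/matrixP => i j; rewrite !mxE ilir.
have dW : map_mx (@da_der _ T) W = 0.
  rewrite dmx dilmx dirmx dZ dZV map_mxN !map_mxM ilirmx.
  by rewrite mulNmx -mulmxA addNr.
have dW' : map_mx (@da_der _ T) W' = 0.
  rewrite dmx dilmx dirmx dZ dZV map_mxN !map_mxM ilirmx.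
  by rewrite mulNmx -mulmxA addNr.
have QW i j : Q (W i j).
  have Wij : W i j \in @dconst_pred L T.
    by move/matrixP/(_ i j): dW; rewrite unfold_in !mxE => ->.
  exact: (Qc (DConst Wij)).
have QW' i j : Q (W' i j).
  have Wij : W' i j \in @dconst_pred L T.
    by move/matrixP/(_ i j): dW'; rewrite unfold_in !mxE => ->.
  exact: (Qc (DConst Wij)).
have Qsum (I : finType) (f : I -> T) : (forall i, Q (f i)) -> Q (\sum_i f i).
  by move=> Qf; elim/big_ind: _.
have irZ i j : Q (ir (Z i j)).
  have -> : ir (Z i j) = (map_mx il Z *m W) i j.
    by rewrite /W mulmxA -map_mxM mulmxV // map_mx1 mul1mx mxE.
  rewrite mxE; apply: Qsum => k; rewrite [map_mx _ _ _ _]mxE.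
  by apply: QM; [exact: Ql|exact: QW].
have irZV i j : Q (ir (invmx Z i j)).
  have -> : ir (invmx Z i j) = (W' *m map_mx il (invmx Z)) i j.
    by rewrite /W' -mulmxA -map_mxM mulmxV // map_mx1 mulmx1 mxE.
  rewrite mxE; apply: Qsum => k; rewrite [map_mx _ _ _ _]mxE.
  by apply: QM; [exact: QW'|exact: Ql].
have Q1 : Q 1 by rewrite -(rmorph1 il); exact: Ql.
have QN u : Q u -> Q (- u) by case=> b <-; exists (- b); rewrite rmorphN.
have irdet : Q (ir (\det (invmx Z))).
  rewrite /determinant rmorph_sum; apply: Qsum => s.
  rewrite rmorphM rmorphXn rmorphN rmorph1 rmorph_prod.
  apply: (QM _ _); last by apply: (big_ind Q) => [||i _]; [exact: Q1|exact: QM|exact: irZV].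
  elim: (X in _ ^+ X) => [|k IHk]; first by rewrite expr0.
  by rewrite exprS; apply: (QM _ _) => //; exact: QN.
elim: (Zgen r) => [l|x [[i [j ->]]|->]|x z _ IHx _ IHz|x z _ IHx _ IHz].
- by rewrite -[tens_inr _ _]ilir; exact: Ql.
- exact: irZ.
- by rewrite -det_inv.
- by rewrite rmorphD; exact: QD.
- by rewrite rmorphM; exact: QM.
Qed.

Local Notation sw := (dconst_map (swap_dhom RL)).

Lemma Psi_swap x : Psi x = swap_hom RL (PhiR (tens_map (algHom_id RC) sw x)).
Proof.
move: x; apply: tensor_eq => [u v|u v|r t].
- by rewrite rmorphD.
- by rewrite !rmorphD.
rewrite Psi_pure tens_map_pure Phi_pure rmorphM /= tens_swapK.
by rewrite /tens_inl tens_swap_pure.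
Qed.

Lemma sw_id x :
  tens_map (algHom_id RC) sw (tens_map (algHom_id RC) sw x) = x.
Proof.
move: x; apply: tensor_eq => [u v|u v|r t] //; first by rewrite !rmorphD.
by rewrite !tens_map_pure; congr pure; apply/val_inj; exact: tens_swapK.
Qed.

Definition Phi_inv y : tensor RC A' := projT1 (cid (Phi_surj y)).

Lemma Phi_invK : cancel Phi_inv PhiR.
Proof. by move=> y; rewrite /Phi_inv; case: cid. Qed.

Lemma PhiK : cancel PhiR Phi_inv.
Proof. by move=> x; apply: (Phi_inj constR simpleR); rewrite Phi_invK. Qed.

Definition Psi_inv (y : T) :=
  tens_map (algHom_id RC) sw (Phi_inv (swap_hom RL y)).

Lemma Psi_invK : cancel Psi_inv Psi.
Proof. by move=> y; rewrite Psi_swap sw_id Phi_invK /= tens_swapK. Qed.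

Lemma PsiK : cancel Psi Psi_inv.
Proof. by move=> x; rewrite /Psi_inv Psi_swap /= tens_swapK PhiK sw_id. Qed.

(** The universal point of the Galois group, over the constants of R (x)_L R: it sends r (x) 1 to
    the element that [Phi] identifies with 1 (x) r. *)
Definition univ_fun x := Phi_inv (Psi x).
Definition univ_inv x := Psi_inv (PhiR x).

Lemma univ_funK : cancel univ_fun univ_inv.
Proof. by move=> x; rewrite /univ_inv /univ_fun Phi_invK PsiK. Qed.

Lemma univ_invK : cancel univ_inv univ_fun.
Proof. by move=> x; rewrite /univ_inv /univ_fun Psi_invK PhiK. Qed.

Lemma Phi_univ x : PhiR (univ_fun x) = Psi x.
Proof. exact: Phi_invK. Qed.

Let PhiI := Phi_inj constR simpleR (D := RL).

Fact univ_zmod : zmod_morphism univ_fun.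
Proof. by move=> x y; apply: PhiI; rewrite rmorphB /= !Phi_univ rmorphB. Qed.

Fact univ_monoid : monoid_morphism univ_fun.
Proof.
split=> [|x y]; apply: PhiI; first by rewrite Phi_univ !rmorph1.
by rewrite rmorphM /= !Phi_univ rmorphM.
Qed.

Fact univ_der x : univ_fun (tens_der x) = tens_der (univ_fun x).
Proof. by apply: PhiI; rewrite Phi_der !Phi_univ Psi_der. Qed.

Fact univ_lin (y : tensor (base_calg L) A') :
  univ_fun (tens_map (ext_base_hom iota) (algHom_id A') y) =
  tens_map (ext_base_hom iota) (algHom_id A') y.
Proof.
apply: PhiI; rewrite Phi_univ; move: y; apply: tensor_eq => [u v|u v|l t].
- by rewrite !rmorphD.
- by rewrite !rmorphD.
rewrite tens_map_pure Psi_pure Phi_pure; congr (_ * _).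
exact/esym/(@tens_inlr L RL RL l).
Qed.

Definition univ_aut : diffAut iota A' :=
  DiffAut univ_funK univ_invK univ_zmod univ_monoid univ_der univ_lin.

(** Invariance under the universal automorphism reads 1 (x) r = r (x) 1 in R (x)_L R. An L-linear
    form [la] with la 1 = 1, applied to the first factor, gives r = iota (la r). *)
Lemma fixed_base (r : R) :
    (forall A (s : diffAut iota A), s (@pure _ RC A r 1) = @pure _ RC A r 1) ->
  exists l, r = iota l.
Proof.
move=> /(_ _ univ_aut) /(congr1 PhiR); rewrite Phi_univ Psi_pure Phi_pure.
rewrite !mulr1 => e.
have [r1|] := eqVneq (1 : R) 0.
  by have := oner_neq0 R; rewrite r1 eqxx.
move=> /(@exists_form L RL)[la fl l1]; exists (la r).
move/(congr1 (lslice la)): e; rewrite !lslice_pure // l1 rmorph1 mul1r mulr1.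
by [].
Qed.

End UniversalAut.

(** * Equivariant frames *)

Lemma lslice_map (K : fieldType) (B A A' : calg K) (f : algHom A A')
    (la : B -> K) (x : tensor B A) : is_form la ->
  lslice la (tens_map (algHom_id B) f x) = f (lslice la x).
Proof.
move=> fl; move: x; apply: tensor_eq => [u v|u v|b a].
- by rewrite rmorphD lsliceD.
- by rewrite lsliceD // rmorphD.
by rewrite tens_map_pure !lslice_pure // rmorphM alg_funE.
Qed.

Lemma pure_split (K : fieldType) (B A : calg K) (b : B) (a : A) :
  pure b a = pure b 1 * pure 1 a.
Proof. by rewrite pureM mulr1 mul1r. Qed.

Section EquivariantFrame.
Variables (L : diffFieldType) (R : diffRingType) (iota : {dmorphism L -> R}).
Local Notation RC := (ext_calg iota).
Local Notation RL := (ring_dalg iota).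
Local Notation T := (tens_dalg RL RL).
Local Notation A' := (dconst T).

Hypothesis constR : forall x : R, der x = 0 ->
  exists c : constants L, iota (const_val c) = x.
Hypothesis simpleR : diff_simple R.
Hypothesis matrixR : exists n (Z : 'M[R]_n), PV_matrix iota Z.

Local Notation univ := (univ_aut constR simpleR matrixR).

Section Pullback.
Variables (D : dalg L) (psi : dalgHom RL D).

Definition pull_aut : diffAut iota (dconst (tens_dalg RL D)) :=
  diffAut_map (dconst_map (tens_dmap RL psi)) univ.

Lemma Phi_pull (r : R) :
  @Phi L R iota D (pull_aut (@pure _ RC _ r 1)) = @tens_inr L RL D (psi r).
Proof.
rewrite /= diffAut_ext_pure pure11 mulr1.
have PhiM x : @Phi L R iota D
    (tens_map (algHom_id RC) (dconst_map (tens_dmap RL psi)) x) =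
    tens_map (algHom_id RL) psi (@Phi L R iota RL x).
  move: x; apply: tensor_eq => [u v|u v|s t].
  - by rewrite !rmorphD.
  - by rewrite !rmorphD.
  by rewrite tens_map_pure !Phi_pure rmorphM /= tens_map_pure rmorph1.
by rewrite PhiM Phi_univ Psi_pure mulr1 /tens_inr tens_map_pure rmorph1.
Qed.

End Pullback.

Lemma diffAut_eq (A : calg (constants L)) (s t : diffAut iota A) :
  (forall r, s (@pure _ RC A r 1) = t (@pure _ RC A r 1)) -> s = t.
Proof.
move=> st; apply: diffAutP; apply: tensor_eq => [u v|u v|r a].
- by rewrite rmorphD.
- by rewrite rmorphD.
by rewrite pure_split !rmorphM /= !diffAut_scal st.
Qed.

Section ConstantExtension.
Variables (A : calg (constants L)) (s : diffAut iota A).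

Fact cext_str_compat l : tens_der (@pure _ RC A (iota l) 1) =
  @pure _ RC A (iota (der l)) 1.
Proof. by rewrite tens_der_pure rmorph_der. Qed.

Definition cext_dalg : dalg L :=
  @Dalg L (@CAlg L (tensor RC A) (@tens_inl _ RC A \o iota))
    (@tens_der L R iota A) (@tens_derD _ _ _ A) (@tens_derM _ _ _ A)
    cext_str_compat.
Local Notation D := cext_dalg.

Definition incl_hom : algHom RL D :=
  @AlgHom L RL D (alg_fun (inl_hom RC A)) (fun l => erefl).

Fact incl_der (x : RL) : incl_hom (da_der x) = da_der (incl_hom x).
Proof. by rewrite /= tens_der_pure. Qed.

Definition incl_dhom : dalgHom RL D := DalgHom incl_der.

Fact act_str l : (s \o alg_fun (inl_hom RC A)) (alg_str RL l) = alg_str D l.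
Proof. exact: diffAut_base. Qed.

Definition act_hom : algHom RL D :=
  @AlgHom L RL D (s \o alg_fun (inl_hom RC A)) act_str.

Fact act_der (x : RL) : act_hom (da_der x) = da_der (act_hom x).
Proof. by rewrite /= -aut_der tens_der_pure. Qed.

Definition act_dhom : dalgHom RL D := DalgHom act_der.

Definition scal_fun : {rmorphism A -> tens_dalg RL D} :=
  @tens_inr L RL D \o @tens_inr _ RC A.

Fact scal_const a : scal_fun a \in @dconst_pred L (tens_dalg RL D).
Proof.
by rewrite unfold_in /= tens_dder_pure /= tens_der_inr der1 pure0r pure0l addr0.
Qed.

Definition scal_map a : dconst (tens_dalg RL D) := DConst (scal_const a).

Fact scal_map_zmod : zmod_morphism scal_map.
Proof. by move=> x y; apply/val_inj; rewrite /= !raddfB. Qed.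

Fact scal_map_monoid : monoid_morphism scal_map.
Proof. by split=> [|x y]; apply/val_inj; rewrite /= ?rmorph1 ?rmorphM. Qed.

HB.instance Definition _ := GRing.isZmodMorphism.Build A
  (dconst (tens_dalg RL D)) scal_map scal_map_zmod.
HB.instance Definition _ := GRing.isMonoidMorphism.Build A
  (dconst (tens_dalg RL D)) scal_map scal_map_monoid.

Fact scal_mapE k :
  scal_map (alg_str A k) = alg_str (dconst (tens_dalg RL D)) k.
Proof.
apply/val_inj; rewrite /= -(@tens_inlr _ RC A).
exact/esym/(@tens_inlr L RL D (val k)).
Qed.

Definition scal_hom : algHom A (dconst (tens_dalg RL D)) :=
  @AlgHom _ A (dconst (tens_dalg RL D)) scal_map scal_mapE.

(* Both sides map r to the element 1 (x) s(r) of R (x)_L (R (x)_C A). *)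
Lemma pull_act :
  (pull_aut incl_dhom * diffAut_map scal_hom s)%g = pull_aut act_dhom.
Proof.
apply: diffAut_eq => r; apply: (Phi_inj constR simpleR).
have sE : diffAut_map scal_hom s (@pure _ RC _ r 1) =
    tens_map (algHom_id RC) scal_hom (s (@pure _ RC A r 1)).
  by rewrite /= diffAut_ext_pure pure11 mulr1.
rewrite Phi_pull.
transitivity (@Phi L R iota D (pull_aut incl_dhom
  (diffAut_map scal_hom s (@pure _ RC _ r 1)))); first by [].
rewrite sE; transitivity (@tens_inr L RL D (s (@pure _ RC A r 1))); last by [].
move: (s _) => y.
move: y; apply: (@tensor_eq _ RC A _
  (fun y => @Phi L R iota D (pull_aut incl_dhom
     (tens_map (algHom_id RC) scal_hom y))) (@tens_inr L RL D)).
- by move=> u v; rewrite !rmorphD.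
- by move=> u v; rewrite rmorphD.
move=> q a; rewrite tens_map_pure pure_split rmorphM [X in _ * X]diffAut_scal rmorphM.
rewrite [X in X * _]Phi_pull [X in _ * X]Phi_pure rmorph1 mul1r.
by rewrite (pure_split q a) -(rmorphM (@tens_inr L RL D)).
Qed.

End ConstantExtension.

Section Frame.
Variables (n : nat) (rep : forall A, diffAut iota A -> 'M[A]_n).
Hypothesis repM : forall A (s t : diffAut iota A),
  rep (s * t)%g = rep s *m rep t.
Hypothesis rep1 : forall A, rep (1%g : diffAut iota A) = 1%:M.
Hypothesis rep_map : forall A B (f : algHom A B) (s : diffAut iota A),
  rep (diffAut_map f s) = map_mx f (rep s).
Variables (E : fieldType) (e : {rmorphism R -> E}).
Hypothesis e_inj : injective e.

Let M : 'M[T]_n := map_mx (dc_rmorphism T) (rep univ).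
Let M' : 'M[T]_n := map_mx (dc_rmorphism T) (rep univ^-1%g).

Let MM' : M *m M' = 1%:M.
Proof. by rewrite -map_mxM -repM mulgV rep1 map_mx1. Qed.

Let M'M : M' *m M = 1%:M.
Proof. exact: mulmx1C MM'. Qed.

(** This is [pull_act] read through [rep]: a cocycle identity in which s acts on the second factor
    of R (x)_L R only. *)
Lemma rep_act (A : calg (constants L)) (s : diffAut iota A) :
  map_mx (tens_map (algHom_id RL) (act_dhom s)) M =
  map_mx (tens_map (algHom_id RL) (incl_dhom A)) M *m
    map_mx (scal_fun A) (rep s).
Proof.
have := congr1 (fun t => map_mx (dc_rmorphism _) (rep t)) (pull_act s).
rewrite repM map_mxM !rep_map => H.
transitivity (map_mx (dc_rmorphism (tens_dalg RL (cext_dalg A)))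
  (map_mx (dconst_map (tens_dmap RL (act_dhom s))) (rep univ))).
  by apply/matrixP => i j; rewrite !mxE.
rewrite -H; congr (_ *m _); by apply/matrixP => i j; rewrite !mxE.
Qed.

Definition equivariant m (u : 'M[R]_(m, n)) : Prop :=
  forall A (s : diffAut iota A),
    map_mx s (map_mx (@tens_inl _ RC A) u) =
    map_mx (@tens_inl _ RC A) u *m map_mx (@tens_inr _ RC A) (rep s).

(** An L-linear form on the first factor of R (x)_L R commutes with the action of s on the second
    factor, so it carries the identity of [rep_act] over to R. *)
Lemma slice_equivariant (la : RL -> L) : is_form la ->
  equivariant (map_mx (lslice la) M).
Proof.
move=> fl A s; apply/matrixP => i j.
have H : tens_map (algHom_id RL) (act_dhom s) (M i j) =
    \sum_k tens_map (algHom_id RL) (incl_dhom A) (M i k) *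
      @tens_inr L RL (cext_dalg A) (@tens_inr _ RC A (rep s k j)).
  have /matrixP/(_ i j) := rep_act s; rewrite [LHS]mxE [RHS]mxE => ->.
  by apply: eq_bigr => k _; rewrite [map_mx _ M _ _]mxE [map_mx _ (rep s) _ _]mxE.
transitivity (act_dhom s (lslice la (M i j))).
  by rewrite [LHS]mxE [map_mx _ _ _ _]mxE [map_mx _ _ _ _]mxE.
rewrite -lslice_map // H /lslice rmorph_sum slice_sum // [RHS]mxE.
apply: eq_bigr => k _; rewrite -/(lslice la _) mulrC lslice_inr // lslice_map //.
by rewrite mulrC; congr (_ * _); rewrite !mxE.
Qed.

(** If a column w over the field E killed all equivariant rows, it would kill the slices of [M];
    then M w = 0, and w = 0 because [M] is invertible. So [rows_full] supplies n equivariant rows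
    independent over E. *)
Lemma equivariant_frame : exists2 Z : 'M[R]_n, Z \in unitmx & equivariant Z.
Proof.
have R1 : (1 : R) != 0 by apply: oner_neq0.
pose eL : calg L := @CAlg L E (e \o iota).
pose eh : algHom RL eL := @AlgHom L RL eL e (fun l => erefl).
pose P (u : 'rV[E]_n) := exists2 v : 'rV[R]_n, equivariant v & u = map_mx e v.
have [w Pw|Zf ZfP Zfu] := @rows_full E n P.
  have tw : map_mx (tens_map (algHom_id RL) eh) M *m map_mx (@tens_inr L RL eL) w = 0.
    apply/matrixP => i j; rewrite [RHS]mxE; apply: lslices_eq0 => la fl.
    have Pu : P (map_mx e (row i (map_mx (lslice la) M))).
      exists (row i (map_mx (lslice la) M)) => // A s.
      by rewrite !map_row slice_equivariant // row_mul.
    have /matrixP/(_ 0 j) := Pw _ Pu.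
    rewrite ord1 !mxE => <-; rewrite /lslice rmorph_sum slice_sum //.
    apply: eq_bigr => k _; rewrite -/(lslice la _) !mxE mulrC lslice_inr //.
    by rewrite lslice_map // mulrC.
  have iw : map_mx (@tens_inr L RL eL) w = 0.
    rewrite -[LHS]mul1mx -(map_mx1 (tens_map (algHom_id RL) eh)) -M'M map_mxM.
    by rewrite -mulmxA tw mulmx0.
  apply/matrixP => i j; apply: (@tens_inr_inj L RL eL) => //.
  by move/matrixP/(_ i j): iw; rewrite !mxE rmorph0.
have /choice[z zP] : forall i, exists v, equivariant v /\ row i Zf = map_mx e v.
  by move=> i; have [v ev vE] := ZfP i; exists v.
pose Z : 'M[R]_n := \matrix_(i, j) z i 0 j.
have rowZ i : row i Z = z i by apply/rowP => j; rewrite !mxE.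
have eZ : map_mx e Z = Zf.
  by apply/row_matrixP => i; rewrite -map_row rowZ (proj2 (zP i)).
have Zeq : equivariant Z.
  move=> A s; apply/row_matrixP => i; rewrite row_mul -!map_row rowZ.
  exact: (proj1 (zP i)).
exists Z => //; rewrite unitmxE.
have [c0|] := eqVneq (\det Z) 0.
  have := Zfu; rewrite unitmxE -eZ det_map_mx c0 rmorph0 unitr0.
  by [].
move=> /(@exists_form L RL)[la fl l1].
have ZM : map_mx (@tens_inr L RL RL) Z = map_mx (@tens_inl L RL RL) Z *m M.
  have /(congr1 (map_mx (@Phi L R iota RL))) := Zeq _ univ.
  rewrite map_mxM => H; apply/matrixP => i j.
  transitivity (@Phi L R iota RL (univ (@pure _ RC _ (Z i j) 1))).
    by rewrite Phi_univ Psi_pure mulr1 mxE.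
  move/matrixP/(_ i j): H; rewrite [LHS]mxE [map_mx _ _ _ _]mxE.
  rewrite [map_mx _ _ _ _]mxE [RHS]mxE => ->; rewrite [RHS]mxE.
  apply: eq_bigr => k _; congr (_ * _).
    by rewrite !mxE /= Phi_pure mulr1.
  by rewrite !mxE /= Phi_pure rmorph1 mul1r.
(* Independence over E does not yet make det Z a unit of R. The relation 1 (x) Z = (Z (x) 1) M gives
   (1 (x) det Z) det M' = det Z (x) 1, and a form with value 1 on det Z turns this into an inverse
   in R. *)
have dZ : @tens_inr L RL RL (\det Z) * \det M' = @tens_inl L RL RL (\det Z).
  have -> : @tens_inr L RL RL (\det Z) = \det (map_mx (@tens_inr L RL RL) Z).
    by rewrite (det_map_mx (alg_fun (inr_hom RL RL))).
  rewrite ZM det_mulmx -mulrA -det_mulmx MM' det1 mulr1.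
  by rewrite (det_map_mx (alg_fun (inl_hom RL RL))).
move/(congr1 (lslice la)): dZ; rewrite lslice_inr // lslice_pure // l1 rmorph1 mulr1.
by move=> cu; apply/unitrPr; exists (lslice la (\det M')).
Qed.

End Frame.
End EquivariantFrame.

(** * Adjoining coordinates over K to an algebra over larger constants *)

Section ExtendConstants.
Variables (K K' : fieldType) (h : {rmorphism K -> K'}).
Variables (A : calg K') (X : calg K).

Definition ext_alg : calg K' :=
  @CAlg K' (tensor (restrict h A) X)
    (alg_fun (inl_hom (restrict h A) X) \o alg_str A).

Definition ext_inl : algHom A ext_alg :=
  @AlgHom K' A ext_alg (alg_fun (inl_hom (restrict h A) X)) (fun k => erefl).

Fact ext_inr_str k : tens_inr (restrict h A) (alg_str X k) =
  alg_str (restrict h ext_alg) k.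
Proof. exact/esym/(@tens_inlr K (restrict h A) X). Qed.

Definition ext_inr : algHom X (restrict h ext_alg) :=
  @AlgHom K X (restrict h ext_alg) (@tens_inr K (restrict h A) X) ext_inr_str.

Section ExtSlice.
Variables (B : calg K') (mu : X -> K) (fm : is_form mu).

Definition ext_slice : tensor B ext_alg -> tensor B A :=
  tens_linr (A := ext_alg) (slice mu).

Let sliceD_ext : {morph (slice mu : ext_alg -> A) : x y / x + y} := sliceD fm.

Let sliceZ_ext k (t : ext_alg) :
  slice mu (alg_str ext_alg k * t) = alg_str A k * slice mu t :> A.
Proof. exact: (slice_inl fm (alg_str A k : restrict h A)). Qed.

Lemma ext_slice_pure b (t : ext_alg) :
  ext_slice (pure b t) = pure b (slice mu t : A).
Proof. exact: (tens_linr_pure (A := ext_alg) sliceD_ext sliceZ_ext). Qed.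

Lemma ext_sliceD : {morph ext_slice : x y / x + y}.
Proof. exact: (tens_linrD (A := ext_alg) sliceD_ext sliceZ_ext). Qed.

Lemma ext_slice_sum I (r : seq I) (P : pred I) (f : I -> tensor B ext_alg) :
  ext_slice (\sum_(i <- r | P i) f i) = \sum_(i <- r | P i) ext_slice (f i).
Proof.
apply: (big_morph ext_slice ext_sliceD).
exact: (tens_linr0 (A := ext_alg) _ sliceD_ext sliceZ_ext).
Qed.

End ExtSlice.

Lemma ext_slice_map (B B' : calg K') (f : algHom B B') (mu : X -> K) x :
  is_form mu -> ext_slice mu (tens_map f (algHom_id ext_alg) x) =
    tens_map f (algHom_id A) (ext_slice (B := B) mu x).
Proof.
move=> fm; move: x; apply: tensor_eq => [u v|u v|b t].
- by rewrite rmorphD ext_sliceD.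
- by rewrite ext_sliceD // rmorphD.
by rewrite tens_map_pure !ext_slice_pure // tens_map_pure.
Qed.

End ExtendConstants.

(** * Equivariant functions on G with values in a Picard-Vessiot ring *)

Section Equivariant.
Variables (F F0 : diffFieldType) (iota0 : {dmorphism F -> F0}).
Variable (G : linAlgGroup (constants F)).
Local Notation KG := (lag_coord G).
Local Notation O := (tensor (ext_calg iota0) KG).

Variables (L : diffFieldType) (i : {dmorphism F -> L}).
Variables (R : diffRingType) (iota : {dmorphism L -> R}).
Variables (jL : {dmorphism L -> F0}) (e : {dmorphism R -> F0}).
Hypothesis eE : forall x, e (iota x) = jL x.
Hypothesis jLi : forall x, jL (i x) = iota0 x.
Local Notation h := (constants_map i).
Variable phi : gfHom (diffGal iota) (base_change h G).
Local Notation RC := (ext_calg iota).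
Local Notation FC := (ext_calg jL).
Local Notation Gr A := (G (restrict h A)).

Definition act_pt (A : calg (constants L)) (s : diffAut iota A) : Gr A :=
  phi A s.

Lemma act_ptM A (s t : diffAut iota A) :
  act_pt (s * t)%g = (act_pt s * act_pt t)%g.
Proof. by have := @gmulfM _ _ (phi A) s t. Qed.

Lemma act_pt_map A B (f : algHom A B) (s : diffAut iota A) :
  act_pt (diffAut_map f s) = gf_map G (restrict_hom h f) (act_pt s).
Proof. exact: (gf_nat phi f s). Qed.

Lemma act_pt1 A : act_pt (1%g : diffAut iota A) = 1%g.
Proof.
by apply: (@mulgI _ (act_pt (1%g : diffAut iota A))); rewrite -act_ptM !mulg1.
Qed.

Section Evaluation.
Variables (A : calg (constants L)) (g : Gr A).

Definition ev_inr : {rmorphism KG -> tensor FC A} :=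
  alg_fun (inr_hom FC A) \o pt g.

Definition ev_inl : {rmorphism ext_calg iota0 -> tensor FC A} :=
  alg_fun (inl_hom FC A).

Fact ev_compat k : ev_inl (alg_str (ext_calg iota0) k) = ev_inr (alg_str KG k).
Proof.
rewrite /= alg_funE /= -jLi.
exact: (@tens_inlr _ FC A (h k)).
Qed.

Definition ev : O -> tensor FC A := rlift ev_compat.
HB.instance Definition _ := GRing.RMorphism.copy ev (rlift ev_compat).

Lemma ev_pure (f : ext_calg iota0) a :
  ev (pure f a) = @pure _ FC A f (pt g a).
Proof. by rewrite /ev rlift_pure /= pureM mulr1 mul1r. Qed.

Lemma ev_der x : ev (tens_der x) = tens_der (ev x).
Proof.
move: x; apply: tensor_eq => [u v|u v|f a].
- by rewrite tens_derD rmorphD.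
- by rewrite rmorphD tens_derD.
by rewrite tens_der_pure !ev_pure tens_der_pure.
Qed.

End Evaluation.

Definition emb_tens (A : calg (constants L)) :
    tensor RC A -> tensor FC A :=
  tens_map (ext_hom eE) (algHom_id A).
HB.instance Definition _ A := GRing.RMorphism.copy (@emb_tens A)
  (tens_map (ext_hom eE) (algHom_id A)).

Lemma emb_tens_pure A (r : RC) a :
  emb_tens (@pure _ RC A r a) = @pure _ FC A (e r) a.
Proof. exact: tens_map_pure. Qed.

Lemma emb_tens_der A (x : tensor RC A) :
  emb_tens (tens_der x) = tens_der (emb_tens x).
Proof.
move: x; apply: tensor_eq => [u v|u v|f a].
- by rewrite tens_derD rmorphD.
- by rewrite rmorphD tens_derD.
by rewrite tens_der_pure !emb_tens_pure tens_der_pure rmorph_der.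
Qed.

(* [x], a function on G with values in F0, takes values in R and satisfies
   x(phi(s) g) = s(x(g)). *)
Definition equivar (x : O) : Prop :=
  forall A (g : Gr A) (s : diffAut iota A), exists y,
    ev g x = emb_tens y /\ ev (act_pt s * g)%g x = emb_tens (s y).

Lemma equivarD x y : equivar x -> equivar y -> equivar (x + y).
Proof.
move=> Ex Ey A g s; have [x' [x1 x2]] := Ex A g s; have [y' [y1 y2]] := Ey A g s.
by exists (x' + y'); rewrite !rmorphD /= x1 x2 y1 y2.
Qed.

Lemma equivarM x y : equivar x -> equivar y -> equivar (x * y).
Proof.
move=> Ex Ey A g s; have [x' [x1 x2]] := Ex A g s; have [y' [y1 y2]] := Ey A g s.
by exists (x' * y'); rewrite !rmorphM /= x1 x2 y1 y2.
Qed.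

Lemma equivar_der x : equivar x -> equivar (tens_der x).
Proof.
move=> Ex A g s; have [x' [x1 x2]] := Ex A g s.
by exists (tens_der x'); rewrite !ev_der x1 x2 aut_der !emb_tens_der.
Qed.

Lemma equivar_base l : equivar (tens_inl KG (jL l : ext_calg iota0)).
Proof.
move=> A g s; exists (@pure _ RC A (iota l) 1).
by rewrite diffAut_base !ev_pure emb_tens_pure eE !rmorph1.
Qed.

Lemma equivar0 : equivar 0.
Proof. by have := equivar_base 0; rewrite !rmorph0. Qed.

Lemma equivar1 : equivar 1.
Proof. by have := equivar_base 1; rewrite !rmorph1. Qed.

Hypothesis e_inj : injective e.
Hypothesis constR : forall x : R, der x = 0 ->
  exists c : constants L, iota (const_val c) = x.
Hypothesis simpleR : diff_simple R.
Hypothesis matrixR : exists n (Z : 'M[R]_n), PV_matrix iota Z.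

Lemma emb_tens_inj A : injective (@emb_tens A).
Proof. by apply: tens_map_inj => x y; exact: e_inj. Qed.

Section Comodule.
Variable V : comodule G.
Local Notation n := (cm_dim V).
Local Notation v := (cm_v V).
Local Notation rho := (cm_rho V).

Definition act_rep (A : calg (constants L)) (s : diffAut iota A) : 'M[A]_n :=
  map_mx (pt (act_pt s)) rho.

Lemma act_repM A (s t : diffAut iota A) :
  act_rep (s * t)%g = act_rep s *m act_rep t.
Proof. by rewrite /act_rep act_ptM cm_rhoM. Qed.

Lemma act_rep1 A : act_rep (1%g : diffAut iota A) = 1%:M.
Proof. by rewrite /act_rep act_pt1 cm_rho1. Qed.

Lemma act_rep_map A B (f : algHom A B) (s : diffAut iota A) :
  act_rep (diffAut_map f s) = map_mx f (act_rep s).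
Proof.
by apply/matrixP => a b; rewrite /act_rep act_pt_map !mxE pt_mapE.
Qed.

Lemma frame_exists : exists2 Z : 'M[R]_n, Z \in unitmx & equivariant act_rep Z.
Proof.
exact: (equivariant_frame constR simpleR matrixR act_repM act_rep1 act_rep_map e).
Qed.

Variable Z : 'M[R]_n.
Hypotheses (Zu : Z \in unitmx) (Zeq : equivariant act_rep Z).

Lemma frame_inv A (s : diffAut iota A) :
  map_mx s (map_mx (@tens_inl _ RC A) (invmx Z)) =
  map_mx (@tens_inr _ RC A) (act_rep s^-1%g) *m
    map_mx (@tens_inl _ RC A) (invmx Z).
Proof.
pose il : {rmorphism R -> tensor RC A} := alg_fun (inl_hom RC A).
have e1 : map_mx s (map_mx il Z) *m map_mx s (map_mx il (invmx Z)) = 1%:M.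
  by rewrite -!map_mxM mulmxV // !map_mx1.
have e2 : (map_mx (@tens_inr _ RC A) (act_rep s^-1%g) *m map_mx il (invmx Z)) *m
    map_mx s (map_mx il Z) = 1%:M.
  rewrite [map_mx s _]Zeq mulmxA -[X in X *m _]mulmxA.
  rewrite -[X in (_ *m X) *m _](map_mxM il) mulVmx // map_mx1 mulmx1.
  by rewrite -map_mxM -act_repM mulVg act_rep1 map_mx1.
by rewrite -[LHS]mul1mx -e2 -mulmxA e1 mulmx1.
Qed.

(** The value of Z w at phi(s) g is Z rho(phi(s)) w(g). Equivariance of Z says s(Z) = Z rho(phi(s)),
    so this is s applied to the value at g. It serves for w = v and for w = rho. *)
Lemma equivar_frame p (w : 'M[KG]_(n, p)) a b :
    (forall A (x y : G A), map_mx (pt (x * y)%g) w =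
      map_mx (pt x) rho *m map_mx (pt y) w) ->
  equivar ((map_mx (@tens_inl _ (ext_calg iota0) KG) (map_mx e Z) *m
    map_mx (@tens_inr _ (ext_calg iota0) KG) w) a b).
Proof.
move=> wM A g s.
pose y (g : Gr A) (Z : 'M[tensor RC A]_n) : 'M_(n, p) :=
  Z *m map_mx (@tens_inr _ RC A) (map_mx (pt g) w).
have evE (g' : Gr A) : ev g' ((map_mx (@tens_inl _ (ext_calg iota0) KG) (map_mx e Z) *m
    map_mx (@tens_inr _ (ext_calg iota0) KG) w) a b) =
    emb_tens (y g' (map_mx (@tens_inl _ RC A) Z) a b).
  rewrite !mxE !rmorph_sum; apply: eq_bigr => k _; rewrite !rmorphM !mxE /=.
  by rewrite !ev_pure !emb_tens_pure !rmorph1.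
exists (y g (map_mx (@tens_inl _ RC A) Z) a b); split; first exact: evE.
rewrite evE; congr emb_tens.
transitivity (map_mx s (y g (map_mx (@tens_inl _ RC A) Z)) a b); last by rewrite mxE.
congr (fun_of_matrix _ a b).
rewrite /y (map_mxM s) Zeq wM map_mxM mulmxA; congr (_ *m _).
by apply/matrixP => c d; rewrite !mxE; exact/esym/diffAut_scal.
Qed.

Definition rho_inv : 'M[KG]_n := map_mx (pt (gen_pt G)^-1%g) rho.

Lemma pt_rho_inv (A : calg (constants F)) (g : G A) :
  map_mx (pt g) rho_inv = map_mx (pt g^-1%g) rho.
Proof.
have gV : gf_map G (pt g) (gen_pt G)^-1%g = g^-1%g.
  by apply: (@mulgI _ g); rewrite mulgV -{1}(map_gen g) -gmulfM mulgV gf_map1.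
by apply/matrixP => a b; rewrite !mxE -gV pt_mapE.
Qed.

Lemma equivar_frame_inv a b :
  equivar ((map_mx (@tens_inr _ (ext_calg iota0) KG) rho_inv *m
    map_mx (@tens_inl _ (ext_calg iota0) KG) (map_mx e (invmx Z))) a b).
Proof.
move=> A g s.
pose y (g : Gr A) (Z : 'M[tensor RC A]_n) : 'M_n :=
  map_mx (@tens_inr _ RC A) (map_mx (pt g^-1%g) rho) *m Z.
have evE (g' : Gr A) : ev g' ((map_mx (@tens_inr _ (ext_calg iota0) KG) rho_inv *m
    map_mx (@tens_inl _ (ext_calg iota0) KG) (map_mx e (invmx Z))) a b) =
    emb_tens (y g' (map_mx (@tens_inl _ RC A) (invmx Z)) a b).
  rewrite /y -pt_rho_inv.
  rewrite !mxE !rmorph_sum; apply: eq_bigr => k _; rewrite !rmorphM !mxE /=.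
  by rewrite !ev_pure !emb_tens_pure !rmorph1.
exists (y g (map_mx (@tens_inl _ RC A) (invmx Z)) a b); split; first exact: evE.
rewrite evE; congr emb_tens.
transitivity (map_mx s (y g (map_mx (@tens_inl _ RC A) (invmx Z))) a b);
  last by rewrite mxE.
congr (fun_of_matrix _ a b).
rewrite /y (map_mxM s) frame_inv mulmxA; congr (_ *m _).
rewrite invgM cm_rhoM map_mxM; congr (_ *m _).
  by apply/matrixP => c d; rewrite !mxE; exact/esym/diffAut_scal.
congr (map_mx _ (map_mx (pt _) _)).
by apply: (@mulgI _ (act_pt s)); rewrite mulgV -act_ptM mulgV act_pt1.
Qed.

(** Evaluated at the generic point of G, equivariance of t v becomes: [t] has entries in R and s(t)
    = t rho(phi(s)). As Z obeys the same law, t Z^-1 is fixed by every s, hence defined over L by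
    [fixed_base]. *)
Lemma equivar_coef (t : 'rV[F0]_n) :
    equivar (\sum_j pure (t 0 j : ext_calg iota0) (v j 0)) ->
  exists u : 'rV[L]_n, t = map_mx jL u *m map_mx e Z.
Proof.
set x := \sum_j _ => Ex.
have [fm dm] := cm_dual V.
have H A (s : diffAut iota A) : exists y : 'I_n -> tensor RC A, forall k,
    @pure _ FC A (t 0 k) 1 = emb_tens (y k) /\
    \sum_j @pure _ FC A (t 0 j) (act_rep s j k) = emb_tens (s (y k)).
  (* Over A (x)_K K[G] both s and the generic point of G are available; the dual forms of [v] then
     separate the coefficients. *)
  pose s2 := diffAut_map (ext_inl h A KG) s.
  pose g : Gr (ext_alg h A KG) := gf_map G (ext_inr h A KG) (gen_pt G).
  have [y [y1 y2]] := Ex _ g s2.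
  have ptv j : pt (act_pt s2 * g)%g (v j 0) =
      \sum_l @pure _ (restrict h A) KG (act_rep s j l) (v l 0).
    have /matrixP/(_ j 0) := cm_vM V (act_pt s2) g; rewrite mxE => ->.
    rewrite mxE; apply: eq_bigr => l _; rewrite !mxE /s2 act_pt_map !pt_mapE.
    by rewrite pt_gen /= pureM mulr1 mul1r.
  have ptg j : pt g (v j 0) = @pure _ (restrict h A) KG 1 (v j 0).
    by rewrite /g pt_mapE pt_gen.
  have sl (q : tensor RC (ext_alg h A KG)) k :
      ext_slice (cm_mu V k) (s2 q) = s (ext_slice (cm_mu V k) q).
    move: q; apply: tensor_eq => [u w|u w|r q].
    - by rewrite rmorphD (ext_sliceD (fm k)).
    - by rewrite (ext_sliceD (fm k)) rmorphD.
    rewrite (ext_slice_pure (fm k)) [in RHS]pure_split rmorphM [X in _ * X]diffAut_scal.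
    rewrite /s2 /= diffAut_ext_pure; move: (s _); apply: tensor_eq => [u w|u w|r' a].
    - by rewrite rmorphD mulrDl (ext_sliceD (fm k)).
    - by rewrite mulrDl.
    rewrite tens_map_pure !pureM !mulr1 (ext_slice_pure (fm k)); congr pure.
    exact: (slice_inl (fm k) (a : restrict h A)).
  exists (fun k => ext_slice (cm_mu V k) y) => k.
  rewrite -sl /emb_tens -!(ext_slice_map _ _ (fm k)) -/(emb_tens _) -/(emb_tens _).
  rewrite -y1 -y2 /x !rmorph_sum !(ext_slice_sum (fm k)); split.
    rewrite (bigD1 k) //= big1 ?addr0.
      rewrite ev_pure ptg (ext_slice_pure (fm k)) slice_pure // dm eqxx.
      by rewrite rmorph1 mul1r.
    move=> j /negPf jk; rewrite ev_pure ptg (ext_slice_pure (fm k)) slice_pure // dm.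
    by rewrite eq_sym jk rmorph0 mul0r pure0r.
  apply: eq_bigr => j _; rewrite /= ev_pure (ext_slice_pure (fm k)) ptv.
  by rewrite (slice_dual (cm_dual V)).
have /choice[r rE] k : exists r, t 0 k = e r.
  (* Over the field of constants itself the tensor factor is trivial, so the coefficient lies in
     R. *)
  have [y /(_ k)[yk _]] := H (base1 (constants L)) 1%g.
  pose idf : base1 (constants L) -> constants L := fun c => c.
  have f1 : is_form idf by [].
  exists (slice idf (y k) : R); have /(congr1 (slice idf)) := yk.
  by rewrite /emb_tens slice_map // slice_pure // rmorph1 mul1r.
pose rr : 'rV[R]_n := \row_k r k.
have rr_eq : equivariant act_rep rr.
  move=> A s; apply/rowP => k; have [y /(_ k)[y1 y2]] := H A s.
  apply: emb_tens_inj; rewrite !mxE rmorph_sum /=.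
  have <- : y k = @tens_inl _ RC A (r k).
    by apply: emb_tens_inj; rewrite -y1 emb_tens_pure rE.
  rewrite -y2; apply: eq_bigr => j _; rewrite !mxE pureM mulr1 mul1r.
  by rewrite emb_tens_pure rE.
pose u := rr *m invmx Z.
have uE A (s : diffAut iota A) :
    map_mx s (map_mx (@tens_inl _ RC A) u) = map_mx (@tens_inl _ RC A) u.
  pose il : {rmorphism R -> tensor RC A} := alg_fun (inl_hom RC A).
  rewrite /u (map_mxM il) (map_mxM s) frame_inv [map_mx s _]rr_eq.
  rewrite mulmxA -[X in X *m _]mulmxA -[X in (_ *m X) *m _]map_mxM.
  by rewrite -act_repM mulgV act_rep1 map_mx1 mulmx1.
have /choice[w wE] k : exists l, u 0 k = iota l.
  apply: (fixed_base constR simpleR matrixR) => A s.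
  by move/rowP/(_ k): (uE A s); rewrite !mxE.
exists (\row_k w k).
have -> : map_mx jL (\row_k w k) = map_mx e u.
  by apply/rowP => k; rewrite !mxE -eE -wE mxE.
rewrite -map_mxM mulmxKV //; apply/rowP => k; by rewrite !mxE rE.
Qed.

End Comodule.
End Equivariant.

(** * Differential subrings *)

Record dsub := Dsub {
  ds_ring : comPzRingType;
  ds_der : ds_ring -> ds_ring;
  ds_derD : {morph ds_der : x y / x + y};
  ds_derM : forall x y, ds_der (x * y) = ds_der x * y + x * ds_der y;
  ds_pred : {pred ds_ring};
  ds_closed : subring_closed ds_pred;
  ds_der_closed : forall x, x \in ds_pred -> ds_der x \in ds_pred;
  ds_nz : (1 : ds_ring) != 0
}.

Section SubDiffRing.
Variable X : dsub.

HB.instance Definition _ :=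
  GRing.isSubringClosed.Build (ds_ring X) (@ds_pred X) (@ds_closed X).

Record dsub_type := DsubElt {
  dsub_val :> ds_ring X;
  dsub_valP : dsub_val \in @ds_pred X
}.

HB.instance Definition _ := [isSub for dsub_val].
HB.instance Definition _ := [Choice of dsub_type by <:].
HB.instance Definition _ := GRing.SubChoice_isSubComPzRing.Build
  (ds_ring X) (@ds_pred X) dsub_type (@ds_closed X).

Fact dsub_nz : (1 : dsub_type) != 0.
Proof. by rewrite -(inj_eq val_inj) /= ds_nz. Qed.

HB.instance Definition _ :=
  GRing.PzSemiRing_isNonZero.Build dsub_type dsub_nz.

(** A [diffRingType] carries a unit structure, so inverses inside the subring are chosen
    classically, with the identity as default on non-units. *)
Definition dsub_unit : {pred dsub_type} :=
  fun x => `[< exists y : dsub_type, y * x = 1 >].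

Definition dsub_inv (x : dsub_type) : dsub_type :=
  if pselect (exists y : dsub_type, y * x = 1) is left e
  then projT1 (cid e) else x.

Fact dsub_mulVx : {in dsub_unit, left_inverse 1 dsub_inv *%R}.
Proof.
move=> x /asboolP ux; rewrite /dsub_inv; case: pselect => // e.
by case: cid.
Qed.

Fact dsub_unitPl (x y : dsub_type) : y * x = 1 -> x \in dsub_unit.
Proof. by move=> yx; apply/asboolP; exists y. Qed.

Fact dsub_inv_out : {in [predC dsub_unit], dsub_inv =1 id}.
Proof.
by move=> x /asboolP nux; rewrite /dsub_inv; case: pselect.
Qed.

HB.instance Definition _ := GRing.ComNzRing_hasMulInverse.Build dsub_type
  dsub_mulVx dsub_unitPl dsub_inv_out.

Definition dsub_der (x : dsub_type) : dsub_type :=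
  DsubElt (ds_der_closed (dsub_valP x)).

Fact dsub_derD x y : dsub_der (x + y) = dsub_der x + dsub_der y.
Proof. by apply/val_inj; rewrite /= ds_derD. Qed.

Fact dsub_derM x y : dsub_der (x * y) = dsub_der x * y + x * dsub_der y.
Proof. by apply/val_inj; rewrite /= ds_derM. Qed.

HB.instance Definition _ :=
  hasDerivation.Build dsub_type dsub_derD dsub_derM.

Definition dsub_ring : diffRingType := dsub_type.

Definition dsub_incl : {rmorphism dsub_ring -> ds_ring X} :=
  val : dsub_type -> ds_ring X.

Section Lift.
Variables (S : diffRingType) (f : {rmorphism S -> ds_ring X}).
Hypothesis fP : forall x, f x \in @ds_pred X.

Definition dsub_lift of (forall x, f (der x) = ds_der (f x)) :
    S -> dsub_ring := fun x => DsubElt (fP x).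

Hypothesis fder : forall x, f (der x) = ds_der (f x).

Fact dsub_lift_zmod : zmod_morphism (dsub_lift fder).
Proof. by move=> x y; apply/val_inj; rewrite /= rmorphB. Qed.

Fact dsub_lift_monoid : monoid_morphism (dsub_lift fder).
Proof. by split=> [|x y]; apply/val_inj; rewrite /= ?rmorph1 ?rmorphM. Qed.

Fact dsub_lift_der x : dsub_lift fder (der x) = der (dsub_lift fder x).
Proof. by apply/val_inj; rewrite /= fder. Qed.

HB.instance Definition _ := GRing.isZmodMorphism.Build S dsub_ring
  (dsub_lift fder) dsub_lift_zmod.
HB.instance Definition _ := GRing.isMonoidMorphism.Build S dsub_ring
  (dsub_lift fder) dsub_lift_monoid.
HB.instance Definition _ := isDifferential.Build S dsub_ring
  (dsub_lift fder) dsub_lift_der.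

Definition dsub_lift_dmorphism : {dmorphism S -> dsub_ring} := dsub_lift fder.

End Lift.
End SubDiffRing.

Section DifferentialComposition.
Variables (R S T : diffRingType).
Variables (g : {dmorphism S -> T}) (f : {dmorphism R -> S}).

Fact dcomp_der x : (g \o f) (der x) = der ((g \o f) x).
Proof. by rewrite /= !rmorph_der. Qed.

HB.instance Definition _ := isDifferential.Build R T (g \o f) dcomp_der.

Definition dcomp : {dmorphism R -> T} := g \o f.

End DifferentialComposition.

Section DifferentialIdentity.
Variable R : diffRingType.

HB.instance Definition _ :=
  isDifferential.Build R R (@idfun R) (fun x => erefl).

Definition did : {dmorphism R -> R} := @idfun R.

End DifferentialIdentity.

Section AlgHomBuilder.
Variables (K : fieldType) (A B : calg K) (f : A -> B).

Definition rmorph_of of zmod_morphism f & monoid_morphism f : A -> B := f.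

Hypotheses (fZ : zmod_morphism f) (fM : monoid_morphism f).

HB.instance Definition _ :=
  GRing.isZmodMorphism.Build A B (rmorph_of fZ fM) fZ.
HB.instance Definition _ :=
  GRing.isMonoidMorphism.Build A B (rmorph_of fZ fM) fM.

Definition mk_algHom (fE : forall k, f (alg_str A k) = alg_str B k) :
  algHom A B := @AlgHom K A B (rmorph_of fZ fM) fE.

End AlgHomBuilder.

(** * Linear spans and frame expansions *)

Section LinearSpan.
Variables (C O : comPzRingType) (k : {rmorphism C -> O}).

Inductive lspan (P : O -> Prop) : O -> Prop :=
| lspan0 : lspan P 0
| lspanS c y x of P y & lspan P x : lspan P (k c * y + x).

Variable P : O -> Prop.

Lemma lspan_gen y : P y -> lspan P y.
Proof.
move=> Py; rewrite -[y]addr0 -[y]mul1r -(rmorph1 k).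
by apply: lspanS => //; exact: lspan0.
Qed.

Lemma lspanD x y : lspan P x -> lspan P y -> lspan P (x + y).
Proof.
move=> sx sy; elim: sx => [|c u v Pu _ IH]; first by rewrite add0r.
by rewrite -addrA; exact: lspanS.
Qed.

Lemma lspanZ c x : lspan P x -> lspan P (k c * x).
Proof.
elim=> [|d u v Pu _ IH]; first by rewrite mulr0; exact: lspan0.
by rewrite mulrDr mulrA -rmorphM; exact: lspanS.
Qed.

Lemma lspan_sum I (r : seq I) (Q : pred I) (f : I -> O) :
  (forall i, Q i -> lspan P (f i)) -> lspan P (\sum_(i <- r | Q i) f i).
Proof. by move=> Pf; apply: big_ind => //; [exact: lspan0|exact: lspanD]. Qed.

Lemma lspanM x y : (forall u v, P u -> P v -> P (u * v)) ->
  lspan P x -> lspan P y -> lspan P (x * y).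
Proof.
move=> PM sx sy; elim: sx => [|c u v Pu _ IH].
  by rewrite mul0r; exact: lspan0.
rewrite mulrDl; apply: lspanD => //; rewrite -mulrA; apply: lspanZ.
elim: sy => [|d w z Pw _ IHz]; first by rewrite mulr0; exact: lspan0.
by rewrite mulrDr mulrCA; apply: lspanS => //; exact: PM.
Qed.

Lemma lspan_seq x : lspan P x ->
  exists2 s : seq (C * O), forall p, p \in s -> P p.2 &
    x = \sum_(p <- s) k p.1 * p.2.
Proof.
elim=> [|c y z Py _ [s sP ->]]; first by exists [::]; rewrite ?big_nil.
exists ((c, y) :: s); last by rewrite big_cons.
by move=> p; rewrite inE => /predU1P[->//|]; exact: sP.
Qed.

End LinearSpan.

Lemma lspan_sub (C O : comPzRingType) (k : {rmorphism C -> O})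
    (P Q : O -> Prop) x :
  (forall y, P y -> lspan k Q y) -> lspan k P x -> lspan k Q x.
Proof.
move=> PQ; elim=> [|c y z Py _ IH]; first exact: lspan0.
by apply: lspanD => //; apply: lspanZ; exact: PQ.
Qed.

Section MultBuilder.
Variables (G H : groupType) (f : G -> H).

Definition mult_of (_ : {morph f : x y / (x * y)%g}) : G -> H := f.
Hypothesis fM : {morph f : x y / (x * y)%g}.
HB.instance Definition _ := isMultiplicative.Build G H (mult_of fM) fM.
Definition mk_mult : {multiplicative G -> H} := mult_of fM.

End MultBuilder.

Section GroupFunctorIso.
Variables (K : fieldType) (G H : groupFunctor K) (f : gfIso G H).

Lemma gf_iso_onto A (h : H A) : exists g, f A g = h.
Proof. by have [f' _ fK] := gf_iso_bij f A; exists (f' h). Qed.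

Definition gf_inv_fun A (h : H A) : G A := projT1 (cid (gf_iso_onto h)).

Lemma gf_invK A (h : H A) : f A (gf_inv_fun h) = h.
Proof. by rewrite /gf_inv_fun; case: cid. Qed.

Lemma gf_isoK A (g : G A) : gf_inv_fun (f A g) = g.
Proof. by apply: (bij_inj (gf_iso_bij f A)); rewrite gf_invK. Qed.

Lemma gf_invM A : {morph @gf_inv_fun A : x y / (x * y)%g}.
Proof.
by move=> x y; apply: (bij_inj (gf_iso_bij f A)); rewrite gmulfM !gf_invK.
Qed.

Lemma gf_inv_nat A B (q : algHom A B) (h : H A) :
  gf_inv_fun (gf_map H q h) = gf_map G q (gf_inv_fun h).
Proof.
by apply: (bij_inj (gf_iso_bij f B)); rewrite gf_invK gf_nat gf_invK.
Qed.

End GroupFunctorIso.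

Section Expansion.
Variables (F F0 : diffFieldType) (iota0 : {dmorphism F -> F0}).
Variable (G : linAlgGroup (constants F)).
Local Notation KG := (lag_coord G).
Local Notation FK := (ext_calg iota0).
Local Notation O := (tensor FK KG).

Lemma gen_neq0 : (1 : KG) != 0.
Proof.
apply/eqP => /(congr1 (counit G)); rewrite rmorph1 rmorph0 => /eqP.
by rewrite (oner_eq0 (constants F)).
Qed.

Lemma tens_inl_inj : injective (@tens_inl _ FK KG).
Proof.
move=> x y xy; have [mu fm m1] := exists_form gen_neq0.
have /(congr1 (slice mu)) := xy.
by rewrite !slice_pure // m1 rmorph1 !mul1r.
Qed.

Lemma O_neq0 : (1 : O) != 0.
Proof.
rewrite -(rmorph1 (@tens_inl _ FK KG)) -(rmorph0 (@tens_inl _ FK KG)).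
by rewrite (inj_eq tens_inl_inj); exact: (oner_neq0 F0).
Qed.

Variable V : comodule G.
Local Notation n := (cm_dim V).
Local Notation v := (cm_v V).

(* The element t v of F0 (x) V. *)
Definition expand (t : 'rV[F0]_n) : O := \sum_j pure (t 0 j : FK) (v j 0).

Lemma expandE m (T : 'M[F0]_(m, n)) a :
  expand (row a T) =
  (map_mx (@tens_inl _ FK KG) (T : 'M[FK]_(m, n)) *m map_mx (@tens_inr _ FK KG) v) a 0.
Proof. by rewrite mul_inlrE; apply: eq_bigr => j _; rewrite mxE. Qed.

Lemma expand_inj : injective expand.
Proof.
move=> t u tu; apply/rowP => j.
by rewrite -(@slice_dual _ FK _ _ _ _ (cm_dual V) (t 0) j) -/(expand t) tu
  /expand slice_dual //; exact: cm_dual.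
Qed.

Lemma expandD : {morph expand : t u / t + u}.
Proof.
move=> t u; rewrite /expand -big_split; apply: eq_bigr => j _.
by rewrite mxE (pureDl (v j 0) (t 0 j : FK) (u 0 j)).
Qed.

Lemma expand0 : expand 0 = 0.
Proof. by rewrite /expand big1 // => j _; rewrite mxE pure0l. Qed.

Lemma expandZ (c : F0) t : expand (c *: t) = tens_inl KG (c : FK) * expand t.
Proof.
rewrite /expand mulr_sumr; apply: eq_bigr => j _.
by rewrite mxE pureM mul1r.
Qed.

Lemma expand_sum I (r : seq I) (f : I -> 'rV[F0]_n) :
  expand (\sum_(i <- r) f i) = \sum_(i <- r) expand (f i).
Proof. exact: (big_morph expand expandD expand0). Qed.

End Expansion.

Lemma comodule_cover (F F0 : diffFieldType) (iota0 : {dmorphism F -> F0})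
    (G : linAlgGroup (constants F))
    (xs : seq (tensor (ext_calg iota0) (lag_coord G))) (fs : seq (lag_coord G)) :
  exists V : comodule G, [/\ (0 < cm_dim V)%N,
    forall x, x \in xs -> exists t, x = expand iota0 (V := V) t &
    forall f, f \in fs -> exists c : 'I_(cm_dim V) -> constants F,
      f = \sum_i alg_str _ (c i) * cm_v V i 0].
Proof.
have /choice[s sE] := @tensor_seq _ (ext_calg iota0) (lag_coord G).
(* Including 1 in the list forces a positive dimension, as the factorization property requires. *)
have [V VP] := comodule_exists
  (1 :: fs ++ flatten [seq [seq p.2 | p <- s x] | x <- xs]).
exists V; split.
- case: (posnP (cm_dim V)) => // n0.
  have [c c1] := VP 1 (mem_head _ _).
  have := gen_neq0 G; rewrite c1 big1 ?eqxx // => i.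
  by have := leq_trans (ltn_ord i) (eq_leq n0).
- move=> x xxs; rewrite [x]sE.
  have : {subset s x <= s x} by [].
  elim: {1 3}(s x) => [|p q IH] sub.
    by exists 0; rewrite big_nil expand0.
  have [|t tE] := IH; first by move=> r rq; apply: sub; rewrite inE rq orbT.
  have [|c cE] := VP p.2.
    rewrite inE mem_cat; apply/orP; right; apply/orP; right.
    apply/flattenP; exists [seq p.2 | p <- s x]; first exact: map_f.
    by apply/map_f/sub; rewrite mem_head.
  exists (\row_j (iota0 (val (c j)) * p.1) + t).
  rewrite big_cons expandD tE; congr (_ + _); rewrite {1}cE /expand.
  rewrite (big_morph (pure p.1) (@pureDr _ _ _ p.1) (@pure0r _ _ _ p.1)).
  by apply: eq_bigr => j _; rewrite mxE -pure_scale.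
by move=> f ff; apply: VP; rewrite inE mem_cat ff orbT.
Qed.

(** * The patched torsor *)

Lemma map_mx_unit (S T : comUnitRingType) (q : {rmorphism S -> T}) n
  (W : 'M[S]_n) : W \in unitmx -> map_mx q W \in unitmx.
Proof. by rewrite !unitmxE det_map_mx; exact: rmorph_unit. Qed.

(** * The Galois groups of R1 and R as subgroups of G *)

Section ActionHoms.
Variables (F F1 : diffFieldType) (i1 : {dmorphism F -> F1}).
Variable E : diffEmbProblem F.
Local Notation G := (ep_G E).
Local Notation H := (ep_H E).

(** The constants map of the identity agrees with the identity up to a proof component; this
    identity on A connects the two algebra structures. *)
Definition resid (A : calg (constants F)) :
  algHom A (restrict (constants_map (did F)) A).
Proof.
refine (@AlgHom _ A (restrict (constants_map (did F)) A) idfun _) => k.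
by congr (alg_str A _); apply/val_inj.
Defined.

Section Kernel.
Variables (R1 : diffRingType) (iota1 : {dmorphism F1 -> R1}).
Variable R1_gal : gfIso (base_change (constants_map i1) (ep_N E)) (diffGal iota1).
Local Notation h := (constants_map i1).

Definition ker_pt A (g : G (restrict h A)) (gk : ep_pi E _ g = 1%g) :
  base_change h (ep_N E) A := @KernelPt _ _ _ (ep_pi E) (restrict h A) g (introT eqP gk).

Definition ker_act A (s : diffGal iota1 A) : base_change h G A :=
  ker_val (gf_inv_fun R1_gal s).

Fact ker_actM A : {morph @ker_act A : x y / (x * y)%g}.
Proof. by move=> x y; rewrite /ker_act gf_invM. Qed.

Definition ker_gfhom : gfHom (diffGal iota1) (base_change h G).
Proof.
refine (@GFHom _ (diffGal iota1) (base_change h G) (fun A => mk_mult (@ker_actM A)) _).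
by move=> A B f g; rewrite /= /mult_of /ker_act gf_inv_nat.
Defined.

Lemma ker_actP A (s : diffGal iota1 A) : ep_pi E _ (ker_act s : G _) = 1%g.
Proof. exact/eqP/(ker_valP (gf_inv_fun R1_gal s)). Qed.

Lemma ker_act_gal A (g : G (restrict h A)) (gk : ep_pi E _ g = 1%g) :
  ker_act (R1_gal A (ker_pt gk)) = g.
Proof. by rewrite /ker_act gf_isoK. Qed.

End Kernel.

Section SectionAction.
Variable sec : gfHom H G.
Local Notation h := (constants_map (did F)).
Local Notation iota := (ep_iota E).

Definition sec_act A (s : diffGal iota A) : base_change h G A :=
  gf_map G (resid A) (sec A (gf_inv_fun (ep_gal E) s)).

Fact sec_actM A : {morph @sec_act A : x y / (x * y)%g}.
Proof. by move=> x y; rewrite /sec_act gf_invM !gmulfM. Qed.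

Fact sec_act_nat A B (f : algHom A B) (s : diffGal iota A) :
  sec_act (gf_map (diffGal iota) f s) = gf_map G (restrict_hom h f) (sec_act s).
Proof.
rewrite /sec_act gf_inv_nat gf_nat -!gf_map_comp.
by congr (gf_map G _ _); exact: algHomP.
Qed.

Definition sec_gfhom : gfHom (diffGal iota) (base_change h G).
Proof.
refine (@GFHom _ (diffGal iota) (base_change h G) (fun A => mk_mult (@sec_actM A)) _).
exact: sec_act_nat.
Defined.

End SectionAction.
End ActionHoms.

Section Patching.
Variables (F F1 F2 F0 : diffFieldType).
Variables (i1 : {dmorphism F -> F1}) (i2 : {dmorphism F -> F2}).
Variables (j1 : {dmorphism F1 -> F0}) (j2 : {dmorphism F2 -> F0}).
Hypothesis diamond : diffDiamond i1 i2 j1 j2.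
Hypothesis factorization : factorization_property j1 j2.
Variable E : diffEmbProblem F.
Variable sec : gfHom (ep_H E) (ep_G E).
Hypothesis secK : forall A h, ep_pi E A (sec A h) = h.
Variable e : {dmorphism ep_R E -> F1}.
Hypothesis e_inj : injective e.
Hypothesis eE : forall x, e (ep_iota E x) = i1 x.
Variables (R1 : diffRingType) (iota1 : {dmorphism F1 -> R1}).
Hypothesis R1_PV : is_PV iota1.
Variable R1_gal : gfIso (base_change (constants_map i1) (ep_N E)) (diffGal iota1).
Variable e1 : {dmorphism R1 -> F0}.
Hypothesis e1_inj : injective e1.
Hypothesis e1E : forall x, e1 (iota1 x) = j1 x.

Local Notation K := (constants F).
Local Notation G := (ep_G E).
Local Notation H := (ep_H E).
Local Notation R := (ep_R E).
Local Notation iota := (ep_iota E).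
Local Notation KG := (lag_coord G).

Definition iota0 : {dmorphism F -> F0} := dcomp j1 i1.
Definition e0 : {dmorphism R -> F0} := dcomp j1 e.
Local Notation FK := (ext_calg iota0).
Local Notation O := (tensor FK KG).

Fact e0E x : e0 (iota x) = iota0 x.
Proof. by rewrite /= eE. Qed.

Fact e0_inj : injective e0.
Proof. by move=> x y /= /fmorph_inj /e_inj. Qed.

Fact iota0_id x : iota0 (did F x) = iota0 x. Proof. by []. Qed.
Fact j1_i1 x : j1 (i1 x) = iota0 x. Proof. by []. Qed.
Fact j2_i2 x : j2 (i2 x) = iota0 x.
Proof. by have [_ c _] := diamond; rewrite -c. Qed.

Local Notation phiN := (ker_gfhom R1_gal).
Local Notation phiH := (sec_gfhom sec).

Definition equivN : O -> Prop := equivar e1E j1_i1 phiN.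
Definition equivH : O -> Prop := equivar e0E iota0_id phiH.

Definition inF0 : {rmorphism F0 -> O} := alg_fun (inl_hom FK KG).
Definition inF2 : {rmorphism F2 -> O} := inF0 \o j2.

(* The patched torsor: Ind_N^G(R1) and F2 (x) Ind_H^G(R), glued inside the
   trivial torsor F0[G]. *)
Definition solP (x : O) : Prop := equivN x /\ lspan inF2 equivH x.

Let PV := ep_PV E.
Let matR : exists n (Z : 'M[R]_n), PV_matrix iota Z. Proof. by case: PV. Qed.
Let simR : diff_simple R. Proof. by case: PV. Qed.
Let conR : forall x : R, der x = 0 -> exists c : constants F, iota (const_val c) = x.
Proof. by case: PV. Qed.
Let matR1 : exists n (Z : 'M[R1]_n), PV_matrix iota1 Z. Proof. by case: R1_PV. Qed.
Let simR1 : diff_simple R1. Proof. by case: R1_PV. Qed.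
Let conR1 : forall x : R1, der x = 0 -> exists c : constants F1, iota1 (const_val c) = x.
Proof. by case: R1_PV. Qed.

Lemma solP1 : solP 1.
Proof. by split; [exact: equivar1|apply: lspan_gen; exact: equivar1]. Qed.

Lemma solPD x y : solP x -> solP y -> solP (x + y).
Proof.
by move=> [x1 x2] [y1 y2]; split; [exact: equivarD|exact: lspanD].
Qed.

Lemma solPM x y : solP x -> solP y -> solP (x * y).
Proof.
move=> [x1 x2] [y1 y2]; split; first exact: equivarM.
by apply: lspanM => // u v; exact: equivarM.
Qed.

Lemma inF0_der c : tens_der (inF0 c) = inF0 (der c).
Proof. exact: tens_der_pure. Qed.

Lemma solP_der x : solP x -> solP (tens_der x).
Proof.
move=> [x1 x2]; split; first exact: equivar_der.
elim: x2 => [|c y z Ey _ IH]; first by rewrite tens_der0; exact: lspan0.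
rewrite tens_derD tens_derM inF0_der -rmorph_der -addrA.
by apply: lspanS => //; apply: lspanS => //; exact: equivar_der.
Qed.

Lemma solP_base c : solP (inF0 (iota0 c)).
Proof.
split; first exact: (equivar_base e1E j1_i1 phiN (i1 c)).
by apply: lspan_gen; exact: (equivar_base e0E iota0_id phiH c).
Qed.

Lemma solPN x : solP x -> solP (- x).
Proof.
move=> Sx; rewrite -mulN1r -(rmorph1 inF0) -(rmorph1 iota0) -!rmorphN.
by apply: solPM => //; exact: solP_base.
Qed.

(** * Frames and the descent of coefficients to F *)

Section Frames.
Variable V : comodule G.
Local Notation n := (cm_dim V).
Local Notation v := (cm_v V).
Local Notation rho := (cm_rho V).

Definition is_frame (Y : 'M[F0]_n) : Prop :=
  exists (A1 : 'M[F1]_n) (A2 : 'M[F2]_n) (Z1 : 'M[R1]_n) (Z : 'M[R]_n),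
  [/\ A1 \in unitmx, A2 \in unitmx, Z1 \in unitmx & Z \in unitmx] /\
  [/\ equivariant (act_rep phiN V) Z1, equivariant (act_rep phiH V) Z,
      Y = map_mx j1 A1 *m map_mx e1 Z1 & Y = map_mx j2 A2 *m map_mx e0 Z].

Lemma exists_frame : (0 < n)%N -> exists Y, is_frame Y.
Proof.
move=> n0.
have [Z1 Z1u Z1eq] := frame_exists e1 phiN conR1 simR1 matR1 V.
have [Z Zu Zeq] := frame_exists e0 phiH conR simR matR V.
pose B := map_mx e0 Z *m invmx (map_mx e1 Z1).
have Bu : B \in unitmx.
  by rewrite unitmx_mul unitmx_inv !map_mx_unit.
have [A1 [A2 [A1u A2u BE]]] := factorization n0 Bu.
exists (map_mx j1 A1 *m map_mx e1 Z1), A1, A2, Z1, Z; split=> //; split=> //.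
have A2u' : map_mx j2 A2 \in unitmx by rewrite map_unitmx.
have Z1u' : map_mx e1 Z1 \in unitmx by exact: map_mx_unit.
by rewrite -(mulKVmx A2u' (map_mx j1 A1)) -BE /B -!mulmxA mulVmx // mulmx1.
Qed.

Variable Y : 'M[F0]_n.
Hypothesis frameY : is_frame Y.

Lemma frame_unit : Y \in unitmx.
Proof.
have [A1 [A2 [Z1 [Z [[A1u A2u Z1u Zu] [_ _ -> _]]]]]] := frameY.
by rewrite unitmx_mul !map_mx_unit.
Qed.

Local Notation ilm := (map_mx inF0).
Local Notation irm := (map_mx (@tens_inr _ FK KG)).

(** The factorization over F1 shows N-equivariance, since F1 is fixed by the automorphisms of R1/F1;
    the one over F2 exhibits the entry as an F2-combination of H-equivariant functions. *)
Lemma frame_solP p (w : 'M[KG]_(n, p)) a b :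
    (forall A (x y : G A), map_mx (pt (x * y)%g) w =
      map_mx (pt x) rho *m map_mx (pt y) w) ->
  solP ((ilm Y *m irm w) a b).
Proof.
move=> wM.
have [A1 [A2 [Z1 [Z [[A1u A2u Z1u Zu] [Z1eq Zeq YE1 YE2]]]]]] := frameY.
split.
  rewrite YE1 map_mxM -mulmxA mxE.
  apply: (big_ind equivN) => [||k _]; [exact: equivar0|by move=> ? ?; exact: equivarD|].
  apply: equivarM; last exact: (equivar_frame e1E j1_i1 Z1eq _ _ wM).
  by rewrite !mxE; exact: equivar_base.
rewrite YE2 map_mxM -mulmxA mxE; apply: lspan_sum => k _.
rewrite !mxE -[inF0 (j2 _)]/(inF2 _); apply: lspanZ; apply: lspan_gen.
have := equivar_frame e0E iota0_id Zeq k b wM.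
by rewrite mxE.
Qed.

Lemma frame_inv_solP a b : solP ((irm (rho_inv V) *m ilm (invmx Y)) a b).
Proof.
have [A1 [A2 [Z1 [Z [[A1u A2u Z1u Zu] [Z1eq Zeq YE1 YE2]]]]]] := frameY.
have invE (L : diffFieldType) (j : {dmorphism L -> F0}) (B : 'M[L]_n)
    (S : diffRingType) (q : {dmorphism S -> F0}) (W : 'M[S]_n) :
    B \in unitmx -> W \in unitmx -> Y = map_mx j B *m map_mx q W ->
    invmx Y = map_mx q (invmx W) *m map_mx j (invmx B).
  move=> Bu Wu YE; have Yu := frame_unit.
  rewrite -[RHS](mulmxK Yu) YE -!mulmxA (mulmxA _ (map_mx j B)) -map_mxM.
  by rewrite mulVmx // map_mx1 mul1mx mulmxA -map_mxM mulVmx // map_mx1 mul1mx.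
split.
  rewrite (invE _ _ _ _ _ _ A1u Z1u YE1) map_mxM mulmxA mxE.
  apply: (big_ind equivN) => [||k _]; [exact: equivar0|by move=> ? ?; exact: equivarD|].
  apply: equivarM; first exact: (equivar_frame_inv e1E j1_i1 Z1u Z1eq).
  by rewrite !mxE; exact: equivar_base.
rewrite (invE _ _ _ _ _ _ A2u Zu YE2) map_mxM mulmxA mxE; apply: lspan_sum => k _.
rewrite mulrC !mxE -[inF0 (j2 _)]/(inF2 _); apply: lspanZ; apply: lspan_gen.
have := equivar_frame_inv e0E iota0_id Zu Zeq a k.
by rewrite mxE.
Qed.

(** Differentiation preserves equivariance and treats [v] as constant, so each row of the derivative
    of W is the coordinate row of an equivariant element, to which [equivar_coef] applies. *)
Lemma equivar_frame_der (L : diffFieldType) (i : {dmorphism F -> L})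
    (S : diffRingType) (io : {dmorphism L -> S}) (j : {dmorphism L -> F0})
    (q : {dmorphism S -> F0}) (qE : forall x, q (io x) = j x)
    (ji : forall x, j (i x) = iota0 x)
    (phi : gfHom (diffGal io) (base_change (constants_map i) G)) (W : 'M[S]_n) :
    injective q ->
    (forall x : S, der x = 0 -> exists c : constants L, io (const_val c) = x) ->
    diff_simple S -> (exists m (Z : 'M[S]_m), PV_matrix io Z) ->
    W \in unitmx -> equivariant (act_rep phi V) W ->
  exists c : 'M[L]_n, map_mx der (map_mx q W) = map_mx j c *m map_mx q W.
Proof.
move=> q_inj conS simS matS Wu Weq.
have dq a : exists u : 'rV[L]_n,
    row a (map_mx der (map_mx q W)) = map_mx j u *m map_mx q W.
  apply: (equivar_coef (eE := qE) (jLi := ji) q_inj conS simS matS Wu Weq).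
  have := equivar_der (equivar_frame qE ji Weq a 0 (cm_vM V)).
  rewrite mul_inlrE (big_morph _ (@tens_derD _ _ _ _) (@tens_der0 _ _ _ _)).
  congr (equivar _ _ _ _); apply: eq_bigr => k _.
  by rewrite tens_der_pure !mxE.
have /choice[c cE] := dq; exists (\matrix_a c a).
by apply/row_matrixP => a; rewrite row_mul -[in RHS]map_row rowK -cE.
Qed.

Lemma der_mulmx (S : diffRingType) m p q (A : 'M[S]_(m, p)) (B : 'M[S]_(p, q)) :
  map_mx der (A *m B) = map_mx der A *m B + A *m map_mx der B.
Proof.
apply/matrixP => a b; rewrite !mxE.
rewrite (big_morph (@der S) (@derD S) (@der0 S)) -big_split.
by apply: eq_bigr => k _; rewrite derM !mxE.
Qed.

(** The logarithmic derivative of Y is a gauge transform by A1 of that of Z1, so its entries lie in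
    F1, and a gauge transform by A2 of that of Z, so they lie in F2; the diamond puts them in F. *)
Lemma frame_der : exists a : 'M[F]_n, map_mx der Y = map_mx iota0 a *m Y.
Proof.
have [A1 [A2 [Z1 [Z [[A1u A2u Z1u Zu] [Z1eq Zeq YE1 YE2]]]]]] := frameY.
have [c1 c1E] := equivar_frame_der e1E j1_i1 e1_inj conR1 simR1 matR1 Z1u Z1eq.
have [c2 c2E] := equivar_frame_der e0E iota0_id e0_inj conR simR matR Zu Zeq.
have dY (L : diffFieldType) (j : {dmorphism L -> F0}) (B c : 'M[L]_n) W :
    B \in unitmx -> Y = map_mx j B *m W ->
    map_mx der W = map_mx j c *m W ->
    map_mx der Y = map_mx j ((map_mx der B + B *m c) *m invmx B) *m Y.
  move=> Bu YE dW; rewrite {1}YE der_mulmx dW mulmxA.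
  have -> : map_mx der (map_mx j B) = map_mx j (map_mx der B).
    by apply/matrixP => a b; rewrite !mxE rmorph_der.
  rewrite -map_mxM -mulmxDl -map_mxD [in RHS]YE [in RHS]map_mxM -[in RHS]mulmxA.
  rewrite [X in _ = _ *m X]mulmxA -map_mxM mulVmx // map_mx1 mul1mx.
  by [].
have c2E' : map_mx der (map_mx e0 Z) = map_mx j2 (map_mx i2 c2) *m map_mx e0 Z.
  rewrite c2E; congr (_ *m _); apply/matrixP => a b; rewrite !mxE.
  exact/esym/j2_i2.
have d1 := dY _ _ _ _ _ A1u YE1 c1E; have d2 := dY _ _ _ _ _ A2u YE2 c2E'.
set B1 := _ *m invmx A1 in d1; set B2 := _ *m invmx A2 in d2.
have B12 : map_mx j1 B1 = map_mx j2 B2.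
  have := d2; rewrite d1 => /(congr1 (mulmx^~ (invmx Y))).
  by rewrite !mulmxK // frame_unit.
have [_ _ meet] := diamond.
have /choice[b bP] (a : 'I_n * 'I_n) : exists x, i1 x = B1 a.1 a.2.
  have [|x [xE _]] := meet (B1 a.1 a.2) (B2 a.1 a.2); last by exists x.
  by move/matrixP/(_ a.1 a.2): B12; rewrite !mxE.
exists (\matrix_(a, c) b (a, c)); rewrite d1; congr (_ *m _).
apply/matrixP => a c.
rewrite [LHS]mxE -[B1 a c]/(B1 (a, c).1 (a, c).2) -bP [RHS]mxE.
by rewrite [fun_of_matrix _ _ _]mxE.
Qed.

(** N-equivariance puts the entries of t Y^-1 in F1. The list presents the same element through
    H-equivariant elements of F0 (x) V, each with coefficients in F against Z, so these entries lie
    in F2 as well. *)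
Lemma frame_coef (t : 'rV[F0]_n) (s : seq (F2 * O)) :
    equivN (expand iota0 t) ->
    (forall p, p \in s -> equivH p.2 /\ exists t, p.2 = expand iota0 (V := V) t) ->
    expand iota0 t = \sum_(p <- s) inF2 p.1 * p.2 ->
  exists u : 'rV[F]_n, t = map_mx iota0 u *m Y.
Proof.
move=> tN sP tE.
have [A1 [A2 [Z1 [Z [[A1u A2u Z1u Zu] [Z1eq Zeq YE1 YE2]]]]]] := frameY.
have [t1 t1E] := equivar_coef e1_inj conR1 simR1 matR1 Z1u Z1eq tN.
have [t2 t2E] : exists t2 : 'rV[F2]_n, t = map_mx j2 t2 *m map_mx e0 Z.
  suff [t2 t2E] : exists t2 : 'rV[F2]_n,
      \sum_(p <- s) inF2 p.1 * p.2 = expand iota0 (map_mx j2 t2 *m map_mx e0 Z).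
    by exists t2; apply: (expand_inj (iota0 := iota0) (V := V)); rewrite tE.
  elim: s sP {tE} => [|p s IH] sP.
    by exists 0; rewrite big_nil map_mx0 mul0mx expand0.
  have [|t2 t2E] := IH; first by move=> q qs; apply: sP; rewrite inE qs orbT.
  have [pH [tp tpE]] := sP p (mem_head _ _).
  rewrite tpE in pH.
  have [u uE] := equivar_coef e0_inj conR simR matR Zu Zeq pH.
  exists (p.1 *: map_mx i2 u + t2); rewrite big_cons t2E tpE uE.
  have -> : map_mx j2 (p.1 *: map_mx i2 u + t2) =
      j2 p.1 *: map_mx iota0 u + map_mx j2 t2.
    apply/rowP => k; rewrite !mxE rmorphD rmorphM; congr (_ * _ + _).
    exact: j2_i2.
  by rewrite mulmxDl expandD -scalemxAl expandZ.
have Yu := frame_unit.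
have e12 : map_mx j1 (t1 *m invmx A1) = map_mx j2 (t2 *m invmx A2).
  have q1 : t = map_mx j1 (t1 *m invmx A1) *m Y.
    by rewrite YE1 map_mxM -mulmxA (mulmxA (map_mx j1 (invmx A1))) -map_mxM mulVmx //
      map_mx1 mul1mx.
  have q2 : t = map_mx j2 (t2 *m invmx A2) *m Y.
    by rewrite YE2 map_mxM -mulmxA (mulmxA (map_mx j2 (invmx A2))) -map_mxM mulVmx //
      map_mx1 mul1mx.
  by have := q2; rewrite {1}q1 => /(congr1 (mulmx^~ (invmx Y))); rewrite !mulmxK.
have [_ _ meet] := diamond.
have /choice[b bP] k : exists x, i1 x = (t1 *m invmx A1) 0 k.
  have [|x [xE _]] := meet ((t1 *m invmx A1) 0 k) ((t2 *m invmx A2) 0 k).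
    by move/rowP/(_ k): e12; rewrite mxE => ->; rewrite mxE.
  by exists x.
exists (\row_k b k).
have -> : map_mx iota0 (\row_k b k) = map_mx j1 (t1 *m invmx A1).
  by apply/rowP => k; rewrite [RHS]mxE -bP !mxE.
by rewrite YE1 map_mxM -mulmxA (mulmxA (map_mx j1 (invmx A1))) -map_mxM mulVmx //
  map_mx1 mul1mx.
Qed.

End Frames.

Lemma sol_frame (xs : seq O) (fs : seq KG) : (forall x, x \in xs -> solP x) ->
  exists (V : comodule G) Y, [/\ is_frame Y,
    forall x, x \in xs -> exists u : 'rV[F]_(cm_dim V),
      x = expand iota0 (map_mx iota0 u *m Y)
    & forall f, f \in fs -> exists c : 'I_(cm_dim V) -> K,
      f = \sum_i alg_str _ (c i) * cm_v V i 0].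
Proof.
move=> Sxs.
have /choice[s sP] x : exists s : seq (F2 * O), solP x ->
    (forall p, p \in s -> equivH p.2) /\ x = \sum_(p <- s) inF2 p.1 * p.2.
  have [[_ /lspan_seq[s sP sE]]|nS] := pselect (solP x); first by exists s.
  by exists [::].
(* The H-equivariant summands have to be expanded in the same comodule as the elements of S, since
   [frame_coef] treats them one by one. *)
have [V [V0 cov fsP]] := comodule_cover
  (xs ++ flatten [seq [seq p.2 | p <- s x] | x <- xs]) fs.
have [Y frY] := exists_frame V0.
exists V, Y; split=> // x xxs.
have [t tE] : exists t, x = expand iota0 (V := V) t.
  by apply: cov; rewrite mem_cat xxs.
have [sH sE] := sP _ (Sxs _ xxs).
have [|||u uE] := @frame_coef V Y frY t (s x).
- by rewrite -tE; case: (Sxs _ xxs).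
- move=> p ps; split; first exact: sH.
  apply: cov; rewrite mem_cat; apply/orP; right; apply/flattenP.
  by exists [seq p.2 | p <- s x]; exact: map_f.
- by rewrite -tE.
by exists u; rewrite tE uE.
Qed.

(* S is an F-form of F0[G]: F-subspaces of S meet as soon as their F0-spans do. *)
Lemma span_meet (P Q : O -> Prop) z :
    (forall x, P x -> solP x) -> (forall x, Q x -> solP x) ->
    P 0 -> Q 0 ->
    (forall c x y, P x -> P y -> P (inF0 (iota0 c) * x + y)) ->
    (forall c x y, Q x -> Q y -> Q (inF0 (iota0 c) * x + y)) ->
    lspan inF0 P z -> lspan inF0 Q z -> z != 0 ->
  exists w, [/\ P w, Q w & w != 0].
Proof.
move=> PS QS P0 Q0 PD QD /lspan_seq[s sP sE] /lspan_seq[r rQ rE] z0.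
have [|V [Y [frY cov _]]] :=
    @sol_frame ([seq p.2 | p <- s] ++ [seq p.2 | p <- r]) [::].
  move=> x; rewrite mem_cat => /orP[/mapP[p /sP Pp ->]|/mapP[p /rQ Qp ->]].
    exact: PS.
  exact: QS.
have mat_of (T : O -> Prop) (l : seq (F0 * O)) :
    (forall p, p \in l -> T p.2 /\ exists u : 'rV[F]_(cm_dim V),
       p.2 = expand iota0 (map_mx iota0 u *m Y)) ->
  exists (M : 'M[F]_(size l, cm_dim V)) (c : 'rV[F0]_(size l)),
    (forall i, T (expand iota0 (map_mx iota0 (row i M) *m Y))) /\
    \sum_(p <- l) inF0 p.1 * p.2 =
      expand iota0 (c *m map_mx iota0 M *m Y).
  move=> lP; pose d := (0 : F0, 0 : O).
  have lP' (i : 'I_(size l)) : exists u : 'rV[F]_(cm_dim V),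
      (nth d l i).2 = expand iota0 (map_mx iota0 u *m Y).
    by have [] := lP _ (mem_nth d (ltn_ord i)).
  pose M : 'M_(size l, _) := \matrix_i projT1 (cid (lP' i)).
  have ME (i : 'I_(size l)) : (nth d l i).2 = expand iota0 (map_mx iota0 (row i M) *m Y).
    by rewrite rowK; case: cid.
  exists M, (\row_i (nth d l i).1); split.
    by move=> i; rewrite -ME; case: (lP _ (mem_nth d (ltn_ord i))).
  rewrite (big_nth d) big_mkord -mulmxA mulmx_sum_row expand_sum.
  by apply: eq_bigr => i _; rewrite expandZ mxE row_mul -map_row ME.
have [|M [c [MP cE]]] := mat_of P s.
- move=> p ps; split; first exact: sP.
  by apply: cov; rewrite mem_cat map_f.
have [|M' [c' [MQ cE']]] := mat_of Q r.
- move=> p pr; split; first exact: rQ.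
  by apply: cov; rewrite mem_cat; apply/orP; right; exact: map_f.
have Yu := frame_unit frY.
have cc : c *m map_mx iota0 M = c' *m map_mx iota0 M'.
  have : expand iota0 (c *m map_mx iota0 M *m Y) =
      expand iota0 (c' *m map_mx iota0 M' *m Y) by rewrite -cE -cE' -sE.
  by move/expand_inj/(congr1 (mulmx^~ (invmx Y))); rewrite !mulmxK.
(* Intersection of row spaces commutes with the field extension F0/F, so a common nonzero vector
   over F0 forces one over F. *)
have nz : (M :&: M')%MS != 0.
  rewrite -(map_mx_eq0 iota0) (eqmx_eq0 (map_capmx _ _ _)); apply/rowV0Pn.
  exists (c *m map_mx iota0 M).
    by rewrite sub_capmx submxMl cc submxMl.
  by apply: contra_neq z0 => c0; rewrite sE cE c0 mul0mx expand0.
have [u uM u0] := rowV0Pn nz.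
have in_of (T : O -> Prop) m (N : 'M[F]_(m, cm_dim V)) :
    T 0 -> (forall c x y, T x -> T y -> T (inF0 (iota0 c) * x + y)) ->
    (forall i, T (expand iota0 (map_mx iota0 (row i N) *m Y))) ->
    (u <= N)%MS -> T (expand iota0 (map_mx iota0 u *m Y)).
  move=> T0 TD TN /submxP[b ->]; rewrite [b *m N]mulmx_sum_row.
  apply: (big_rec (fun w => T (expand iota0 (map_mx iota0 w *m Y)))) =>
      [|i x _ Tx]; first by rewrite map_mx0 mul0mx expand0.
  rewrite map_mxD mulmxDl expandD map_mxZ -scalemxAl expandZ.
  exact: TD.
exists (expand iota0 (map_mx iota0 u *m Y)); split.
- by apply: (in_of P _ M) => //; apply: submx_trans uM (capmxSl _ _).
- by apply: (in_of Q _ M') => //; apply: submx_trans uM (capmxSr _ _).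
apply: contra_neq u0 => u0.
have uY : map_mx iota0 u *m Y = 0.
  by apply: (expand_inj (iota0 := iota0) (V := V)); rewrite u0 expand0.
by apply: (map_mx_inj (f := iota0)); rewrite map_mx0 -[LHS](mulmxK Yu) uY mul0mx.
Qed.

(** [span_meet], applied to [P] and the line F x, yields a nonzero F-multiple of [x] in [P]. *)
Lemma span_sol (P : O -> Prop) x :
    (forall x, P x -> solP x) -> P 0 ->
    (forall c x y, P x -> P y -> P (inF0 (iota0 c) * x + y)) ->
    solP x -> lspan inF0 P x -> P x.
Proof.
move=> PS P0 PD Sx Px; have [->//|x0] := eqVneq x 0.
pose Q y := exists c, y = inF0 (iota0 c) * x.
have [||||||||w [Pw [c wE] w0]] := @span_meet P Q x _ _ _ _ _ _ _ _ x0 => //.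
- by move=> _ [c ->]; apply: solPM => //; exact: solP_base.
- by exists 0; rewrite !rmorph0 mul0r.
- move=> c _ _ [a ->] [b ->]; exists (c * a + b).
  by rewrite !rmorphD !rmorphM mulrDl mulrA.
- by apply: lspan_gen; exists 1; rewrite !rmorph1 mul1r.
have c0 : c != 0 by apply: contra_neq w0 => c0; rewrite wE c0 !rmorph0 mul0r.
have := PD c^-1 w 0 Pw P0; rewrite addr0 wE mulrA -!rmorphM mulVf //.
by rewrite !rmorph1 mul1r.
Qed.

(** Since Y is invertible, every row over F0 is an F0-combination of the rows of Y, whose expansions
    Y v lie in S. *)
Lemma span_all (x : O) : lspan inF0 solP x.
Proof.
have [V [V0 cov _]] := comodule_cover [:: x] [::].
have [t ->] := cov x (mem_head _ _).
have [Y frY] := exists_frame V0.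
have Yu := frame_unit frY.
rewrite -(mulmxKV Yu t) mulmx_sum_row expand_sum; apply: lspan_sum => k _.
rewrite expandZ; apply: lspanZ; apply: lspan_gen; rewrite expandE.
exact: (frame_solP frY _ _ (cm_vM V)).
Qed.

(** * The embedding of R in the patched torsor *)

Local Notation gu := (gen_pt G).

Definition gen_aut : diffAut iota KG := ep_gal E KG (ep_pi E KG gu).

(* r |-> (g |-> pi(g) r), the embedding of R in the patched torsor. *)
Definition embO : {rmorphism R -> O} :=
  (emb_tens e0E (A := KG) \o gen_aut) \o alg_fun (inl_hom (ext_calg iota) KG).

Lemma embOE r : embO r = emb_tens e0E (gen_aut (@pure _ (ext_calg iota) KG r 1)).
Proof. by []. Qed.

Lemma gal_gen (A : calg K) (g : G A) (r : R) :
  tens_map (algHom_id (ext_calg iota)) (pt g) (gen_aut (@pure _ (ext_calg iota) KG r 1)) =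
  (ep_gal E A (ep_pi E A g) : diffAut iota A) (@pure _ (ext_calg iota) A r 1).
Proof.
have -> : ep_gal E A (ep_pi E A g) = diffAut_map (pt g) gen_aut :> diffAut iota A.
  rewrite -{1}(map_gen g) gf_nat; exact: (gf_nat (ep_gal E) (pt g)).
by rewrite /= diffAut_ext_pure pure11 mulr1.
Qed.

Definition unresid (A : calg K) :
  algHom (restrict (constants_map (did F)) A) A.
Proof.
refine (@AlgHom _ (restrict (constants_map (did F)) A) A idfun _) => k.
by congr (alg_str A _); apply/val_inj.
Defined.

(** As [sec] is a section of pi, pi(sec(h) g) = h pi(g): translating by sec(h) amounts to letting h
    act on the values. *)
Lemma embO_equivH r : equivH (embO r).
Proof.
move=> A g s.
pose back := unresid A.
pose gb := gf_map G back g.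
have evE (g' : G (restrict (constants_map (did F)) A)) :
    ev iota0_id g' (embO r) = emb_tens e0E
      ((ep_gal E A (ep_pi E A (gf_map G back g')) : diffAut iota A)
        (@pure _ (ext_calg iota) A r 1)).
  rewrite -gal_gen embOE; move: (gen_aut _); apply: tensor_eq => [u w|u w|q a].
  - by rewrite !rmorphD.
  - by rewrite !rmorphD.
  by rewrite tens_map_pure !emb_tens_pure ev_pure pt_mapE.
exists ((ep_gal E A (ep_pi E A gb) : diffAut iota A) (@pure _ (ext_calg iota) A r 1)).
split; first exact: evE.
rewrite evE; congr (emb_tens e0E _).
have -> : ep_gal E A (ep_pi E A (gf_map G back (act_pt phiH s * g)%g)) =
    (s * ep_gal E A (ep_pi E A gb))%g :> diffAut iota A; last by [].
have -> : gf_map G back (act_pt phiH s * g)%g =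
    (sec A (gf_inv_fun (ep_gal E) (s : diffGal iota A)) * gb)%g.
  rewrite gmulfM; congr (_ * _)%g; rewrite -[LHS]gf_map_comp.
  rewrite -[RHS]gf_map_id; congr (gf_map G _ _); exact: algHomP.
rewrite gmulfM secK.
have := @gmulfM _ _ (ep_gal E A) (gf_inv_fun (ep_gal E) (s : diffGal iota A)) (ep_pi E A gb).
by rewrite gf_invK.
Qed.

Definition base_tens (A : calg (constants F1)) :
    tensor (ext_calg iota) (restrict (constants_map i1) A) ->
    tensor (ext_calg iota1) A :=
  @tens_lift _ (ext_calg iota) (restrict (constants_map i1) A) _
    (fun (q : R) a => @pure _ (ext_calg iota1) A (iota1 (e q)) a).

Fact base_tens_balanced (A : calg (constants F1)) :
  @balanced _ (ext_calg iota) (restrict (constants_map i1) A) _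
    (fun (q : R) a => @pure _ (ext_calg iota1) A (iota1 (e q)) a).
Proof.
split=> [a u w|q a b|k q a]; first by rewrite !rmorphD; exact: pureDl.
  exact: pureDr.
rewrite !rmorphM /= eE.
exact: (@pure_scale _ (ext_calg iota1) A (constants_map i1 k) (iota1 (e q)) a).
Qed.

Lemma base_tens_pure (A : calg (constants F1)) (q : R) a :
  base_tens (@pure _ (ext_calg iota) (restrict (constants_map i1) A) q a) =
  @pure _ (ext_calg iota1) A (iota1 (e q)) a.
Proof. exact: (tens_lift_pure (base_tens_balanced A)). Qed.

Lemma base_tensD (A : calg (constants F1)) : {morph @base_tens A : u v / u + v}.
Proof. exact: (tens_liftD (base_tens_balanced A)). Qed.

(** Translation by N does not change pi(g), and the values come from F1 through [base_tens], so the
    automorphisms of R1/F1 fix them. *)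
Lemma embO_equivN r : equivN (embO r).
Proof.
move=> A g s.
have evE (g' : G (restrict (constants_map i1) A)) :
    ev j1_i1 g' (embO r) = emb_tens e1E (base_tens
      ((ep_gal E _ (ep_pi E _ g') : diffAut iota (restrict (constants_map i1) A))
        (@pure _ (ext_calg iota) _ r 1))).
  rewrite -gal_gen embOE; move: (gen_aut _); apply: tensor_eq => [u w|u w|q a].
  - by rewrite !rmorphD.
  - by rewrite rmorphD base_tensD rmorphD.
  by rewrite tens_map_pure base_tens_pure !emb_tens_pure ev_pure e1E.
exists (base_tens ((ep_gal E _ (ep_pi E _ g) : diffAut iota (restrict (constants_map i1) A))
  (@pure _ (ext_calg iota) _ r 1))); split; first exact: evE.
have piN : ep_pi E _ (act_pt phiN s) = 1%g by exact: (ker_actP R1_gal s).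
have fixed w : s (base_tens w) = base_tens (A := A) w.
  move: w; apply: tensor_eq => [u w|u w|q a].
  - by rewrite base_tensD rmorphD.
  - by rewrite base_tensD.
  rewrite base_tens_pure [in LHS]pure_split rmorphM [X in X * _]diffAut_base.
  by rewrite [X in _ * X]diffAut_scal -pure_split.
by rewrite evE gmulfM piN mul1g fixed.
Qed.

Lemma embO_sol r : solP (embO r).
Proof. by split; [exact: embO_equivN|apply: lspan_gen; exact: embO_equivH]. Qed.

Lemma embO_der r : embO (der r) = tens_der (embO r).
Proof. by rewrite !embOE -emb_tens_der -aut_der tens_der_pure. Qed.

Lemma embO_base c : embO (iota c) = inF0 (iota0 c).
Proof. by rewrite embOE diffAut_base emb_tens_pure e0E. Qed.

Lemma embO_inj : injective embO.
Proof.
pose I r := embO r = 0.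
have [I0|I1] : (forall r, I r -> r = 0) \/ (forall r, I r).
  apply: simR; split=> [|x y|r x|x]; rewrite /I; first exact: rmorph0.
  - by rewrite rmorphD => -> ->; rewrite addr0.
  - by rewrite rmorphM => ->; rewrite mulr0.
  - by rewrite embO_der => ->; exact: tens_der0.
- move=> x y xy; apply/eqP; rewrite -subr_eq0; apply/eqP/I0.
  by rewrite /I rmorphB xy subrr.
by have := O_neq0 iota0 G; rewrite -(rmorph1 embO) I1 eqxx.
Qed.

Definition inR (x : O) : Prop := exists r, x = embO r.

Lemma inR0 : inR 0. Proof. by exists 0; rewrite rmorph0. Qed.

Lemma inR_lin c x y : inR x -> inR y -> inR (inF0 (iota0 c) * x + y).
Proof.
move=> [r ->] [q ->]; exists (iota c * r + q).
by rewrite rmorphD rmorphM embO_base.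
Qed.

Lemma inR_sol x : inR x -> solP x.
Proof. by move=> [r ->]; exact: embO_sol. Qed.

(** The comorphism of the idempotent endomorphism g |-> sec(pi(g)) of G. *)
Definition sec_pi : algHom KG KG := pt (sec KG (ep_pi E KG gu)).
Definition theta : {rmorphism O -> O} := tens_map (algHom_id FK) sec_pi.

Lemma theta_pure f a : theta (@pure _ FK KG f a) = @pure _ FK KG f (sec_pi a).
Proof. exact: tens_map_pure. Qed.

(** A fixed [z] is an F0-combination of functions a(sec(pi(g))), hence of the entries of
    rho(sec(pi(g))). A frame Z of R satisfies embO(Z) = Z rho(sec(pi(g))), so these entries are
    F0-combinations of elements of R. *)
Lemma theta_fixed z : theta z = z -> lspan inF0 inR z.
Proof.
move=> <-.
suff H a : lspan inF0 inR (@tens_inr _ FK KG (sec_pi a)).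
  have [s ->] := tensor_seq z; rewrite rmorph_sum; apply: lspan_sum => p _.
  by rewrite theta_pure pureE; apply: lspanZ.
have [V [_ _ /(_ a (mem_head _ _))[c ->]]] := comodule_cover (iota0 := iota0) [::] [:: a].
have algE k b : @tens_inr _ FK KG (alg_str KG k * b) =
    inF0 (iota0 (val k)) * @tens_inr _ FK KG b.
  by rewrite rmorphM; congr (_ * _); exact/esym/(@tens_inlr _ FK KG k).
rewrite !rmorph_sum; apply: lspan_sum => i _.
rewrite [sec_pi _]rmorphM alg_funE [X in lspan _ _ X]algE; apply: lspanZ.
have [Z Zu Zeq] := frame_exists e0 phiH conR simR matR V.
have thrho j k : lspan inF0 inR (@tens_inr _ FK KG (sec_pi (cm_rho V j k))).
  have actE : act_rep phiH V gen_aut = map_mx sec_pi (cm_rho V).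
    apply/matrixP => a' b'; rewrite !mxE /act_pt /= /mult_of /sec_act pt_mapE.
    by rewrite /gen_aut gf_isoK.
  have embZ : map_mx embO Z = map_mx inF0 (map_mx e0 Z) *m
      map_mx (@tens_inr _ FK KG) (map_mx sec_pi (cm_rho V)).
    have /(congr1 (map_mx (emb_tens e0E (A := KG)))) := Zeq KG gen_aut.
    rewrite actE => q; transitivity (map_mx (emb_tens e0E (A := KG))
      (map_mx gen_aut (map_mx (@tens_inl _ (ext_calg iota) KG) Z))).
      by apply/matrixP => a' b'; rewrite !mxE.
    rewrite q map_mxM; congr (_ *m _); apply/matrixP => a' b'; rewrite !mxE /=;
      by rewrite emb_tens_pure ?rmorph1.
  have -> : @tens_inr _ FK KG (sec_pi (cm_rho V j k)) =
      (map_mx inF0 (map_mx e0 (invmx Z)) *m map_mx embO Z) j k.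
    rewrite embZ mulmxA -map_mxM -map_mxM mulVmx // !map_mx1 mul1mx.
    by rewrite !mxE.
  rewrite mxE; apply: lspan_sum => l _.
  by rewrite !mxE; apply: lspanZ; apply: lspan_gen; exists (Z l k).
have /matrixP/(_ i 0) := cm_v_rho V (sec KG (ep_pi E KG gu)).
rewrite mxE -/sec_pi => ->; rewrite mxE rmorph_sum; apply: lspan_sum => j _.
rewrite !mxE mulrC [X in lspan _ _ X]algE; exact: lspanZ.
Qed.

(** * The decomposition g = n sec(pi(g)) over the constants of F1 *)

Local Notation K1 := (constants F1).
Local Notation h1 := (constants_map i1).
Local Notation R1C := (ext_calg iota1).
Local Notation F1C := (ext_calg j1).

Section ExtLift.
Variables (B : calg K1) (q : algHom KG (restrict h1 B)).
Local Notation Au := (ext_alg h1 (base1 K1) KG).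

Definition ext_lift_l : {rmorphism restrict h1 (base1 K1) -> B} := alg_str B.

Fact ext_lift_compat k :
  ext_lift_l (alg_str (restrict h1 (base1 K1)) k) = q (alg_str KG k).
Proof. by rewrite alg_funE. Qed.

Definition ext_lift_r : {rmorphism KG -> B} := alg_fun q.

Fact ext_liftE k : rlift (g := ext_lift_r) ext_lift_compat (alg_str Au k) = alg_str B k.
Proof. exact: rlift_inl. Qed.

Definition ext_lift : algHom Au B :=
  @AlgHom K1 Au B (rlift (g := ext_lift_r) ext_lift_compat) ext_liftE.

Lemma ext_lift_pure c a :
  ext_lift (@pure _ (restrict h1 (base1 K1)) KG c a) = alg_str B c * q a.
Proof. exact: rlift_pure. Qed.

End ExtLift.

Local Notation Au := (ext_alg h1 (base1 K1) KG).

Definition gA : G (restrict h1 Au) := gf_map G (ext_inr h1 (base1 K1) KG) gu.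
Definition gS : G (restrict h1 Au) := sec _ (ep_pi E _ gA).

Lemma pt_gA a : pt gA a = @pure _ (restrict h1 (base1 K1)) KG 1 a.
Proof. by rewrite /gA pt_mapE pt_gen. Qed.

Lemma pt_gS a : pt gS a = @pure _ (restrict h1 (base1 K1)) KG 1 (sec_pi a).
Proof. by rewrite /gS /gA !gf_nat pt_mapE. Qed.

Lemma pi_nA : ep_pi E _ (gA * gS^-1)%g = 1%g.
Proof.
have piS : ep_pi E _ gS = ep_pi E _ gA by rewrite /gS secK.
by apply: (@mulIg _ (ep_pi E _ gS)); rewrite -gmulfM mulgVK mul1g.
Qed.

Definition sN : diffAut iota1 Au := R1_gal Au (ker_pt pi_nA).

Lemma act_sN : (act_pt phiN sN * gS)%g = gA.
Proof.
have -> : act_pt phiN sN = (gA * gS^-1)%g by exact: ker_act_gal.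
exact: mulgVK.
Qed.

(** The generic point g is n sec(pi(g)) with n = g sec(pi(g))^-1 in N, and [sN] is the automorphism
    given by n. So an N-equivariant function is determined by its values on sec(pi(g)). *)
Lemma equivN_eval x : equivN x -> exists y,
  ev j1_i1 gS x = emb_tens e1E y /\ ev j1_i1 gA x = emb_tens e1E (sN y).
Proof. by move=> /(_ _ gS sN)[y]; rewrite act_sN; exists y. Qed.

Definition O1 : calg K1 := @CAlg K1 O ((inF0 \o j1) \o val).

Fact inr_O1 k : @tens_inr _ FK KG (alg_str KG k) = alg_str (restrict h1 O1) k.
Proof. exact/esym/(@tens_inlr _ FK KG k). Qed.

Definition inr1 : algHom KG (restrict h1 O1) :=
  @AlgHom _ KG (restrict h1 O1) (@tens_inr _ FK KG) inr_O1.

Definition inF1C : {rmorphism F1C -> O} := inF0.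

Fact collapse_compat k : inF1C (alg_str F1C k) = ext_lift inr1 (alg_str Au k).
Proof. by rewrite alg_funE. Qed.

(* F0 (x)_K1 (K1 (x)_K K[G]) = F0 (x)_K K[G] *)
Definition collapse : {rmorphism tensor F1C Au -> O} :=
  rlift (g := alg_fun (ext_lift inr1)) collapse_compat.

Lemma collapse_pure f c a :
  collapse (@pure _ F1C Au f (@pure _ (restrict h1 (base1 K1)) KG c a)) =
  inF0 (f * j1 (val c)) * @tens_inr _ FK KG a.
Proof.
rewrite [LHS](rlift_pure collapse_compat) rmorphM -mulrA; congr (_ * _).
exact: (ext_lift_pure inr1 c a).
Qed.

Lemma collapse_gA x : collapse (ev j1_i1 gA x) = x.
Proof.
move: x; apply: tensor_eq => [u w|u w|f a] //; first by rewrite !rmorphD.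
by rewrite ev_pure pt_gA collapse_pure rmorph1 mulr1 -pureE.
Qed.

Lemma collapse_gS x : collapse (ev j1_i1 gS x) = theta x.
Proof.
move: x; apply: tensor_eq => [u w|u w|f a]; [by rewrite !rmorphD|exact: rmorphD|].
by rewrite ev_pure pt_gS collapse_pure rmorph1 mulr1 theta_pure -pureE.
Qed.

Lemma collapseK t : ev j1_i1 gA (collapse t) = t.
Proof.
move: t; apply: tensor_eq => [u w|u w|f a] //; first by rewrite !rmorphD.
move: a; apply: (@tensor_eq _ (restrict h1 (base1 K1)) KG _
  (fun a => ev j1_i1 gA (collapse (@pure _ F1C Au f a))) (@pure _ F1C Au f)).
- by move=> u w; rewrite (@pureDr _ F1C Au) !rmorphD.
- by move=> u w; rewrite (@pureDr _ F1C Au).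
move=> c a; rewrite collapse_pure -pureE ev_pure pt_gA.
rewrite mulrC (@pure_scale _ F1C Au c f); congr pure.
by rewrite /= pureM mulr1 mul1r.
Qed.

(** * Constants and simplicity *)

(** The value of [c] at sec(pi(g)) is constant, hence comes from K1 (x) K[G] and is fixed by [sN].
    So c(g) = c(sec(pi(g))), which puts [c] in the F0-span of R, then in R by [span_sol], and
    finally in the constants of R. *)
Lemma sol_constant c : solP c -> tens_der c = 0 -> exists k : K, c = inF0 (iota0 (val k)).
Proof.
move=> Sc dc; have [y [yS yA]] := equivN_eval (proj1 Sc).
have dy : tens_der y = 0.
  apply: (emb_tens_inj (eE := e1E) e1_inj).
  by rewrite emb_tens_der -yS -ev_der dc !rmorph0.
have [a aE] := tens_der_eq0 conR1 dy.
have [r rE] : inR c.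
  apply: span_sol => //; [exact: inR_sol|exact: inR0|exact: inR_lin|].
  apply: theta_fixed; rewrite -collapse_gS -[RHS]collapse_gA yS yA aE.
  by rewrite [sN _]diffAut_scal.
have [k kE] : exists k : K, iota (val k) = r.
  apply: conR; apply: embO_inj; rewrite embO_der rmorph0 -rE; exact: dc.
by exists k; rewrite rE -kE embO_base.
Qed.

Definition thetaA : algHom Au Au := ext_lift (pt gS).

Lemma theta_collapse t :
  theta (collapse t) = collapse (tens_map (algHom_id F1C) thetaA t).
Proof.
move: t; apply: tensor_eq => [u w|u w|f a]; [by rewrite !rmorphD|by rewrite !rmorphD|].
rewrite tens_map_pure; move: a; apply: (@tensor_eq _ (restrict h1 (base1 K1)) KG _
  (fun a => theta (collapse (@pure _ F1C Au f a)))
  (fun a => collapse (@pure _ F1C Au f (thetaA a)))).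
- by move=> u w; rewrite (@pureDr _ F1C Au) !rmorphD.
- by move=> u w; rewrite rmorphD (@pureDr _ F1C Au) rmorphD.
move=> c a; have thE : thetaA (@pure _ (restrict h1 (base1 K1)) KG c a) =
    @pure _ (restrict h1 (base1 K1)) KG c (sec_pi a).
  rewrite [LHS]ext_lift_pure pt_gS.
  apply: etrans (@pureM _ (restrict h1 (base1 K1)) KG c 1 1 (sec_pi a)) _.
  exact: (congr2 (@pure _ (restrict h1 (base1 K1)) KG) (mulr1 _) (mul1r _)).
by rewrite thE !collapse_pure -!pureE theta_pure.
Qed.

(** Replacing g by sec(pi(g)) makes the component n = g sec(pi(g))^-1 trivial, so [sN] specialises
    to the identity. *)
Lemma thetaA_sN r : tens_map (algHom_id R1C) thetaA (sN (@pure _ R1C Au r 1)) =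
  @pure _ R1C Au r 1.
Proof.
have thg : gf_map G (restrict_hom h1 thetaA) gA = gS.
  apply: pt_inj; apply: algHomP => a; rewrite pt_mapE pt_gA.
  by apply: etrans (ext_lift_pure (pt gS) 1 a) _; rewrite rmorph1 mul1r.
have thS : gf_map G (restrict_hom h1 thetaA) gS = gS.
  by rewrite {1}/gS -!gf_nat thg /gS secK.
have sN1 : diffAut_map thetaA sN = 1%g.
  rewrite /sN -[LHS](gf_nat R1_gal thetaA).
  have -> : gf_map (base_change h1 (ep_N E)) thetaA (ker_pt pi_nA) = 1%g.
    apply/val_inj; rewrite /= gmulfM thg.
    by rewrite -{1}thS -gmulfM mulgV gf_map1.
  apply: (@mulgI _ (R1_gal Au 1%g)); rewrite mulg1 -[LHS]gmulfM.
  by rewrite mulg1.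
have := congr1 (fun s : diffAut iota1 Au => s (@pure _ R1C Au r 1)) sN1.
by rewrite /= diffAut_ext_pure pure11 mulr1.
Qed.

Section Simple.
Variable I : O -> Prop.
Hypothesis IS : forall x, I x -> solP x.
Hypothesis ID : forall x y, I x -> I y -> I (x + y).
Hypothesis IM : forall a x, solP a -> I x -> I (a * x).
Hypothesis Ider : forall x, I x -> I (tens_der x).

Let inl1 : {rmorphism R1 -> tensor R1C Au} := alg_fun (inl_hom R1C Au).

(** The values on sec(pi(g)) of the elements of the ideal; their R1-span is the differential
    submodule to which [simple_submodule] is applied. *)
Definition evalI (y : tensor R1C Au) : Prop :=
  exists2 x, I x & ev j1_i1 gS x = emb_tens e1E y.

(** [sN] turns the value on sec(pi(g)) into the value at g. It turns r in R1 into a function that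
    restricts to r on sec(pi(g)), by [thetaA_sN], and that lies in the F0-span of S, so its product
    with an element of I stays in the F0-span of I. *)
Lemma evalI_collapse y : lspan inl1 evalI y ->
  theta (collapse (emb_tens e1E (sN y))) = collapse (emb_tens e1E y) /\
  lspan inF0 I (collapse (emb_tens e1E (sN y))).
Proof.
elim=> [|r z w [x Ix xz] _ [IH1 IH2]].
  by rewrite !rmorph0; split=> //; exact: lspan0.
have xE : collapse (emb_tens e1E (sN z)) = x.
  have [z' [zS zA]] := equivN_eval (proj1 (IS Ix)).
  have -> : z = z' by apply: (emb_tens_inj (eE := e1E) e1_inj); rewrite -xz zS.
  by rewrite -zA collapse_gA.
rewrite !rmorphD !rmorphM /= xE; split.
  rewrite IH1 -xz collapse_gS; congr (_ * _ + _).
  rewrite theta_collapse; congr (collapse _).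
  have emb_th t : tens_map (algHom_id F1C) thetaA (emb_tens e1E t) =
      emb_tens e1E (tens_map (algHom_id R1C) thetaA t).
    move: t; apply: tensor_eq => [u w'|u w'|f a]; [by rewrite !rmorphD|by rewrite !rmorphD|].
    by rewrite tens_map_pure !emb_tens_pure tens_map_pure.
  by rewrite emb_th thetaA_sN.
apply: lspanD => //.
apply: (@lspan_sub _ _ inF0 (fun a => exists2 b, solP b & a = b * x)).
  by move=> _ [b Sb ->]; apply: lspan_gen; exact: IM.
elim: (span_all (collapse (emb_tens e1E (sN (@pure _ R1C Au r 1))))).
  by rewrite mul0r; exact: lspan0.
move=> c b t Sb _ IH; rewrite mulrDl -mulrA; apply: lspanS => //.
by exists b.
Qed.

(** The R1-span of the values contains a nonzero constant, which [sN] fixes. Its transport [z] to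
    F0[G] is fixed by [theta] and lies in the F0-span of I, so by [theta_fixed] and [span_meet] the
    ideal contains a nonzero element of R; simplicity of R gives 1. *)
Lemma sol_simple x : I x -> x != 0 -> I 1.
Proof.
move=> Ix x0.
have [y [yS yA]] := equivN_eval (proj1 (IS Ix)).
have y0 : y != 0.
  apply: contra_neq x0 => y0.
  by rewrite -[x]collapse_gA yA y0 !rmorph0.
have My : lspan inl1 evalI y by apply: lspan_gen; exists x.
have [|||a [Ma a0]] := @simple_submodule _ _ _ conR1 simR1 Au _ _ _ _ y My y0.
- by move=> u w; exact: lspanD.
- by move=> r u; exact: (lspanZ (k := inl1)).
- move=> u; elim=> [|r z w [t It tz] Mz IH]; first by rewrite tens_der0; exact: lspan0.
  rewrite tens_derD tens_derM -addrA.
  have -> : tens_der (inl1 r) = inl1 (der r) by exact: tens_der_pure.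
  apply: lspanS; first by exists t.
  apply: lspanS => //; exists (tens_der t); first exact: Ider.
  by rewrite ev_der tz emb_tens_der.
have [thz Iz] := evalI_collapse Ma.
rewrite [sN _]diffAut_scal in thz Iz; set z := collapse _ in thz Iz.
have z0 : z != 0.
  apply: contra_neq a0 => z0; apply: (emb_tens_inj (eE := e1E) e1_inj).
  by rewrite -[LHS]collapseK -/z z0 !rmorph0.
have I0 : I 0.
  have := IM (solP_base 0) Ix; by rewrite !rmorph0 mul0r.
have [||||||w [Iw [r rE] w0]] := @span_meet I inR z _ _ _ _ _ _ Iz (theta_fixed thz) z0.
- exact: IS.
- exact: inR_sol.
- exact: I0.
- exact: inR0.
- by move=> c u w Iu Iw; apply: ID => //; apply: IM => //; exact: solP_base.
- exact: inR_lin.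
pose J r := I (embO r).
have [J0|J1] : (forall r, J r -> r = 0) \/ (forall r, J r).
  apply: simR; split=> [|u t|q u|u]; rewrite /J.
  - by rewrite rmorph0.
  - by rewrite rmorphD; exact: ID.
  - by rewrite rmorphM; apply: IM; exact: embO_sol.
  - by rewrite embO_der; exact: Ider.
- by move: w0; rewrite rE (J0 r) ?rmorph0 ?eqxx // /J -rE.
by rewrite -(rmorph1 embO); exact: J1.
Qed.

End Simple.

(** * The Picard-Vessiot ring S *)

Fact sol_closed : subring_closed (fun x : O => `[< solP x >]).
Proof.
split=> [|x y|x y]; rewrite !unfold_in; first exact/asboolP/solP1.
  by move=> /asboolP Sx /asboolP Sy; apply/asboolP/solPD => //; exact: solPN.
by move=> /asboolP Sx /asboolP Sy; apply/asboolP/solPM.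
Qed.

Fact sol_der_closed (x : O) :
  x \in (fun x : O => `[< solP x >]) -> tens_der x \in (fun x : O => `[< solP x >]).
Proof. by rewrite !unfold_in => /asboolP Sx; apply/asboolP/solP_der. Qed.

Definition sol_dsub : dsub :=
  @Dsub O (@tens_der _ _ iota0 KG) (@tens_derD _ _ _ _) (@tens_derM _ _ _ _)
    (fun x => `[< solP x >]) sol_closed sol_der_closed (O_neq0 iota0 G).

Definition SR : diffRingType := dsub_ring sol_dsub.

Definition sol_val : {rmorphism SR -> O} := dsub_incl sol_dsub.

Lemma sol_valP (s : SR) : solP (sol_val s).
Proof. exact/asboolP/(dsub_valP s). Qed.

Lemma sol_val_inj : injective sol_val.
Proof. exact: val_inj. Qed.

Lemma sol_val_der (s : SR) : sol_val (der s) = tens_der (sol_val s).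
Proof. by []. Qed.

Lemma sol_lift x : solP x -> exists s : SR, sol_val s = x.
Proof. by move=> /asboolP Sx; exists (@DsubElt sol_dsub x Sx). Qed.

Definition base_fun : {rmorphism F -> O} := inF0 \o iota0.

Fact base_fun_mem c : base_fun c \in @ds_pred sol_dsub.
Proof. exact/asboolP/solP_base. Qed.

Fact base_fun_der c : base_fun (der c) = @ds_der sol_dsub (base_fun c).
Proof. by rewrite /= tens_der_pure !rmorph_der. Qed.

Definition iotaS : {dmorphism F -> SR} :=
  @dsub_lift_dmorphism sol_dsub F base_fun base_fun_mem base_fun_der.

Fact embO_mem r : embO r \in @ds_pred sol_dsub.
Proof. exact/asboolP/embO_sol. Qed.

Fact embO_ds_der r : embO (der r) = @ds_der sol_dsub (embO r).
Proof. exact: embO_der. Qed.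

Definition embS : {dmorphism R -> SR} :=
  @dsub_lift_dmorphism sol_dsub R embO embO_mem embO_ds_der.

Lemma sol_val_iotaS c : sol_val (iotaS c) = inF0 (iota0 c). Proof. by []. Qed.
Lemma sol_val_embS r : sol_val (embS r) = embO r. Proof. by []. Qed.

Lemma embSE r : embS (iota r) = iotaS r.
Proof. by apply: sol_val_inj; rewrite sol_val_embS embO_base. Qed.

Lemma embS_inj : injective embS.
Proof. by move=> x y /(congr1 sol_val) /embO_inj. Qed.

Lemma simS : diff_simple SR.
Proof.
move=> I [I0 ID IM Ider].
have [[s Is s0]|nI] := pselect (exists2 s, I s & s != 0); last first.
  left=> s Is; apply/eqP/negP => /negP s0; apply: nI; by exists s.
right=> t; pose J (x : O) := exists2 s, I s & sol_val s = x.
have [||||||u Iu u1] := @sol_simple J _ _ _ _ (sol_val s).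
- by move=> _ [q _ <-]; exact: sol_valP.
- by move=> _ _ [q Iq <-] [r Ir <-]; exists (q + r); [exact: ID|rewrite rmorphD].
- move=> a _ /sol_lift[b <-] [q Iq <-].
  by exists (b * q); [exact: IM|rewrite rmorphM].
- by move=> _ [q Iq <-]; exists (der q); [exact: Ider|].
- by exists s.
- by apply: contra_neq s0 => s0; apply: sol_val_inj; rewrite s0 rmorph0.
have -> : t = t * u by rewrite (sol_val_inj (etrans u1 (esym (rmorph1 _)))) mulr1.
exact: IM.
Qed.

Lemma conS (x : SR) : der x = 0 -> exists c : constants F, iotaS (const_val c) = x.
Proof.
move=> dx; have [|k kE] := sol_constant (sol_valP x).
  by rewrite -sol_val_der dx rmorph0.
by exists k; apply: sol_val_inj; rewrite kE.
Qed.

Lemma sol_val_mx m n (M N : 'M[SR]_(m, n)) :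
  map_mx sol_val M = map_mx sol_val N -> M = N.
Proof.
move=> MN; apply/matrixP => a b; apply: sol_val_inj.
by move/matrixP/(_ a b): MN; rewrite !mxE.
Qed.

Section FundamentalMatrix.
Variable V : comodule G.
Variable Y : 'M[F0]_(cm_dim V).
Hypothesis frY : is_frame Y.
Local Notation n := (cm_dim V).
Local Notation irm := (map_mx (@tens_inr _ FK KG)).
Local Notation ilm := (map_mx inF0).

Lemma rhoVr : cm_rho V *m rho_inv V = 1%:M.
Proof.
have := cm_rhoV V gu; rewrite pt_gen.
by have -> : map_mx (algHom_id KG) (cm_rho V) = cm_rho V
  by apply/matrixP => a b; rewrite !mxE.
Qed.

(** The inverse of Y rho(g) is rho(g^-1) Y^-1, whose entries lie in S by [frame_inv_solP]. *)
Lemma fund_exists : exists Z : 'M[SR]_n,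
  Z \in unitmx /\ map_mx sol_val Z = ilm Y *m irm (cm_rho V).
Proof.
have wM A (x y : G A) : map_mx (pt (x * y)%g) (cm_rho V) =
  map_mx (pt x) (cm_rho V) *m map_mx (pt y) (cm_rho V) by exact: cm_rhoM.
have /choice[z zE] (p : 'I_n * 'I_n) := sol_lift (frame_solP frY p.1 p.2 wM).
have /choice[z' zE'] (p : 'I_n * 'I_n) := sol_lift (frame_inv_solP frY p.1 p.2).
pose Z : 'M[SR]_n := \matrix_(a, b) z (a, b).
pose Z' : 'M[SR]_n := \matrix_(a, b) z' (a, b).
have ZE : map_mx sol_val Z = ilm Y *m irm (cm_rho V).
  by apply/matrixP => a b; rewrite mxE [Z a b]mxE zE.
have ZE' : map_mx sol_val Z' = irm (rho_inv V) *m ilm (invmx Y).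
  by apply/matrixP => a b; rewrite mxE [Z' a b]mxE zE'.
exists Z; split=> //; suff /mulmx1_unit[] : Z *m Z' = 1%:M by [].
apply: sol_val_mx.
rewrite map_mxM ZE ZE' map_mx1 mulmxA -[X in X *m _]mulmxA -map_mxM rhoVr.
by rewrite map_mx1 mulmx1 -map_mxM mulmxV ?map_mx1 //; exact: frame_unit.
Qed.

Variable Z : 'M[SR]_n.
Hypotheses (Zu : Z \in unitmx) (ZE : map_mx sol_val Z = ilm Y *m irm (cm_rho V)).

Lemma irm_rho : irm (cm_rho V) = ilm (invmx Y) *m map_mx sol_val Z.
Proof.
by rewrite ZE mulmxA -map_mxM mulVmx ?map_mx1 ?mul1mx //; exact: frame_unit.
Qed.

(** [rho] is constant for the derivation, so Y rho satisfies the same equation over F as Y. *)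
Lemma fund_der : exists a : 'M[F]_n, map_mx der Z *m invmx Z = map_mx iotaS a.
Proof.
have [a aE] := frame_der frY; exists a.
suff -> : map_mx der Z = map_mx iotaS a *m Z by rewrite mulmxK.
apply: sol_val_mx; rewrite map_mxM ZE.
have -> : map_mx sol_val (map_mx iotaS a) = ilm (map_mx iota0 a).
  by apply/matrixP => i j; rewrite !mxE.
rewrite mulmxA -map_mxM -aE; apply/matrixP => i j.
have -> : map_mx sol_val (map_mx der Z) i j = tens_der (map_mx sol_val Z i j).
  by rewrite !mxE.
rewrite ZE !mxE (big_morph _ (@tens_derD _ _ _ _) (@tens_der0 _ _ _ _)).
by apply: eq_bigr => k _; rewrite !mxE tens_derM inF0_der tens_der_inr mulr0 addr0.
Qed.

Lemma v_rho i : @tens_inr _ FK KG (cm_v V i 0) =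
  \sum_j inF0 (iota0 (val (counit G (cm_v V j 0)))) * @tens_inr _ FK KG (cm_rho V i j).
Proof.
have /matrixP/(_ i 0) := cm_v_rho V gu; rewrite pt_gen !mxE /= => {1}->.
rewrite rmorph_sum; apply: eq_bigr => j _; rewrite !mxE rmorphM mulrC; congr (_ * _).
exact/esym/(@tens_inlr _ FK KG).
Qed.

End FundamentalMatrix.

(** For a comodule containing generators of K[G], rho = Y^-1 Z shows that the F-algebra generated by
    Z and 1/det Z spans F0[G] over F0. By [span_sol] this F-subspace of S is all of S. *)
Lemma is_PV_S : is_PV iotaS.
Proof.
split; [|exact: simS|exact: conS].
have [fs fsP] := lag_coord_ft G.
have [V [V0 _ cov]] := comodule_cover (iota0 := iota0) [::] fs.
have [Y frY] := exists_frame V0.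
have [Z [Zu ZE]] := fund_exists frY.
exists (cm_dim V), Z; split=> //; first exact: (fund_der frY Zu ZE).
pose gens y := (exists i j, y = Z i j) \/ y = (\det Z)^-1.
pose P (x : O) := exists2 s : SR, sol_val s = x & generated iotaS gens s.
have P1 : P 1 by exists (iotaS 1); [rewrite !rmorph1|exact: gen_scalar].
have PM u v : P u -> P v -> P (u * v).
  by move=> [a <- ga] [b <- gb]; exists (a * b); [rewrite rmorphM|exact: gen_mul].
have Pconst c : lspan inF0 P (inF0 c).
  by rewrite -[inF0 c]mulr1; apply: lspanZ; exact: lspan_gen.
have allP (x : O) : lspan inF0 P x.
  suff HP a : lspan inF0 P (@tens_inr _ FK KG a).
    have [s ->] := tensor_seq x; apply: lspan_sum => p _.
    by rewrite pureE; exact: lspanZ.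
  elim: (fsP a) => [k|f ff|u v _ Pu _ Pv|u v _ Pu _ Pv].
  - by rewrite -(@tens_inlr _ FK KG k); exact: Pconst.
  - have [c ->] := cov f ff.
    rewrite rmorph_sum; apply: lspan_sum => i _; rewrite rmorphM.
    rewrite -[X in X * _](@tens_inlr _ FK KG (c i)); apply: (lspanZ (k := inF0)).
    rewrite [X in lspan _ _ X]v_rho; apply: lspan_sum => j _; apply: lspanZ.
    have /matrixP/(_ i j) := irm_rho frY ZE; rewrite mxE => ->; rewrite mxE.
    apply: lspan_sum => l _; rewrite mxE [map_mx _ _ _ _]mxE.
    apply: lspanZ; apply: lspan_gen; exists (Z l j) => //.
    by apply: gen_gen; left; exists l, j.
  - by rewrite rmorphD; exact: lspanD.
  - by rewrite rmorphM; exact: lspanM.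
move=> x; have [|||||s /sol_val_inj <-] := @span_sol P (sol_val x) => //.
- by move=> _ [s <- _]; exact: sol_valP.
- by exists (iotaS 0); [rewrite !rmorph0|exact: gen_scalar].
- move=> c _ _ [a <- ga] [b <- gb]; exists (iotaS c * a + b).
    by rewrite rmorphD rmorphM.
  by apply: gen_add => //; apply: gen_mul => //; exact: gen_scalar.
- exact: sol_valP.
Qed.

Local Notation SC := (ext_calg iotaS).

Definition evK (B : calg K) (g : G B) : {rmorphism O -> tensor FK B} :=
  tens_map (algHom_id FK) (pt g).

Lemma evK_pure (B : calg K) (g : G B) f a :
  evK g (@pure _ FK KG f a) = @pure _ FK B f (pt g a).
Proof. exact: tens_map_pure. Qed.

Lemma evK_inF0 (B : calg K) (g : G B) c : evK g (inF0 c) = @tens_inl _ FK B c.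
Proof. by rewrite [LHS]evK_pure rmorph1. Qed.

Lemma evK_map (B B' : calg K) (q : algHom B B') (g : G B) x :
  evK (gf_map G q g) x = tens_map (algHom_id FK) q (evK g x).
Proof.
move: x; apply: tensor_eq => [u w|u w|f a]; [exact: rmorphD|by rewrite !rmorphD|].
by rewrite !evK_pure tens_map_pure pt_mapE.
Qed.

(** * The Galois group of the patched torsor *)

Section SolEval.
Variables (A B : calg K) (g : G B) (al : algHom A B).

Definition evS_l : {rmorphism SC -> tensor FK B} := evK g \o sol_val.
Definition evS_r : {rmorphism A -> tensor FK B} := @tens_inr _ FK B \o al.

Fact evS_compat k : evS_l (alg_str SC k) = evS_r (alg_str A k).
Proof.
transitivity (evK g (inF0 (iota0 (val k)))); first by [].
by rewrite evK_inF0 /evS_r [RHS]/= alg_funE; exact: (@tens_inlr _ FK B k).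
Qed.

Definition evS : {rmorphism tensor SC A -> tensor FK B} := rlift evS_compat.

Lemma evS_pure (s : SR) a :
  evS (@pure _ SC A s a) = evK g (sol_val s) * @tens_inr _ FK B (al a).
Proof. exact: (rlift_pure evS_compat). Qed.

Lemma evS_der t : evS (tens_der t) = tens_der (evS t).
Proof.
move: t; apply: tensor_eq => [u w|u w|s a].
- by rewrite tens_derD !rmorphD.
- by rewrite rmorphD tens_derD.
rewrite tens_der_pure !evS_pure tens_derM tens_der_inr mulr0 addr0; congr (_ * _).
rewrite sol_val_der; move: (sol_val s); apply: tensor_eq => [u w|u w|f b].
- by rewrite tens_derD !rmorphD.
- by rewrite rmorphD tens_derD.
by rewrite tens_der_pure !evK_pure tens_der_pure.
Qed.

End SolEval.

Lemma evS_map (A B B' : calg K) (q : algHom B B') (g : G B) (al : algHom A B) t :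
  tens_map (algHom_id FK) q (evS g al t) =
  evS (gf_map G q g) (algHom_comp q al) t.
Proof.
move: t; apply: tensor_eq => [u w|u w|s a]; [by rewrite !rmorphD|by rewrite !rmorphD|].
rewrite !evS_pure evK_map rmorphM; congr (_ * _).
by apply: etrans (tens_map_pure _ _ _ _) _; rewrite rmorph1.
Qed.

Lemma evS_comp (A A' B : calg K) (q : algHom A A') (g : G B) (al : algHom A' B) t :
  evS g al (tens_map (algHom_id SC) q t) = evS g (algHom_comp al q) t.
Proof.
move: t; apply: tensor_eq => [u w|u w|s a]; [by rewrite !rmorphD|by rewrite !rmorphD|].
by rewrite tens_map_pure !evS_pure.
Qed.

Section GenericEval.
Variable A : calg K.
Local Notation KGA := (tens_calg KG A).

Definition gl : G KGA := gf_map G (inl_hom KG A) gu.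

(** The inclusion of S (x) A in F0 (x) K[G] (x) A. Identities in S (x) A are checked there, where
    right translation by g is evaluation at the product of [gl] and [gr g]. *)
Definition Theta : {rmorphism tensor SC A -> tensor FK KGA} :=
  evS gl (inr_hom KG A).

Lemma pt_gl a : pt gl a = @tens_inl _ KG A a.
Proof. by rewrite /gl pt_mapE pt_gen. Qed.

Lemma Theta_inj : injective Theta.
Proof.
move=> t u tu; apply: slices_inj => mu fm; apply: sol_val_inj.
have fD : {morph (slice mu : KGA -> KG) : x y / x + y} := sliceD fm.
have fZ k (x : KGA) : slice mu (alg_str KGA k * x) = alg_str KG k * slice mu x :> KG.
  exact: (slice_inl fm (alg_str KG k : KG)).
have sl w : tens_linr (A := KGA) (slice mu : KGA -> KG) (Theta w) =
    sol_val (slice mu w) :> tensor FK KG.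
  have lD := tens_linrD (B := FK) fD fZ.
  move: w; apply: tensor_eq => [x y|x y|s a].
  - by rewrite rmorphD lD.
  - by rewrite (sliceD fm) rmorphD.
  rewrite evS_pure slice_pure //; move: s => s.
  have -> : sol_val (alg_str SC (mu a) * s) =
      inF0 (iota0 (val (mu a))) * sol_val s by rewrite rmorphM.
  move: (sol_val s); apply: tensor_eq => [x y|x y|f b].
  - by rewrite rmorphD mulrDl lD.
  - by rewrite mulrDr.
  rewrite evK_pure pt_gl !pureM (tens_linr_pure fD fZ) !mulr1 mul1r.
  by rewrite mul1r slice_pure //; exact/esym/(@pure_scale _ FK KG (mu a) f b).
by rewrite -!sl tu.
Qed.

Definition gr (g : G A) : G KGA := gf_map G (inr_hom KG A) g.

Section Translation.
Variable g : G A.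

(** An element of S is u Y v with u over F, and v(g' g) = rho(g') v(g). The coefficients u Y rho(g')
    lie in S and v(g) lies in A, so the translate lies in S (x) A. *)
Lemma translate_exists (s : SR) : exists t : tensor SC A,
  Theta t = evK (gl * gr g)%g (sol_val s).
Proof.
have [|V [Y [frY cov _]]] := @sol_frame [:: sol_val s] [::].
  by move=> x; rewrite inE => /eqP ->; exact: sol_valP.
have [u ->] := cov _ (mem_head _ _).
pose z k : O := (map_mx inF0 (map_mx iota0 u *m Y) *m
  map_mx (@tens_inr _ FK KG) (cm_rho V)) 0 k.
have zS k : solP (z k).
  rewrite /z map_mxM -mulmxA mxE.
  apply: (big_ind solP) => [||j _].
  - by have := solP_base 0; rewrite !rmorph0.
  - exact: solPD.
  rewrite !mxE; apply: solPM; first exact: solP_base.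
  have wM B (x y : G B) : map_mx (pt (x * y)%g) (cm_rho V) =
    map_mx (pt x) (cm_rho V) *m map_mx (pt y) (cm_rho V) by exact: cm_rhoM.
  by have := frame_solP frY j k wM; rewrite mxE.
have /choice[q qE] k := sol_lift (zS k).
exists (\sum_k @pure _ SC A (q k) (pt g (cm_v V k 0))).
rewrite rmorph_sum /expand rmorph_sum.
under eq_bigr do rewrite evS_pure qE /z mxE rmorph_sum mulr_suml.
rewrite exchange_big; apply: eq_bigr => j _.
rewrite evK_pure.
have /matrixP/(_ j 0) := cm_vM V gl (gr g); rewrite !mxE => ->.
rewrite (big_morph (pure _) (@pureDr _ _ _ _) (@pure0r _ _ _ _)).
apply: eq_bigr => k _; rewrite !mxE rmorphM [X in X * _ * _]evK_inF0.
rewrite [X in _ * X * _]evK_pure !pureM !mulr1 mul1r.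
by rewrite [X in _ = pure _ (_ * X)]pt_mapE.
Qed.

Definition translate (s : SR) : tensor SC A := projT1 (cid (translate_exists s)).

Lemma Theta_translate s : Theta (translate s) = evK (gl * gr g)%g (sol_val s).
Proof. by rewrite /translate; case: cid. Qed.

Fact translate_zmod : zmod_morphism translate.
Proof. by move=> x y; apply: Theta_inj; rewrite rmorphB !Theta_translate !rmorphB. Qed.

Fact translate_monoid : monoid_morphism translate.
Proof.
split=> [|x y]; apply: Theta_inj; first by rewrite Theta_translate !rmorph1.
by rewrite rmorphM !Theta_translate !rmorphM.
Qed.

HB.instance Definition _ := GRing.isZmodMorphism.Build SC (tensor SC A)
  translate translate_zmod.
HB.instance Definition _ := GRing.isMonoidMorphism.Build SC (tensor SC A)
  translate translate_monoid.

Definition translate_rmorphism : {rmorphism SC -> tensor SC A} := translate.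

Lemma translate_base c : translate (iotaS c) = @pure _ SC A (iotaS c) 1.
Proof.
apply: Theta_inj; rewrite Theta_translate evS_pure rmorph1 rmorph1 mulr1.
by rewrite sol_val_iotaS !evK_inF0.
Qed.

Fact sol_act_compat k : translate_rmorphism (alg_str SC k) = @tens_inr _ SC A (alg_str A k).
Proof. by rewrite [LHS]translate_base; exact: (@tens_inlr _ SC A k). Qed.

Definition sol_act : {rmorphism tensor SC A -> tensor SC A} :=
  rlift sol_act_compat.

Lemma sol_act_pure (s : SR) a :
  sol_act (@pure _ SC A s a) = translate s * @tens_inr _ SC A a.
Proof. exact: (rlift_pure sol_act_compat). Qed.

Lemma evS_act (B : calg K) (g' : G B) (al : algHom A B) t :
  evS g' al (sol_act t) = evS (g' * gf_map G al g)%g al t.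
Proof.
move: t; apply: tensor_eq => [x y|x y|s a]; [by rewrite !rmorphD|by rewrite !rmorphD|].
rewrite sol_act_pure evS_pure rmorphM; congr (_ * _); last first.
  by rewrite evS_pure !rmorph1 mul1r.
have := congr1 (tens_map (algHom_id FK) (pair_hom (pt g') al)) (Theta_translate s).
rewrite [X in X = _]evS_map -[X in _ = X]evK_map gmulfM /gl /gr -!gf_map_comp.
by rewrite pair_hom_inl pair_hom_inr map_gen.
Qed.

Lemma Theta_act t : Theta (sol_act t) = evS (gl * gr g)%g (inr_hom KG A) t.
Proof. exact: evS_act. Qed.

Lemma sol_act_der t : sol_act (tens_der t) = tens_der (sol_act t).
Proof. by apply: Theta_inj; rewrite [RHS]evS_der !Theta_act evS_der. Qed.

Lemma sol_act_lin (y : tensor (base_calg F) A) :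
  sol_act (tens_map (ext_base_hom iotaS) (algHom_id A) y) =
  tens_map (ext_base_hom iotaS) (algHom_id A) y.
Proof.
move: y; apply: tensor_eq => [u w|u w|l a]; [by rewrite !rmorphD|by rewrite rmorphD|].
by rewrite tens_map_pure sol_act_pure translate_base pureM mulr1 mul1r.
Qed.

End Translation.

Lemma sol_actM g g' t : sol_act (g * g')%g t = sol_act g (sol_act g' t).
Proof. by apply: Theta_inj; rewrite !Theta_act evS_act -mulgA -gmulfM. Qed.

Lemma sol_act1 t : sol_act 1%g t = t.
Proof. by apply: Theta_inj; rewrite Theta_act /gr gf_map1 mulg1. Qed.

Lemma sol_actK g : cancel (sol_act g) (sol_act g^-1%g).
Proof. by move=> t; rewrite -sol_actM mulVg sol_act1. Qed.

Lemma sol_actVK g : cancel (sol_act g^-1%g) (sol_act g).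
Proof. by move=> t; rewrite -sol_actM mulgV sol_act1. Qed.

Definition sol_aut (g : G A) : diffAut iotaS A :=
  DiffAut (@sol_actK g) (@sol_actVK g) (rmorphB (sol_act g))
    (rmorphism_monoidP (sol_act g)) (@sol_act_der g) (@sol_act_lin g).

Fact sol_autM : {morph sol_aut : x y / (x * y)%g}.
Proof. by move=> x y; apply: diffAutP => t; exact: sol_actM. Qed.

(** As S spans F0[G] over F0, the automorphism determines evaluation at the product of [gl] and
    [gr g] on all of F0[G], hence this point, and g after cancelling [gl]. *)
Lemma sol_aut_inj : injective sol_aut.
Proof.
move=> g g' gg'.
have evE x : evK (gl * gr g)%g x = evK (gl * gr g')%g x.
  elim: (span_all x) => [|c _ y /sol_lift[s <-] _ IH]; first by rewrite !rmorph0.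
  rewrite !rmorphD !rmorphM !evK_inF0 IH -!Theta_translate; congr (_ * Theta _ + _).
  have := congr1 (fun q : diffAut iotaS A => q (@pure _ SC A s 1)) gg'.
  by rewrite /= !sol_act_pure rmorph1 !mulr1.
have F01 : (1 : FK) != 0 by exact: (oner_neq0 F0).
have : gr g = gr g'.
  apply: (@mulgI _ gl); apply: pt_inj; apply: algHomP => a.
  apply: (@tens_inr_inj _ FK KGA F01); have := evE (@tens_inr _ FK KG a).
  by rewrite !evK_pure.
move/(congr1 (gf_map G (pair_hom (pt (1%g : G A)) (algHom_id A)))).
rewrite /gr -!gf_map_comp !pair_hom_inr.
by rewrite !gf_map_id.
Qed.

End GenericEval.

(** * Differential automorphisms of S are right translations *)

Section Surjectivity.
Variables (A : calg K) (tau : diffAut iotaS A).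
Local Notation KGA := (tens_calg KG A).
Local Notation T := (tensor FK KGA).

Definition twist : {rmorphism SR -> T} :=
  (Theta A \o tau) \o alg_fun (inl_hom SC A).

Definition inT : {rmorphism F0 -> T} := alg_fun (inl_hom FK KGA).
Definition irT : {rmorphism KGA -> T} := alg_fun (inr_hom FK KGA).

Lemma twist_base c : twist (iotaS c) = inT (iota0 c).
Proof.
rewrite /twist /= [tau _]diffAut_base [LHS]evS_pure !rmorph1 mulr1.
by rewrite sol_val_iotaS [LHS]evK_inF0.
Qed.

(* The graph of the F0-linear extension of [twist] to F0[G] = F0 (x)_F S. *)
Inductive twist_graph : O -> T -> Prop :=
| twist_graph0 : twist_graph 0 0
| twist_graphS c s x y of twist_graph x y :
    twist_graph (inF0 c * sol_val s + x) (inT c * twist s + y).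

Lemma twist_graphD x y x' y' : twist_graph x y -> twist_graph x' y' ->
  twist_graph (x + x') (y + y').
Proof.
move=> g g'; elim: g => [|c s u w _ IH]; first by rewrite !add0r.
by rewrite -!addrA; exact: twist_graphS.
Qed.

Lemma twist_graphZ c x y : twist_graph x y -> twist_graph (inF0 c * x) (inT c * y).
Proof.
elim=> [|d s u w _ IH]; first by rewrite !mulr0; exact: twist_graph0.
by rewrite !mulrDr !mulrA -!rmorphM; exact: twist_graphS.
Qed.

Lemma twist_graph_val s : twist_graph (sol_val s) (twist s).
Proof.
have := twist_graphS 1 s twist_graph0.
by rewrite !rmorph1 !mul1r !addr0.
Qed.

Lemma twist_graphM x y x' y' : twist_graph x y -> twist_graph x' y' ->
  twist_graph (x * x') (y * y').
Proof.
move=> g g'; elim: g => [|c s u w _ IH]; first by rewrite !mul0r; exact: twist_graph0.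
rewrite !mulrDl; apply: twist_graphD => //; rewrite -!mulrA; apply: twist_graphZ.
elim: g' {IH} => [|d r u' w' _ IH]; first by rewrite !mulr0; exact: twist_graph0.
rewrite !mulrDr [X in twist_graph (X + _)]mulrCA [X in twist_graph _ (X + _)]mulrCA.
rewrite -[sol_val s * _]rmorphM -[twist s * _]rmorphM.
exact: twist_graphS.
Qed.

Lemma twist_graph_sum (J : Type) (l : seq J) (f : J -> O) (f' : J -> T) :
  (forall j, twist_graph (f j) (f' j)) ->
  twist_graph (\sum_(j <- l) f j) (\sum_(j <- l) f' j).
Proof.
move=> ff'; elim: l => [|j l IH]; first by rewrite !big_nil; exact: twist_graph0.
by rewrite !big_cons; exact: twist_graphD.
Qed.

Lemma twist_graph_repr x y : twist_graph x y -> exists2 l : seq (F0 * SR),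
  x = \sum_(p <- l) inF0 p.1 * sol_val p.2 & y = \sum_(p <- l) inT p.1 * twist p.2.
Proof.
elim=> [|c s u w _ [l -> ->]]; first by exists [::]; rewrite big_nil.
by exists ((c, s) :: l); rewrite big_cons.
Qed.

(** Elements of S have F-coordinates along a frame Y. Since Y is invertible, an F0-linear relation
    between them already holds between their coordinate rows, and [twist] is F-linear; so the graph
    is single-valued. *)
Lemma twist_graph_eq0 y : twist_graph 0 y -> y = 0.
Proof.
move=> /twist_graph_repr[l /esym xE yE].
have [|V [Y [frY cov _]]] := @sol_frame [seq sol_val p.2 | p <- l] [::].
  by move=> z /mapP[p _ ->]; exact: sol_valP.
have Yu := frame_unit frY.
have /choice[w wE] k := sol_lift (frame_solP frY k 0 (cm_vM V)).
have pos (p : F0 * SR) : exists u : 'rV[F]_(cm_dim V), p \in l ->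
    sol_val p.2 = expand iota0 (map_mx iota0 u *m Y).
  have [/(map_f (fun p => sol_val p.2)) /cov[u uE]|pl] := boolP (p \in l).
    by exists u.
  by exists 0.
have /choice[u uE] := pos.
have tw p : p \in l -> twist p.2 = \sum_k inT (iota0 (u p 0 k)) * twist (w k).
  move=> pl; have -> : p.2 = \sum_k iotaS (u p 0 k) * w k.
    apply: sol_val_inj; rewrite uE // mulmx_sum_row expand_sum rmorph_sum.
    apply: eq_bigr => k _; rewrite expandZ rmorphM wE mxE; congr (_ * _).
    exact: expandE.
  by rewrite rmorph_sum; apply: eq_bigr => k _; rewrite rmorphM twist_base.
have c0 : \sum_(p <- l) p.1 *: map_mx iota0 (u p) = 0.
  have e1' : expand iota0 ((\sum_(p <- l) p.1 *: map_mx iota0 (u p)) *m Y) = 0.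
    rewrite mulmx_suml expand_sum -[RHS]xE.
    rewrite [LHS]big_seq [RHS]big_seq; apply: eq_bigr => p pl.
    by rewrite -scalemxAl expandZ uE.
  have e2' : (\sum_(p <- l) p.1 *: map_mx iota0 (u p)) *m Y = 0.
    by apply: (expand_inj (iota0 := iota0) (V := V)); rewrite e1' expand0.
  by rewrite -[LHS](mulmxK Yu) e2' mul0mx.
rewrite yE big_seq.
transitivity (\sum_k inT ((\sum_(p <- l) p.1 *: map_mx iota0 (u p)) 0 k) * twist (w k)).
  rewrite (eq_bigr (fun p => \sum_k inT (p.1 * iota0 (u p 0 k)) * twist (w k))).
    rewrite -big_seq exchange_big; apply: eq_bigr => k _.
    rewrite summxE rmorph_sum mulr_suml; apply: eq_bigr => p _.
    by rewrite !mxE.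
  move=> p pl; rewrite tw // mulr_sumr; apply: eq_bigr => k _.
  by rewrite rmorphM mulrA.
by rewrite c0 big1 // => k _; rewrite mxE rmorph0 mul0r.
Qed.

Lemma twist_graph_fun x y y' : twist_graph x y -> twist_graph x y' -> y = y'.
Proof.
move=> g /(twist_graphZ (-1)) g'; have := twist_graphD g g'.
rewrite !rmorphN !rmorph1 !mulN1r subrr => /twist_graph_eq0 /eqP.
by rewrite subr_eq0 => /eqP.
Qed.

Section TwistMatrix.
Variable V : comodule G.
Local Notation n := (cm_dim V).

(** For Z = Y rho one has tau(Z) = Z D, and D is constant because tau respects the equation of Z; so
    D comes from a matrix C over A. Cancelling Y, the extension of tau sends rho to rho C. *)
Lemma twist_rho : exists C : 'M[A]_n, forall i j,
  twist_graph (@tens_inr _ FK KG (cm_rho V i j))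
    (irT ((map_mx (@tens_inl _ KG A) (cm_rho V) *m
           map_mx (@tens_inr _ KG A) C) i j)).
Proof.
(* Frames are available in positive dimension; for n = 0 there is no entry to check. *)
have [n0|V0] := posnP n.
  exists 0 => i; have := leq_trans (ltn_ord i) (eq_leq n0); by [].
have [Y frY] := exists_frame V0.
have [Z [Zu ZE]] := fund_exists frY.
have [a aE] := fund_der frY Zu ZE.
have dZ : map_mx der Z = map_mx iotaS a *m Z by rewrite -aE mulmxKV.
pose il : {rmorphism SR -> tensor SC A} := alg_fun (inl_hom SC A).
pose D := map_mx il (invmx Z) *m map_mx tau (map_mx il Z).
have ZD : map_mx tau (map_mx il Z) = map_mx il Z *m D.
  by rewrite mulmxA -map_mxM mulmxV // map_mx1 mul1mx.
clearbody D.
have dM m p q (M : 'M[tensor SC A]_(m, p)) (N : 'M[tensor SC A]_(p, q)) :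
    map_mx (@tens_der _ _ iotaS A) (M *m N) =
    map_mx (@tens_der _ _ iotaS A) M *m N + M *m map_mx (@tens_der _ _ iotaS A) N.
  apply/matrixP => i j; rewrite !mxE.
  rewrite (big_morph _ (@tens_derD _ _ iotaS A) (@tens_der0 _ _ iotaS A)) -big_split.
  by apply: eq_bigr => k _; rewrite tens_derM !mxE.
have dil : map_mx (@tens_der _ _ iotaS A) (map_mx il Z) = map_mx il (map_mx der Z).
  by apply/matrixP => i j; rewrite !mxE; exact: tens_der_pure.
have dD : map_mx (@tens_der _ _ iotaS A) D = 0.
  have : map_mx (@tens_der _ _ iotaS A) (map_mx tau (map_mx il Z)) =
      map_mx il (map_mx iotaS a) *m map_mx tau (map_mx il Z).
    have -> : map_mx (@tens_der _ _ iotaS A) (map_mx tau (map_mx il Z)) =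
        map_mx tau (map_mx il (map_mx der Z)).
      apply/matrixP => i j; rewrite !mxE -aut_der; congr (tau _).
      exact: tens_der_pure.
    rewrite dZ !map_mxM; congr (_ *m _); apply/matrixP => i j; rewrite !mxE.
    exact: diffAut_base.
  rewrite ZD dM dil dZ map_mxM mulmxA => /(canRL (addKr _)).
  rewrite addNr => e0'.
  by rewrite -[LHS]mul1mx -(map_mx1 il) -(mulVmx Zu) map_mxM -mulmxA e0' mulmx0.
have /choice[C CE] (p : 'I_n * 'I_n) : exists c, D p.1 p.2 = @tens_inr _ SC A c.
  apply: (tens_der_eq0 conS); by move/matrixP/(_ p.1 p.2): dD; rewrite mxE [in RHS]mxE.
exists (\matrix_(i, j) C (i, j)) => i j.
have twZ : map_mx twist Z = map_mx inT Y *m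
    map_mx irT (map_mx (@tens_inl _ KG A) (cm_rho V) *m
           map_mx (@tens_inr _ KG A) (\matrix_(i, j) C (i, j))).
  transitivity (map_mx (Theta A) (map_mx tau (map_mx il Z))).
    by apply/matrixP => k l; rewrite !mxE.
  rewrite ZD !map_mxM mulmxA; congr (_ *m _).
    transitivity (map_mx (evK (gl A)) (map_mx sol_val Z)).
      apply/matrixP => k l; rewrite !mxE.
      by rewrite [LHS](evS_pure (gl A) (inr_hom KG A)) !rmorph1 mulr1.
    rewrite ZE map_mxM; congr (_ *m _); apply/matrixP => k l; rewrite !mxE.
      exact: evK_inF0.
    by apply: etrans (evK_pure _ _ _) _; rewrite pt_gl.
  apply/matrixP => k l; rewrite mxE (CE (k, l)) !mxE.
  by apply: etrans (evS_pure _ _ _ _) _; rewrite !rmorph1 mul1r.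
have -> : irT ((map_mx (@tens_inl _ KG A) (cm_rho V) *m
     map_mx (@tens_inr _ KG A) (\matrix_(i, j) C (i, j))) i j) =
    (map_mx inT (invmx Y) *m map_mx twist Z) i j.
  rewrite twZ mulmxA -map_mxM mulVmx ?map_mx1 ?mul1mx; last exact: frame_unit frY.
  by rewrite [RHS]mxE.
have /matrixP/(_ i j) := irm_rho frY ZE; rewrite mxE => ->.
rewrite !mxE; apply: twist_graph_sum => k; rewrite !mxE; apply: twist_graphZ.
exact: twist_graph_val.
Qed.

End TwistMatrix.

Lemma twist_graph_scal k x y : twist_graph (@tens_inr _ FK KG x) (irT y) ->
  twist_graph (@tens_inr _ FK KG (alg_str KG k * x)) (irT (alg_str KGA k * y)).
Proof.
move=> /(twist_graphZ (iota0 (val k))).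
have -> : @tens_inr _ FK KG (alg_str KG k * x) = inF0 (iota0 (val k)) * @tens_inr _ FK KG x.
  by rewrite rmorphM; congr (_ * _); exact/esym/(@tens_inlr _ FK KG k).
have -> : irT (alg_str KGA k * y) = inT (iota0 (val k)) * irT y.
  by rewrite rmorphM; congr (_ * _); exact/esym/(@tens_inlr _ FK KGA k).
by [].
Qed.

Lemma twist_inr f : exists y, twist_graph (@tens_inr _ FK KG f) (irT y).
Proof.
have [V [V0 _ cov]] := comodule_cover (iota0 := iota0) [::] [:: f].
have [c ->] := cov f (mem_head _ _).
have [C CE] := twist_rho V.
pose t i j : KGA := (map_mx (@tens_inl _ KG A) (cm_rho V) *m
  map_mx (@tens_inr _ KG A) C) i j.
exists (\sum_i alg_str KGA (c i) * \sum_j alg_str KGA (counit G (cm_v V j 0)) * t i j).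
rewrite !rmorph_sum; apply: twist_graph_sum => i; apply: twist_graph_scal.
have /matrixP/(_ i 0) := cm_v_rho V gu; rewrite pt_gen !mxE /= => ->.
rewrite !rmorph_sum; apply: twist_graph_sum => j; rewrite !mxE mulrC.
by apply: twist_graph_scal; exact: CE.
Qed.

Lemma irT_inj : injective irT.
Proof. by apply: (@tens_inr_inj _ FK KGA); exact: (oner_neq0 F0). Qed.

(** The F0-linear extension of tau maps K[G] into K[G] (x) A by [twist_inr] and is a ring
    homomorphism, that is, a point of G. *)
Lemma twist_point : exists q : G KGA, forall f,
  twist_graph (@tens_inr _ FK KG f) (irT (pt q f)).
Proof.
have /choice[t tE] := twist_inr.
have uniq x y y' : twist_graph x (irT y) -> twist_graph x (irT y') -> y = y'.
  by move=> g g'; apply: irT_inj; exact: twist_graph_fun g'.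
have t1 : t 1 = 1.
  apply: (uniq 1); first by have := tE 1; rewrite rmorph1.
  by have := twist_graph_val 1; rewrite !rmorph1.
have tM : {morph t : x y / x * y}.
  move=> x y; apply: uniq (tE _) _; rewrite !rmorphM; exact: twist_graphM (tE x) (tE y).
have tD : {morph t : x y / x + y}.
  move=> x y; apply: uniq (tE _) _; rewrite !rmorphD; exact: twist_graphD (tE x) (tE y).
have tZ : zmod_morphism t.
  by move=> x y; apply: (@addIr _ (t y)); rewrite -tD !subrK.
have tK k : t (alg_str KG k) = alg_str KGA k.
  apply: uniq (tE _) _; rewrite -[alg_str KG k]mulr1 -[alg_str KGA k]mulr1.
  by apply: twist_graph_scal; rewrite -t1; exact: tE.
exists (lag_pt (mk_algHom tZ (t1, tM) tK)) => f; rewrite ptK; exact: tE.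
Qed.

(** Let g' be the generic point [gl]. Specialising g' to 1 in rho(q) = rho(g') C identifies C with
    rho(g), so rho(q) = rho(g' g) for every comodule and q = g' g: the extension of tau is right
    translation by g. *)
Lemma sol_aut_onto : exists g : G A, sol_aut g = tau.
Proof.
have [q qE] := twist_point.
pose back : algHom KGA A := pair_hom (pt (1%g : G A)) (algHom_id A).
pose g := gf_map G back q; exists g.
have qg : q = (gl A * gr g)%g.
  apply: pt_inj; apply: algHomP => f.
  have [V [V0 _ cov]] := comodule_cover (iota0 := iota0) [::] [:: f].
  have [c ->] := cov f (mem_head _ _).
  have [C CE] := twist_rho V.
  have ptq : map_mx (pt q) (cm_rho V) =
      map_mx (@tens_inl _ KG A) (cm_rho V) *m map_mx (@tens_inr _ KG A) C.
    apply/matrixP => i j; rewrite mxE; apply: irT_inj.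
    by apply: twist_graph_fun (CE i j); exact: qE.
  have ptg : map_mx (pt g) (cm_rho V) = C.
    have -> : map_mx (pt g) (cm_rho V) = map_mx back (map_mx (pt q) (cm_rho V)).
      by apply/matrixP => i j; rewrite !mxE pt_mapE.
    rewrite ptq map_mxM.
    have -> : map_mx back (map_mx (@tens_inl _ KG A) (cm_rho V)) =
        map_mx (pt (1%g : G A)) (cm_rho V).
      apply/matrixP => i j; rewrite !mxE; apply: etrans (pair_hom_pure _ _ _ _) _.
      by rewrite rmorph1 mulr1.
    rewrite cm_rho1 mul1mx; apply/matrixP => i j; rewrite !mxE.
    by apply: etrans (pair_hom_pure _ _ _ _) _; rewrite rmorph1 mul1r.
  have rhoE : map_mx (pt q) (cm_rho V) = map_mx (pt (gl A * gr g)%g) (cm_rho V).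
    rewrite cm_rhoM ptq; congr (_ *m _); apply/matrixP => i j.
      by rewrite !mxE pt_gl.
    by rewrite -ptg !mxE /gr pt_mapE.
  have vE : map_mx (pt q) (cm_v V) = map_mx (pt (gl A * gr g)%g) (cm_v V).
    by rewrite !(cm_v_rho V) rhoE.
  rewrite !rmorph_sum; apply: eq_bigr => i _; rewrite !rmorphM !alg_funE.
  by move/matrixP/(_ i 0): vE; rewrite !mxE => ->.
have graphE x : twist_graph x (evK q x).
  have [l ->] := tensor_seq x; rewrite rmorph_sum; apply: twist_graph_sum => p.
  rewrite evK_pure !pureE; apply: twist_graphZ; exact: qE.
apply: diffAut_eq => s; apply: Theta_inj.
rewrite /= sol_act_pure rmorph1 mulr1 Theta_translate -qg.
by apply: twist_graph_fun (graphE _) _; exact: twist_graph_val.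
Qed.

End Surjectivity.

Lemma sol_aut_nat (A B : calg K) (f : algHom A B) (g : G A) :
  sol_aut (gf_map G f g) = diffAut_map f (sol_aut g).
Proof.
apply: diffAut_eq => s; apply: Theta_inj.
rewrite /= diffAut_ext_pure pure11 mulr1 /= !sol_act_pure !rmorph1 !mulr1.
rewrite Theta_translate [RHS]evS_comp.
have := evS_act g (gl B) (algHom_comp (inr_hom KG B) f) (@pure _ SC A s 1).
rewrite sol_act_pure evS_pure !rmorph1 !mulr1 => ->.
by rewrite gf_map_comp.
Qed.

Definition sol_gfhom : gfHom G (diffGal iotaS).
Proof.
refine (@GFHom _ G (diffGal iotaS) (fun A => mk_mult (@sol_autM A)) _).
exact: sol_aut_nat.
Defined.

Fact sol_gfhom_bij A : bijective (sol_gfhom A).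
Proof.
have /choice[f fK] := @sol_aut_onto A; exists f => [g|]; last exact: fK.
by apply: sol_aut_inj; exact: fK.
Qed.

Definition sol_gfiso : gfIso G (diffGal iotaS) := GFIso sol_gfhom_bij.

Lemma evK_embO (B : calg K) (g : G B) r : evK g (embO r) =
  emb_tens e0E ((ep_gal E B (ep_pi E B g) : diffAut iota B) (@pure _ (ext_calg iota) B r 1)).
Proof.
rewrite -gal_gen embOE; move: (gen_aut _); apply: tensor_eq => [u w|u w|q a].
- by rewrite !rmorphD.
- by rewrite !rmorphD.
by rewrite tens_map_pure !emb_tens_pure evK_pure.
Qed.

(** With g' the generic point [gl], [Theta] sends both sides for r in R to the image of r under
    pi(g') pi(g) = pi(g' g). *)
Lemma sol_restriction (A : calg K) (g : G A) (x : tensor (ext_calg iota) A) :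
  tens_map (ext_hom embSE) (algHom_id A)
    ((ep_gal E A (ep_pi E A g) : diffAut iota A) x) =
  sol_aut g (tens_map (ext_hom embSE) (algHom_id A) x).
Proof.
pose s1 : diffAut iota A := ep_gal E A (ep_pi E A g).
rewrite -[ep_gal E A _ : diffAut iota A]/s1.
move: x; apply: tensor_eq => [u w|u w|r a]; [by rewrite !rmorphD|by rewrite !rmorphD|].
rewrite pure_split !rmorphM; congr (_ * _); last first.
  rewrite /= (diffAut_scal s1) !tens_map_pure rmorph1.
  exact/esym/(diffAut_scal (sol_aut g)).
rewrite /= tens_map_pure rmorph1; apply: Theta_inj.
rewrite sol_act_pure rmorph1 mulr1 Theta_translate sol_val_embS evK_embO !gmulfM.
pose s2 : diffAut iota (tens_calg KG A) := ep_gal E _ (ep_pi E _ (gl A)).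
have nat1 : ep_gal E _ (ep_pi E _ (gr g)) = diffAut_map (inr_hom KG A) s1 :> diffAut iota _.
  by rewrite /gr gf_nat; exact: (gf_nat (ep_gal E) (inr_hom KG A)).
have TE w : Theta A (tens_map (ext_hom embSE) (algHom_id A) w) =
    emb_tens e0E (s2 (tens_map (algHom_id (ext_calg iota)) (inr_hom KG A) w)).
  move: w; apply: tensor_eq => [u w|u w|q b]; [by rewrite !rmorphD|by rewrite !rmorphD|].
  rewrite !tens_map_pure [LHS]evS_pure [sol_val _]sol_val_embS evK_embO.
  rewrite [in RHS]pure_split !rmorphM; congr (_ * _).
  by rewrite /= (diffAut_scal s2) emb_tens_pure rmorph1.
rewrite TE; congr (emb_tens e0E _).
have -> : tens_map (algHom_id (ext_calg iota)) (inr_hom KG A) (s1 (@pure _ (ext_calg iota) A r 1)) =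
    diffAut_map (inr_hom KG A) s1 (@pure _ (ext_calg iota) _ r 1).
  by rewrite /= diffAut_ext_pure pure11 mulr1.
by rewrite -nat1.
Qed.

Definition solution : properSolution E :=
  @ProperSolution F E SR iotaS is_PV_S sol_gfiso embS embS_inj embSE sol_restriction.

End Patching.

Theorem theorem2p14
  (F F1 F2 F0 : diffFieldType)
  (i1 : {dmorphism F -> F1}) (i2 : {dmorphism F -> F2})
  (j1 : {dmorphism F1 -> F0}) (j2 : {dmorphism F2 -> F0})
  (diamond : diffDiamond i1 i2 j1 j2)
  (factorization : factorization_property j1 j2)
  (E : diffEmbProblem F) (E_split : ep_split E)
  (e : {dmorphism ep_R E -> F1}) (e_inj : injective e)
  (eE : forall x, e (ep_iota E x) = i1 x)
  (R1 : diffRingType) (iota1 : {dmorphism F1 -> R1}) (R1_PV : is_PV iota1)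
  (R1_gal : gfIso (base_change (constants_map i1) (ep_N E)) (diffGal iota1))
  (e1 : {dmorphism R1 -> F0}) (e1_inj : injective e1)
  (e1E : forall x, e1 (iota1 x) = j1 x) :
  inhabited (properSolution E).
Proof.
have [sec secK] := E_split; apply: inhabits.
exact: (solution diamond factorization secK e_inj eE R1_PV R1_gal e1_inj e1E).
Qed.
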